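(* Consider the Gumbel-max watermark model of the context with $\varepsilon_n\asymp n^{-p}$, and suppose Assumptions (A) and (B) hold with constants $p\ge 0$ and $0\le q\le 1$ satisfying $q+2p<1$. Fix any $\delta>0$, any $s\in[-1,2]$, and any sequence $c_n^+$ with $0\le c_n^+\le 1/n$. Then the Tr-GoF test, which rejects $H_0$ if and only if $n\cdot S_n^+(s)\ge (1+\delta)\log\log n$, has Type I error plus Type II error tending to $0$ as $n\to\infty$.
   Context: Notation: $a_n \asymp b_n$ means there are constants $C_1,C_2>0$ with $C_1 a_n\le b_n\le C_2 a_n$ for all $n$. $\mathcal{W}$ is a finite vocabulary. For a probability vector $\mathbf{P}=(P_w)_{w\in\mathcal{W}}$, $\mu_{1,\mathbf{P}}$ is the distribution on $[0,1]$ with CDF $F_{1,\mathbf{P}}(r)=\sum_w P_w r^{1/P_w}$; $\mu_0=U(0,1)$. Watermark model: for $t=1,\dots,n$ a random next-token distribution $\mathbf{P}_t$ is produced, $\xi_t=(U_{t,w})_{w\in\mathcal{W}}$ has i.i.d. $U(0,1)$ entries, the decoder is $\mathcal{S}(\mathbf{P},\xi)=\arg\max_w \frac{\log U_w}{P_w}$, the observed token is $w_t$ and $Y_t=U_{t,w_t}$. Let $\mathcal{F}_{t-1}=\sigma(\{w_j,\xi_j,\mathbf{P}_{j+1}\}_{j=1}^{t-1})$. Assumption (A): (a) $\xi_1,\dots,\xi_n$ are i.i.d. and $\xi_t$ is independent of $\mathcal{F}_{t-1}$; (b) with probability $\varepsilon_n$, $w_t=\mathcal{S}(\mathbf{P}_t,\xi_t)$;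 otherwise $w_t$ is drawn from $\mathbf{P}_t$ and, conditionally on $\mathcal{F}_{t-1}$, is independent of $\xi_t$. Assumption (B): $\Delta(\mathbf{P}_t):=1-\max_w P_{t,w}=\Delta_n$ for all $t\le n$, with $\Delta_n\asymp n^{-q}$. $H_1^{\mathrm{mix}}$ is the law of $Y_{1:n}$ under this model; $H_0$: $Y_1,\dots,Y_n$ i.i.d. $U(0,1)$. Tr-GoF statistic: set $\mathrm{p}_t=1-Y_t$, sort $\mathrm{p}_{(1)}<\dots<\mathrm{p}_{(n)}$, set $\mathrm{p}_{(n+1)}=1$, and $S_n^+(s)=\sup_{t\in\{1,\dots,n\}:\,\mathrm{p}_{(t+1)}\ge c_n^+} K_s^+(t/n,\mathrm{p}_{(t)})$, where $K_s^+(u,v)=K_s(u,v)$ if $0<v<u<1$ and $K_s^+(u,v)=0$ otherwise, $K_s(u,v)=v\,\phi_s(u/v)+(1-v)\,\phi_s\big(\frac{1-u}{1-v}\big)$, and $\phi_s(x)=x\log x-x+1$ if $s=1$, $\phi_s(x)=\frac{1-s+sx-x^s}{s(1-s)}$ if $s\ne 0,1$, $\phi_s(x)=-\log x+x-1$ if $s=0$. *)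

(* Defs.v *)
From HB Require Import structures.
From mathcomp Require Import all_boot all_order all_algebra.
From mathcomp Require Import all_classical all_reals all_analysis.
Set Implicit Arguments. Unset Strict Implicit. Unset Printing Implicit Defensive.
Import Order.TTheory GRing.Theory Num.Theory.
Import numFieldNormedType.Exports.
Local Open Scope classical_set_scope.
Local Open Scope ring_scope.

Section Defs.
Variable R : realType.

(** [a_n ≍ b_n] : C1 a_n <= b_n <= C2 a_n for all n >= 1 (a_n = n^{-x} is
    undefined at n = 0). *)
Definition asymp (a b : nat -> R) : Prop :=
  exists C1 C2 : R, 0 < C1 /\ 0 < C2 /\
    forall n : nat, (1 <= n)%N -> C1 * a n <= b n <= C2 * a n.

(** P(U <= r) for U ~ U(0,1). *)
Definition clamp01 (r : R) : R := Num.min 1 (Num.max 0 r).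

Definition phi_s (s x : R) : R :=
  if s == 1 then x * ln x - x + 1
  else if s == 0 then - ln x + x - 1
  else (1 - s + s * x - x `^ s) / (s * (1 - s)).

Definition K_s (s u v : R) : R :=
  v * phi_s s (u / v) + (1 - v) * phi_s s ((1 - u) / (1 - v)).

Definition K_s_plus (s u v : R) : R :=
  if (0 < v) && (v < u) && (u < 1) then K_s s u v else 0.

(** Tr-GoF statistic S_n^+(s) for observations y 1, ..., y n, threshold c = c_n^+.
    ps = sorted p-values p_(1) <= ... <= p_(n) (list index t-1 holds p_(t));
    [nth 1 ps n] = 1 = p_(n+1).  The supremum over the finite, nonempty
    (t = n always qualifies since c <= 1) index set is a max; folding with 0
    is harmless since K_s^+ >= 0. *)
Definition tr_gof_stat (n : nat) (c s : R) (y : nat -> R) : R :=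
  let ps := sort <=%R [seq 1 - y t | t <- iota 1 n] in
  \big[Num.max/0]_(1 <= t < n.+1 | c <= nth 1 ps t)
     K_s_plus s (t%:R / n%:R) (nth 1 ps t.-1).

Definition tr_gof_reject (n : nat) (c s delta : R) (y : nat -> R) : Prop :=
  (1 + delta) * ln (ln n%:R) <= n%:R * tr_gof_stat n c s y.

Variable W : finType.

(** Gumbel-max decoder S(P, xi) = argmax_w log(U_w) / P_w, the argmax taken
    over tokens with P_w > 0 (tokens with P_w = 0 have score -oo).
    [w0] is only an irrelevant default making the argmax well-typed. *)
Definition gumbel_dec (w0 : W) (P u : W -> R) : W :=
  Order.arg_max (Order.arg_max w0 xpredT P) (fun w => 0 < P w)
    (fun w => ln (u w) / P w).

(** Generators of F_{t-1} = sigma({w_j, xi_j, P_{j+1}}_{j=1}^{t-1}). *)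
Definition hist_gen (Omega : Type) (U P : nat -> W -> Omega -> R)
    (tok : nat -> Omega -> W) (t : nat) : set (set Omega) :=
  [set A | exists j : nat, (1 <= j < t)%N /\
     ((exists a : W, A = tok j @^-1` [set a]) \/
      (exists (w : W) (r : R), A = [set x | U j w x <= r]) \/
      (exists (w : W) (r : R), A = [set x | P j.+1 w x <= r]))].

Definition xi_rect (Omega : Type) (U : nat -> W -> Omega -> R) (t : nat)
    (r : W -> R) : set Omega :=
  [set x | forall w : W, U t w x <= r w].

End Defs.

(** The Gumbel-max watermark mixture model H_1^mix at sample size n, on a
    probability space Omega, with watermark fraction eps and Delta_n = Delta
    (Assumptions (A) and (B)).
    - wm_U t w = U_{t,w} (xi_t = (U_{t,w})_w),  wm_P t w = P_{t,w},
      wm_tok t = w_t,  wm_wmk t = event "w_t is produced by the watermark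
      decoder" (the probability-eps branch of (b)).  *)
Record wm_model (R : realType) (W : finType) (n : nat) (eps Delta : R) := {
  wm_disp : measure_display;
  wm_Omega : measurableType wm_disp;
  wm_Pr : probability wm_Omega R;
  wm_U : nat -> W -> wm_Omega -> R;
  wm_P : nat -> W -> wm_Omega -> R;
  wm_tok : nat -> wm_Omega -> W;
  wm_wmk : nat -> set wm_Omega;
  wm_U_meas : forall t w, measurable_fun setT (wm_U t w);
  wm_P_meas : forall t w, measurable_fun setT (wm_P t w);
  wm_tok_meas : forall t a, measurable (wm_tok t @^-1` [set a]);
  wm_wmk_meas : forall t, measurable (wm_wmk t);
  wm_P_ge0 : forall t w x, 0 <= wm_P t w x;
  wm_P_sum1 : forall t x, \sum_(w : W) wm_P t w x = 1;
  wm_B : forall t x, (1 <= t <= n)%N ->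
     1 - \big[Num.max/0]_(w : W) wm_P t w x = Delta;
  (* Assumption (A)(a): xi_t has i.i.d. U(0,1) entries and is independent
     of F_{t-1} (hence xi_1, ..., xi_n are i.i.d.) *)
  wm_A_a : forall t, (1 <= t <= n)%N ->
     forall A, <<s hist_gen wm_U wm_P wm_tok t >> A ->
     forall r : W -> R,
       wm_Pr (A `&` xi_rect wm_U t r) =
       (wm_Pr A * (\prod_(w : W) clamp01 (r w))%:E)%E;
  (* (A)(b), mixture indicator: with probability eps, independently of
     F_{t-1} and xi_t *)
  wm_A_b_coin : forall t, (1 <= t <= n)%N ->
     forall A, <<s hist_gen wm_U wm_P wm_tok t >> A ->
     forall r : W -> R,
       wm_Pr (A `&` xi_rect wm_U t r `&` wm_wmk t) =
       (eps%:E * wm_Pr (A `&` xi_rect wm_U t r))%E;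
  wm_A_b_wmk : forall t, (1 <= t <= n)%N ->
     wm_Pr (wm_wmk t `&` [set x | wm_tok t x <>
        gumbel_dec (wm_tok t x) (fun w => wm_P t w x) (fun w => wm_U t w x)])
     = 0%E;
  (* (A)(b), other branch: conditionally on F_{t-1}, w_t ~ P_t and is
     independent of xi_t *)
  wm_A_b_free : forall t, (1 <= t <= n)%N ->
     forall A, <<s hist_gen wm_U wm_P wm_tok t >> A ->
     forall (r : W -> R) (a : W),
       wm_Pr (A `&` xi_rect wm_U t r `&` ~` wm_wmk t `&` wm_tok t @^-1` [set a])
       = (((1 - eps) * \prod_(w : W) clamp01 (r w))%:E *
          \int[wm_Pr]_(x in A) (wm_P t a x)%:E)%E
}.

Definition wm_Y (R : realType) (W : finType) n eps Delta
    (M : @wm_model R W n eps Delta) (t : nat) (x : wm_Omega M) : R :=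
  @wm_U R W n eps Delta M t (@wm_tok R W n eps Delta M t x) x.

(** H0 at sample size n: Y_1, ..., Y_n i.i.d. U(0,1) (joint CDF factorizes). *)
Record null_model (R : realType) (n : nat) := {
  nm_disp : measure_display;
  nm_Omega : measurableType nm_disp;
  nm_Pr : probability nm_Omega R;
  nm_Y : nat -> nm_Omega -> R;
  nm_Y_meas : forall t, measurable_fun setT (nm_Y t);
  nm_iid : forall r : nat -> R,
     nm_Pr [set x | forall t, (1 <= t <= n)%N -> nm_Y t x <= r t] =
     (\prod_(1 <= t < n.+1) clamp01 (r t))%:E
}.

Arguments wm_U {R W n eps Delta} _ _ _ _.
Arguments wm_P {R W n eps Delta} _ _ _ _.
Arguments wm_tok {R W n eps Delta} _ _ _.
Arguments wm_wmk {R W n eps Delta} _ _ _.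
Arguments wm_Y {R W n eps Delta} M t x.
Arguments nm_Y {R n} _ _ _.

(* Main.v *)
Require Import Defs.
From HB Require Import structures.
From mathcomp Require Import all_boot all_order all_algebra.
From mathcomp Require Import all_classical all_reals all_analysis.
From mathcomp Require Import measurable_realfun ring lra.
Import Order.TTheory GRing.Theory Num.Theory.
Import numFieldNormedType.Exports.
Local Open Scope classical_set_scope.
Local Open Scope ring_scope.

(** Type I error.  For [-1 <= s <= 2] and [v < u] the divergence [K_s u v] is at
    most [(u - v)^2 / 2 * (1 / v + 1 / (1 - u))], so it suffices to control the
    one-sided normalised deviation of the empirical distribution function [F_n] of
    the p-values at the scale [(1 + delta) log log n].  [F_n(v) / v] is a reverse
    martingale, so Doob's inequality for its exponential bounds the supremum over a
    geometric block of levels by the Chernoff bound at one end of the block; there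
    are [O(log n)] blocks, and the sharp constant is only needed near the two ends of
    the unit interval.

    Type II error.  Conversely [K_s u v >= (u - v)^2 / (2 u)].  At level
    [v = Delta / 2] a watermarked round has [P(p_t <= v) >= v + Delta / 18] given the
    past: if [M = min_w (- log U_w / P_w)] (a standard exponential variable) then
    [- log Y = P_dec * M], and the tokens other than the most likely one have
    [P_w <= Delta].  A Chernoff bound then makes the number of p-values below [v]
    exceed [n (v + eps Delta / 36)], which yields
    [n K_s >= const * n eps^2 Delta], a positive power of [n].  The first round is
    discarded since [P_1] is not required to be independent of [xi_1]. *)

Set Implicit Arguments.
Unset Strict Implicit.
Unset Printing Implicit Defensive.

(** The range of [s] enters only through [phi_s]: as a function of [ln x] its derivative lies
    between those for [s = -1] and [s = 2], whose [phi_s] are explicit rational functions, so one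
    pair of bounds serves every [s]. With [L = ln (ln n)] there are about [expR L] blocks. Each may
    cost only slightly less than [expR (- L)], and [delta] is the margin that pays at once for the
    block ratio and for the second summand of [1 / v + 1 / (1 - u)]. Away from the ends the number
    of blocks is independent of [n], so any positive multiple of [L] is enough there. Close to an
    end the counts are Poisson-like and the exponent loses a factor [1 + sqrt (2 * x / y)]; this
    affects only [O(L)] blocks, each still costing [expR (- const * sqrt L)]. Levels below [y0 / n]
    are excluded by a union bound on the smallest p-value. Events quantified over all real levels
    are bounded in outer probability; only the rejection event itself has to be measurable. For the
    watermark, conditioning is replaced by quantification over all events [A] of the past, and the
    random [P_t] is frozen on small cubes. *)

Section ExpInequalities.
Variable R : realType.
Implicit Types (x y z a b s l t u v : R).

(** * Exponential inequalities; quadratic bounds for [phi_s] and [K_s] *)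

Lemma is_derive_ge0_ndecr (f df : R -> R) :
  (forall x, is_derive x (1 : R) f (df x)) -> (forall x, 0 <= df x) ->
  {homo f : x y / x <= y}.
Proof.
move=> fdf df0 x y; rewrite le_eqVlt => /predU1P[->//|xy].
have cf : {within `[x, y], continuous f}.
  apply: derivable_within_continuous => z _; exact: ex_derive.
have [c _ fc] := MVT xy (fun z _ => fdf z) cf.
by rewrite -subr_ge0 fc mulr_ge0// subr_ge0 ltW.
Qed.

Lemma is_derive_ge0_ge0 (f df : R -> R) :
  (forall x, is_derive x (1 : R) f (df x)) -> f 0 = 0 ->
  (forall x, 0 <= x -> 0 <= df x) -> forall x, 0 <= x -> 0 <= f x.
Proof.
move=> fdf f0 df0 x; rewrite le_eqVlt => /predU1P[<-|x0]; first by rewrite f0.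
have cf : {within `[0, x], continuous f}.
  apply: derivable_within_continuous => z _; exact: ex_derive.
have [c] := MVT x0 (fun z _ => fdf z) cf.
rewrite in_itv/= f0 subr0 => /andP[c0 _] ->.
by apply: mulr_ge0; [exact/df0/ltW|rewrite subr0 ltW].
Qed.

Lemma is_derive_expRM s y : is_derive y (1 : R) (fun z => expR (s * z)) (s * expR (s * y)).
Proof.
have h : is_derive y (1 : R) (fun z => s * z) s.
  have h0 : is_derive y (1 : R) (s \*: (id : R -> R)) (s *: (1 : R)).
    by typeclasses eauto.
  by apply: is_derive_eq h0 _; rewrite /GRing.scale/= mulr1.
have := @is_derive1_comp _ expR (fun z => s * z) y _ _ (is_derive_expR (s * y)) h.
by rewrite /comp mulrC.
Qed.


(** One family that contains the three closed forms of [phi_s s (expR z)], so that each case of the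
    derivative is a choice of coefficients. *)
Lemma is_derive_expoly c b d c0 s0 c1 s1 c2 s2 y :
  is_derive y (1 : R)
    (fun z => c + b * z + d * (z * expR z) +
      (c0 * expR (s0 * z) + c1 * expR (s1 * z) + c2 * expR (s2 * z)))
    (b + d * (expR y + y * expR y) +
      (c0 * (s0 * expR (s0 * y)) + c1 * (s1 * expR (s1 * y)) +
       c2 * (s2 * expR (s2 * y)))).
Proof.
pose e0 s := fun z : R => expR (s * z).
have de s k : is_derive y (1 : R) (k \*: e0 s) (k *: (s * expR (s * y))).
  have de := is_derive_expRM s y; exact: (@is_deriveZ R R^o R^o _ _ _ _ _ de).
have d1 : is_derive y (1 : R) (cst c) (0 : R) by typeclasses eauto.
have d2 : is_derive y (1 : R) (b \*: (id : R -> R)) (b *: (1 : R)).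
  by typeclasses eauto.
have d3 : is_derive y (1 : R) ((id : R -> R) * (@expR R))
  (y *: expR y + expR y *: 1) by typeclasses eauto.
have d4 : is_derive y (1 : R) (d \*: ((id : R -> R) * (@expR R)))
  (d *: (y *: expR y + expR y *: 1)).
  exact: (@is_deriveZ R R^o R^o _ _ _ _ _ d3).
have df := is_deriveD (is_deriveD (is_deriveD d1 d2) d4)
  (is_deriveD (is_deriveD (de s0 c0) (de s1 c1)) (de s2 c2)).
apply: is_derive_eq df _.
by rewrite /GRing.scale/= !mulr1 add0r (addrC (y * _)).
Qed.

Lemma expRM_le_convex t y : 0 <= t <= 1 -> expR (t * y) <= 1 - t + t * expR y.
Proof.
move=> /andP[t0 t1].
have h1 : expR (t * y) * (1 + (1 - t) * y) <= expR y.
  have -> : expR y = expR (t * y) * expR ((1 - t) * y).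
    by rewrite -expRD; congr expR; ring.
  by rewrite ler_pM2l ?expR_gt0// expR_ge1Dx.
have h2 : expR (t * y) * (1 - t * y) <= 1.
  by rewrite -[leRHS](expRxMexpNx_1 (t * y)) ler_pM2l ?expR_gt0// expR_ge1Dx.
(* Adding [h1] with weight [t] and [h2] with weight [1 - t] cancels the terms linear in [y]. *)
set e := expR (t * y) in h1 h2 *; nra.
Qed.

(* [psi (s - 1) (ln x)] is the derivative of [phi_s s] at [x]. *)
Definition psi a z : R := if a == 0 then z else (expR (a * z) - 1) / a.

Lemma psi_le a z : -2 <= a <= 1 -> psi a z <= expR z - 1.
Proof.
move=> /andP[a2 a1]; rewrite /psi.
have hz := expR_ge1Dx z.
case: (ltgtP a 0) => a0; [|have := @expRM_le_convex a z|]; last by lra.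
  rewrite ler_ndivrMr//; have := expR_ge1Dx (a * z); nra.
move=> h; rewrite ler_pdivrMr//; have /h{h} : 0 <= a <= 1; [lra|nra].
Qed.

Lemma psi_ge a z : -2 <= a <= 1 -> (1 - expR (- (2 * z))) / 2 <= psi a z.
Proof.
move=> /andP[a2 a1]; rewrite /psi.
have hz := expR_ge1Dx (- (2 * z)).
case: (ltgtP a 0) => a0; last by lra.
  rewrite ler_ndivlMr//; have : 0 <= - a / 2 <= 1 by lra.
  move=> /(@expRM_le_convex _ (- (2 * z))).
  have -> : - a / 2 * - (2 * z) = a * z by field.
  nra.
by rewrite ler_pdivlMr//; have := expR_ge1Dx (a * z); nra.
Qed.

Lemma phi_s_1 s : phi_s s 1 = 0 :> R.
Proof.
rewrite /phi_s; case: ifP => _; first by rewrite ln1 mulr0; lra.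
case: ifP => _; first by rewrite ln1; lra.
rewrite powR1 (_ : 1 - s + s * 1 - 1 = 0) ?mul0r//; ring.
Qed.

Lemma phi_s_expR s z : phi_s s (expR z) =
  if s == 1 then expR z * z - expR z + 1
  else if s == 0 then - z + expR z - 1
  else (1 - s + s * expR z - expR (s * z)) / (s * (1 - s)).
Proof. by rewrite /phi_s expRK -expRM (mulrC z). Qed.

(** In the variable [z = ln x] the dependence on [s] is confined to the factor [psi (s - 1) z],
    which can be compared between different [s]. *)
Lemma is_derive_phi_s s z :
  is_derive z (1 : R) (fun y => phi_s s (expR y)) (expR z * psi (s - 1) z).
Proof.
have exps : expR z * expR ((s - 1) * z) = expR (s * z).
  by rewrite -expRD; congr expR; ring.
rewrite (_ : (fun y => _) = fun y => 
  if s == 1 then expR y * y - expR y + 1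
  else if s == 0 then - y + expR y - 1
  else (1 - s + s * expR y - expR (s * y)) / (s * (1 - s))); last first.
  by apply/funext => y; rewrite phi_s_expR.
rewrite /psi subr_eq0; case: (eqVneq s 1) => [s1|s1].
  have := is_derive_expoly 1 0 1 (-1) 1 0 0 0 0 z.
  rewrite (_ : (fun z => _) = fun y => expR y * y - expR y + 1); last first.
    by apply/funext => y; rewrite !mul1r; ring.
  move=> h; apply: is_derive_eq h _; rewrite !mul1r; ring.
case: (eqVneq s 0) => [s0|s0].
  have := is_derive_expoly (-1) (-1) 0 1 1 0 0 0 0 z.
  rewrite (_ : (fun z => _) = fun y => - y + expR y - 1); last first.
    by apply/funext => y; rewrite !mul1r; ring.
  move=> h; apply: is_derive_eq h _; rewrite !mul1r s0 sub0r mulN1r expRN.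
  have := expR_gt0 z => /lt0r_neq0 ez; field; exact: ez.
have s1' : s - 1 != 0 by rewrite subr_eq0.
have s1'' : 1 - s != 0 by rewrite subr_eq0 eq_sym.
have := is_derive_expoly ((1 - s) / (s * (1 - s))) 0 0 (s / (s * (1 - s))) 1
   (- 1 / (s * (1 - s))) s 0 0 z.
rewrite (_ : (fun z => _) = fun y => (1 - s + s * expR y - expR (s * y)) / (s * (1 - s))); last first.
  by apply/funext => y; rewrite !mul1r; field; rewrite s1''.
move=> h; apply: is_derive_eq h _; rewrite !mul1r -exps.
by field; rewrite s0 s1' s1''.
Qed.

(** All [phi_s] vanish at 1, that is at [z = 0]; a monotone difference therefore orders two of them
    on either side of 1, in opposite directions. *)
Lemma phi_s_ndecrB s t :
  (forall z, psi (s - 1) z <= psi (t - 1) z) ->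
  {homo (fun y => phi_s t (expR y) - phi_s s (expR y)) : x y / x <= y}.
Proof.
move=> st; apply: (@is_derive_ge0_ndecr _ (fun z => expR z * psi (t - 1) z - expR z * psi (s - 1) z)).
  by move=> x; apply: is_deriveB (is_derive_phi_s t x) (is_derive_phi_s s x).
by move=> x; rewrite -mulrBr mulr_ge0 ?expR_ge0// subr_ge0.
Qed.

Lemma phi_s2E x : 0 <= x -> phi_s 2 x = (x - 1) ^+ 2 / 2 :> R.
Proof.
move=> x0; rewrite /phi_s ifF; last by apply/eqP; lra.
rewrite ifF; last by apply/eqP; lra.
by rewrite powR_mulrn//; field.
Qed.

Lemma phi_sN1E x : 0 < x -> phi_s (-1) x = (x - 1) ^+ 2 / (2 * x) :> R.
Proof.
move=> x0; rewrite /phi_s ifF; last by apply/eqP; lra.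
rewrite ifF; last by apply/eqP; lra.
by rewrite powR_inv1 1?ltW//; field; rewrite gt_eqF.
Qed.

Let psi2 z : psi (2 - 1) z = expR z - 1.
Proof. by rewrite /psi (_ : 2 - 1 = 1 :> R) ?oner_eq0 ?divr1 ?mul1r//; lra. Qed.

Let psiN1 z : psi (-1 - 1) z = (1 - expR (- (2 * z))) / 2.
Proof.
rewrite /psi ifF; last by apply/eqP; lra.
by rewrite (_ : (-1 - 1) * z = - (2 * z)); [field|ring].
Qed.

Lemma phi_s_le2 s x : -1 <= s <= 2 -> 1 <= x -> phi_s s x <= phi_s 2 x.
Proof.
move=> hs x1; have x0 : x \is Num.pos by rewrite posrE; lra.
have /(_ _) := @phi_s_ndecrB s 2; rewrite -(lnK x0) => /(_ _ 0 (ln x) (ln_ge0 x1)).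
by rewrite expR0 !phi_s_1 subrr subr_ge0; apply=> z; rewrite psi2 psi_le//; lra.
Qed.

Lemma phi_s_ge2 s x : -1 <= s <= 2 -> 0 < x <= 1 -> phi_s 2 x <= phi_s s x.
Proof.
move=> hs /andP[x0' x1]; have x0 : x \is Num.pos by rewrite posrE.
have /(_ _) := @phi_s_ndecrB s 2; rewrite -(lnK x0) => /(_ _ (ln x) 0 (ln_le0 x1)).
by rewrite expR0 !phi_s_1 subrr subr_le0; apply=> z; rewrite psi2 psi_le//; lra.
Qed.

Lemma phi_s_geN1 s x : -1 <= s <= 2 -> 1 <= x -> phi_s (-1) x <= phi_s s x.
Proof.
move=> hs x1; have x0 : x \is Num.pos by rewrite posrE; lra.
have /(_ _) := @phi_s_ndecrB (-1) s; rewrite -(lnK x0) => /(_ _ 0 (ln x) (ln_ge0 x1)).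
by rewrite expR0 !phi_s_1 subrr subr_ge0; apply=> z; rewrite psiN1 psi_ge//; lra.
Qed.

Lemma phi_s_leN1 s x : -1 <= s <= 2 -> 0 < x <= 1 -> phi_s s x <= phi_s (-1) x.
Proof.
move=> hs /andP[x0' x1]; have x0 : x \is Num.pos by rewrite posrE.
have /(_ _) := @phi_s_ndecrB (-1) s; rewrite -(lnK x0) => /(_ _ (ln x) 0 (ln_le0 x1)).
by rewrite expR0 !phi_s_1 subrr subr_le0; apply=> z; rewrite psiN1 psi_ge//; lra.
Qed.

(** Since [u / v >= 1 >= (1 - u) / (1 - v)], the worst cases are [phi_s 2] in the first term and
    [phi_s (-1)] in the second. Hence the denominators: the level [v] at the low end, but the
    empirical [1 - u] at the high end. *)
Lemma K_s_ub s u v : -1 <= s <= 2 -> 0 < v -> v < u -> u < 1 ->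
  K_s s u v <= (u - v) ^+ 2 / 2 * (v^-1 + (1 - u)^-1).
Proof.
move=> hs v0 vu u1; rewrite /K_s.
have uv1 : 1 <= u / v by rewrite ler_pdivlMr// mul1r ltW.
have uv2 : 0 < (1 - u) / (1 - v) <= 1.
  by apply/andP; split; [apply: divr_gt0; lra|rewrite ler_pdivrMr; lra].
have := phi_s_le2 hs uv1; rewrite phi_s2E; last by lra.
have := phi_s_leN1 hs uv2; rewrite phi_sN1E; last by lra.
rewrite -(ler_pM2l (_ : 0 < 1 - v)); last by lra.
move=> h1; rewrite -(ler_pM2l v0) => h2.
apply: le_trans (lerD h2 h1) _; rewrite le_eqVlt; apply/orP; left; apply/eqP.
by field; rewrite !gt_eqF//; lra.
Qed.

(** The first term is compared with [phi_s (-1)]; the second is dropped, being at least a multiple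
    of the square [phi_s 2]. *)
Lemma K_s_lb s u v : -1 <= s <= 2 -> 0 < v -> v < u -> u < 1 ->
  (u - v) ^+ 2 / (2 * u) <= K_s s u v.
Proof.
move=> hs v0 vu u1; rewrite /K_s.
have uv1 : 1 <= u / v by rewrite ler_pdivlMr// mul1r ltW.
have uv2 : 0 < (1 - u) / (1 - v) <= 1.
  by apply/andP; split; [apply: divr_gt0; lra|rewrite ler_pdivrMr; lra].
have := phi_s_geN1 hs uv1; rewrite phi_sN1E; last by lra.
have := phi_s_ge2 hs uv2; rewrite phi_s2E; last by lra.
move=> h1; rewrite -(ler_pM2l v0) => h2.
have {}h1 : 0 <= (1 - v) * phi_s s ((1 - u) / (1 - v)).
  apply: mulr_ge0; first lra.
  by apply: le_trans h1; rewrite divr_ge0// sqr_ge0.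
rewrite -[leLHS]addr0; apply: lerD => //; apply: le_trans h2.
rewrite le_eqVlt; apply/orP; left; apply/eqP.
by field; rewrite !gt_eqF//; lra.
Qed.

Lemma expRN_le_quad l : 0 <= l -> expR (- l) <= 1 - l + l ^+ 2 / 2.
Proof.
move=> l0; rewrite -subr_ge0.
have e2 t : 0 <= t -> 0 <= t - 1 + expR (- t).
  by move=> _; have := expR_ge1Dx (- t); lra.
have h y := is_derive_expoly 1 (-1) 0 (-1) (-1) 0 0 0 0 y.
have d y : is_derive y (1 : R) (fun z => 1 - z + z ^+ 2 / 2 - expR (- z)) (y - 1 + expR (- y)).
  have -> : (fun z : R => 1 - z + z ^+ 2 / 2 - expR (- z)) =
    ((fun z => 1 + -1 * z + 0 * (z * expR z) + (-1 * expR (-1 * z) + 0 * expR (0 * z) + 0 * expR (0 * z))) +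
     (2^-1 \*: ((id : R -> R) * (id : R -> R)))).
    apply/funext => z /=; rewrite !fctE/= mulN1r /GRing.scale/=. by field.
  have h2 : is_derive y (1 : R) (2^-1 \*: ((id : R -> R) * (id : R -> R)))
      (2^-1 *: (y *: 1 + y *: 1)) by typeclasses eauto.
  apply: is_derive_eq (is_deriveD (h y) h2) _.
  by rewrite (mulN1r y) /GRing.scale/=; field.
have := is_derive_ge0_ge0 d _ e2 l0; apply.
by rewrite oppr0 expR0; ring.
Qed.

(** The Poisson rate function on the right is [phi_s 1 a] and the left side is [phi_s (-1) a]. *)
Lemma xlnx_ge a : 1 <= a -> (a - 1) ^+ 2 / (2 * a) <= a * ln a - a + 1.
Proof.
move=> a1; have a0 : 0 < a by lra.
have hs1 : -1 <= (1 : R) <= 2 by lra.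
have := phi_s_geN1 hs1 a1; rewrite phi_sN1E// /phi_s eqxx.
by [].
Qed.

End ExpInequalities.

(** * Doob's maximal inequality for multinomial counts *)

Section FiniteMaximalInequality.
Variables (R : realType) (n m : nat) (w : 'I_m.+1 -> R).
Hypothesis w_ge0 : forall j, 0 <= w j.
Hypothesis w0_gt0 : 0 < w ord0.
Hypothesis w_sum1 : \sum_j w j = 1.

Let g (i : 'I_m.+1) : R := \sum_(j < m.+1 | (j <= i)%N) w j.
Let N (c : {ffun 'I_n -> 'I_m.+1}) (i : 'I_m.+1) : nat :=
  (\sum_(t < n) (c t <= i)%N)%N.

Let merge (i j : 'I_m.+1) : 'I_m.+1 := if (j <= i)%N then i else j.

Let merge_le (i j k : 'I_m.+1) : (i <= k)%N -> (merge i j <= k)%N = (j <= k)%N.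
Proof.
move=> ik; rewrite /merge; case: ifP => // ji.
by rewrite ik (leq_trans ji ik).
Qed.

Let g_ge (i : 'I_m.+1) : w ord0 <= g i.
Proof.
rewrite /g (bigD1 ord0)//= lerDl; apply: sumr_ge0 => *; exact: w_ge0.
Qed.

(** Image of a product weight under merging: an event that sees the trials only after merging can be
    summed over merged configurations, which again carry a product weight. *)
Let sum_merge (i : 'I_m.+1) (C : pred {ffun 'I_n -> 'I_m.+1}) (h : 'I_m.+1 -> R) :
  (forall c d : {ffun 'I_n -> 'I_m.+1}, (forall t, merge i (c t) = d t) -> C c = C d) ->
  \sum_(c | C c) \prod_t h (c t) =
  \sum_(d | C d) \prod_t \sum_(j | merge i j == d t) h j.
Proof.
move=> hC; pose M (c : {ffun 'I_n -> 'I_m.+1}) := [ffun t => merge i (c t)].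
rewrite (partition_big M C)/=; last first.
  by move=> c; rewrite (hC c (M c))// => t; rewrite ffunE.
apply: eq_bigr => d Cd.
rewrite (bigA_distr_big_dep (fun t j => merge i j == d t))/=.
apply: eq_bigl => c; apply/idP/idP.
  move=> /andP[_ /eqP <-]; apply/familyP => t.
  by rewrite unfold_in ffunE.
move=> /familyP h1; have Mc : M c = d.
  by apply/ffunP => t; rewrite ffunE; apply/eqP; exact: h1 t.
rewrite Mc eqxx andbT (hC c d)// => t.
by rewrite -Mc ffunE.
Qed.

(* Doob's inequality for the reverse martingale [N c i / g i]: the sum is split
   according to the last crossing index [i], and the cells [0, ..., i] are
   merged, which conditions on the history down to level [i]. *)
Lemma finite_maximal (lam b kap : R) : 0 <= kap ->
  \sum_(c : {ffun 'I_n -> 'I_m.+1} | [exists i, b * g i - kap <= lam * (N c i)%:R])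
     \prod_t w (c t)
  <= expR (kap - b * w ord0) * (1 + (expR lam - 1) * w ord0) ^+ n.
Proof.
move=> kap0.
(* Tilting cell 0 by [expR lam] turns the moment generating function of [N c ord0] into a plain sum
   of products. *)
pose f j := w j * (if j == ord0 then expR lam else 1).
have f_ge0 j : 0 <= f j.
  by rewrite /f mulr_ge0// ?w_ge0//; case: ifP => _; rewrite ?expR_ge0.
pose A i (c : {ffun 'I_n -> 'I_m.+1}) := b * g i - kap <= lam * (N c i)%:R.
pose C i (c : {ffun 'I_n -> 'I_m.+1}) :=
  A i c && [forall j : 'I_m.+1, (i < j)%N ==> ~~ A j c].
have NM (i k : 'I_m.+1) (c d : {ffun 'I_n -> 'I_m.+1}) :
    (i <= k)%N -> (forall t, merge i (c t) = d t) -> N c k = N d k.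
  by move=> ik h; apply: eq_bigr => t _; rewrite -h merge_le.
have CM i (c d : {ffun 'I_n -> 'I_m.+1}) :
    (forall t, merge i (c t) = d t) -> C i c = C i d.
  move=> h; rewrite /C /A (NM i i c d)//; congr (_ && _).
  apply: eq_forallb => j; case: ltnP => //= ij.
  by rewrite (NM i j c d)// ltnW.
have Cexcl i j c : C i c -> C j c -> i = j.
  move=> /andP[Ai /forallP fi] /andP[Aj /forallP fj].
  apply/val_inj; case: (ltngtP i j) => // ij.
    by have := fi j; rewrite ij Aj.
  by have := fj i; rewrite ij Ai.
have Cex c : [exists i, A i c] -> exists i, C i c.
  move=> /existsP[i0 Ai0]; exists [arg max_(i > i0 | A i c) (i : nat)].
  case: arg_maxnP => // i Ai mi; rewrite /C Ai/=.
  apply/forallP => j; apply/implyP => ij; apply/negP => /mi.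
  by rewrite /geq/= leqNgt ij.
have sumf : \sum_j f j = 1 + (expR lam - 1) * w ord0.
  have := w_sum1; rewrite (bigD1 ord0)//= => s1.
  rewrite (bigD1 ord0)//= {1}/f eqxx (eq_bigr w); first lra.
  by move=> j /negPf j0; rewrite /f j0 mulr1.
have -> : (1 + (expR lam - 1) * w ord0) ^+ n =
    \sum_(c : {ffun 'I_n -> 'I_m.+1}) \prod_t f (c t).
  rewrite -sumf -(bigA_distr_bigA (fun (_ : 'I_n) j => f j)) /=.
  by rewrite prodr_const card_ord.
rewrite expRB mulrAC ler_pdivlMr ?expR_gt0// mulrC.
have prod_ge0 (h : 'I_m.+1 -> R) (c : {ffun 'I_n -> 'I_m.+1}) :
    (forall j, 0 <= h j) -> 0 <= \prod_t h (c t).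
  by move=> h0; apply: prodr_ge0 => *; exact: h0.
have crossing i : expR (b * w ord0) * (\sum_(c | C i c) \prod_t w (c t)) <=
    expR kap * \sum_(c | C i c) \prod_t f (c t).
  (* After merging, a trial in the cells up to [i] is in cell 0 with conditional weight
     [th = w ord0 / g i]. Jensen's inequality, [expR (lam * th) <= 1 - th + th * expR lam], is the
     submartingale step from level [i] down to level 0. *)
  rewrite !(@sum_merge i (C i)); try exact: CM.
  rewrite !mulr_sumr; apply: ler_sum => d /andP[Ad _].
  pose th := w ord0 / g i.
  have gi0 : 0 < g i by apply: lt_le_trans (g_ge i).
  have th01 : 0 <= th <= 1.
    by apply/andP; split; [rewrite divr_ge0// ltW|rewrite ler_pdivrMr// mul1r g_ge].
  have step j : (\sum_(k | merge i k == j) w k) * expR (lam * th * (j <= i)%N%:R) <=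
      \sum_(k | merge i k == j) f k.
    case: (ltngtP j i) => ij.
    - have e0 : (fun k => merge i k == j) =1 pred0.
        move=> k; rewrite /merge; case: ifP => ki; apply/negP => /eqP kj;
          move: ij; rewrite -kj ?ltnn// => ik.
        by rewrite (ltnW ik) in ki.
      by rewrite !(big_pred0 _ _ _ _ e0) mul0r.
    - rewrite mulr0 expR0 mulr1; apply: ler_sum => k /eqP kj.
      rewrite /f ifF ?mulr1//; apply/eqP => k0; move: kj ij.
      by rewrite k0 /merge leq0n => <-; rewrite ltnn.
    - have -> : j = i by apply/val_inj.
      have sm h : \sum_(k | merge i k == i) h k = \sum_(k < m.+1 | (k <= i)%N) h k :> R.
        apply: eq_bigl => k; rewrite /merge; case: ifP => ki; first by rewrite eqxx.
        by apply/eqP => kj; rewrite kj leqnn in ki.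
      rewrite !sm -/(g i) mulr1.
      have -> : \sum_(k < m.+1 | (k <= i)%N) f k = g i * (1 - th + th * expR lam).
        rewrite /g (bigD1 ord0)//= /f eqxx.
        rewrite (eq_bigr w); last by move=> k /andP[_ /negPf ->]; rewrite mulr1.
        have -> : \sum_(k < m.+1 | (k <= i)%N && (k != ord0)) w k = g i - w ord0.
          by rewrite /g [in RHS](bigD1 ord0)//= addrAC subrr add0r.
        by rewrite -/(g i) /th; field; rewrite gt_eqF.
      by rewrite ler_pM2l// mulrC expRM_le_convex.
  apply: (@le_trans _ _ (expR kap * \prod_t ((\sum_(k | merge i k == d t) w k) *
     expR (lam * th * (d t <= i)%N%:R)))); last first.
    rewrite ler_pM2l ?expR_gt0//; apply: ler_prod => t _.
    by rewrite step andbT mulr_ge0 ?expR_ge0// sumr_ge0.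
  rewrite big_split/= mulrCA mulrC ler_wpM2l//.
    by apply: prodr_ge0 => t _; rewrite sumr_ge0.
  rewrite -expR_sum -expRD ler_expR -mulr_sumr -natr_sum -/(N d i).
  have := Ad; rewrite /A => AA.
  (* Multiplying the crossing inequality at [i] by [th] carries it to level 0; [kap] shrinks to
     [th * kap <= kap]. *)
  have -> : b * w ord0 = th * (b * g i) by rewrite /th; field; rewrite gt_eqF.
  have /andP[th0 th1] := th01.
  have := ler_wpM2l th0 AA; nra.
have h1 : \sum_(c : {ffun 'I_n -> 'I_m.+1} | [exists i, A i c]) \prod_t w (c t) <=
    \sum_i \sum_(c | C i c) \prod_t w (c t).
  rewrite (exchange_big_dep predT)//= [leRHS](bigID (fun c => [exists i, A i c]))/=.
  apply: ler_wpDr.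
    by apply: sumr_ge0 => c _; apply: sumr_ge0 => i _; exact: prod_ge0.
  apply: ler_sum => c /Cex[i Ci]; rewrite (bigD1 i)//= lerDl.
  by apply: sumr_ge0 => *; exact: prod_ge0.
have h2 : \sum_i \sum_(c | C i c) \prod_t f (c t) <=
    \sum_(c : {ffun 'I_n -> 'I_m.+1}) \prod_t f (c t).
  rewrite (exchange_big_dep predT)//=; apply: ler_sum => c _.
  have [/existsP[i Ci]|/existsPn nC] := boolP [exists i, C i c].
    rewrite (big_pred1 i)// => j; apply/idP/eqP => [Cj|->//].
    exact: Cexcl Cj Ci.
  by rewrite big_pred0 ?prod_ge0// => i; apply/negbTE/nC.
apply: le_trans (ler_wpM2l (expR_ge0 _) h1) _.
apply: le_trans (ler_wpM2l (expR_ge0 kap) h2).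
by rewrite !mulr_sumr; apply: ler_sum => i _; exact: crossing.
Qed.

End FiniteMaximalInequality.

(** * Real-valued probabilities and outer bounds *)

Section RealProbability.
Context {d : measure_display} {R : realType} {T : measurableType d}.
Variable P : probability T R.
Implicit Types (A B : set T).

Definition pr A : R := fine (P A).

Lemma prE A : measurable A -> P A = (pr A)%:E.
Proof. by move=> mA; rewrite /pr fineK// fin_num_measure. Qed.

Lemma pr_ge0 A : 0 <= pr A.
Proof. by rewrite /pr fine_ge0. Qed.

Lemma pr_setT : pr setT = 1.
Proof. by rewrite /pr probability_setT. Qed.

Lemma pr_set0 : pr set0 = 0.
Proof. by rewrite /pr measure0. Qed.

Lemma pr_le A B : measurable A -> measurable B -> A `<=` B -> pr A <= pr B.
Proof.
by move=> mA mB AB; rewrite -lee_fin -!prE// le_measure// inE.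
Qed.

Lemma prUle A B : measurable A -> measurable B -> pr (A `|` B) <= pr A + pr B.
Proof.
move=> mA mB; rewrite -lee_fin EFinD -!prE//; last exact: measurableU.
exact: measureU2.
Qed.

Lemma prDI A B : measurable A -> measurable B ->
  pr A = pr (A `\` B) + pr (A `&` B).
Proof.
move=> mA mB; apply: EFin_inj; rewrite EFinD -!prE//; first exact: measureDI.
  exact: measurableI.
exact: measurableD.
Qed.

Lemma pr_setC A : measurable A -> pr (~` A) = 1 - pr A.
Proof.
by move=> mA; rewrite -pr_setT (@prDI setT A)// setTI setTD addrK.
Qed.

Lemma pr_bigsetU_le (I : Type) (r : seq I) (Q : pred I) (F : I -> set T) :
  (forall i, measurable (F i)) ->
  pr (\big[setU/set0]_(i <- r | Q i) F i) <= \sum_(i <- r | Q i) pr (F i).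
Proof.
move=> mF; elim: r => [|i r ih]; first by rewrite !big_nil pr_set0.
rewrite !big_cons; case: ifP => // _.
apply: le_trans (prUle _ _) _ => //; first exact: bigsetU_measurable.
by rewrite lerD2l.
Qed.

Lemma bigsetU_seqE (I : eqType) (r : seq I) (Q : pred I) (F : I -> set T) x :
  (\big[setU/set0]_(i <- r | Q i) F i) x <-> exists i, [/\ i \in r, Q i & F i x].
Proof.
elim: r => [|i r ih]; first by rewrite big_nil; split => // -[i []].
rewrite big_cons; case: ifPn => Qi; split.
- move=> [Fx|/ih[j [jr Qj Fj]]]; first by exists i; rewrite mem_head.
  by exists j; rewrite in_cons jr orbT.
- move=> [j []]; rewrite in_cons => /predU1P[->|jr] Qj Fj; first by left.
  by right; apply/ih; exists j.
- by move=> /ih[j [jr Qj Fj]]; exists j; rewrite in_cons jr orbT.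
- move=> [j []]; rewrite in_cons => /predU1P[->|jr] Qj Fj; first by rewrite Qj in Qi.
  by apply/ih; exists j.
Qed.

Lemma pr_fin_sub (I : finType) (Q : pred I) (F : I -> set T) A :
  measurable A -> (forall i, measurable (F i)) ->
  (forall x, A x -> exists2 i, Q i & F i x) ->
  pr A <= \sum_(i | Q i) pr (F i).
Proof.
move=> mA mF AF; apply: le_trans (pr_bigsetU_le _ _ mF).
apply: pr_le => //; first exact: bigsetU_measurable.
move=> x /AF[i Qi Fi]; apply/bigsetU_seqE; exists i; split => //.
Qed.

Lemma pr_fin_partition (I : finType) (F : I -> set T) A :
  measurable A -> (forall i, measurable (F i)) ->
  (forall x, A x -> exists i, F i x) ->
  (forall i, F i `<=` A) ->
  (forall i j x, F i x -> F j x -> i = j) ->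
  pr A = \sum_i pr (F i).
Proof.
move=> mA mF AF FA Fdisj.
have dis (r : seq I) : uniq r ->
    pr (\big[setU/set0]_(i <- r) F i) = \sum_(i <- r) pr (F i).
  elim: r => [|i r ih]/=; first by rewrite !big_nil pr_set0.
  move=> /andP[ir ur]; rewrite !big_cons -ih//.
  rewrite (@prDI (F i `|` \big[setU/set0]_(j <- r) F j) (F i))//; last first.
    by apply: measurableU => //; exact: bigsetU_measurable.
  rewrite addrC; congr (pr _ + pr _); apply/seteqP; split => x.
  - by move=> [].
  - by move=> Fx; split => //; left.
  - by move=> [[|]].
  - move=> h; split; first by right.
    move=> Fi; move/bigsetU_seqE : h => [j [jr _ Fj]].
    by move: ir; rewrite (Fdisj _ _ _ Fi Fj) jr.
rewrite -dis ?index_enum_uniq//; congr pr; apply/seteqP; split => x.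
  move=> /AF[i Fi]; apply/bigsetU_seqE; exists i; split => //.
by move=> /bigsetU_seqE[i [_ _]]; exact: FA.
Qed.

(* [outer_le S q]: the outer probability of the possibly non-measurable set
   [S] is at most [q]. *)
Definition outer_le (S : set T) (q : R) :=
  forall e, 0 < e -> exists B, [/\ measurable B, S `<=` B & pr B <= q + e].

Lemma outer_leU S1 S2 q1 q2 : outer_le S1 q1 -> outer_le S2 q2 ->
  outer_le (S1 `|` S2) (q1 + q2).
Proof.
move=> h1 h2 e e0; have e20 : 0 < e / 2 by rewrite divr_gt0.
have [B1 [mB1 SB1 p1]] := h1 _ e20; have [B2 [mB2 SB2 p2]] := h2 _ e20.
exists (B1 `|` B2); split; [exact: measurableU|exact: setUSS|].
apply: le_trans (prUle mB1 mB2) _; lra.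
Qed.

Lemma outer_le0 q : 0 <= q -> outer_le set0 q.
Proof. by move=> q0 e e0; exists set0; split => //; rewrite pr_set0; lra. Qed.

Lemma outer_le_bigU (I : Type) (r : seq I) (S : I -> set T) (q : I -> R) :
  (forall i, outer_le (S i) (q i)) ->
  outer_le (\big[setU/set0]_(i <- r) S i) (\sum_(i <- r) q i).
Proof.
move=> h; elim: r => [|i r ih]; first by rewrite !big_nil; exact: outer_le0.
by rewrite !big_cons; exact: outer_leU.
Qed.

Lemma outer_leS S1 S2 q1 q2 : S1 `<=` S2 -> q2 <= q1 ->
  outer_le S2 q2 -> outer_le S1 q1.
Proof.
move=> S12 q21 h e /h[B [mB SB pB]]; exists B; split => //.
  exact: subset_trans SB.
by apply: le_trans pB _; rewrite lerD2r.
Qed.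

Lemma outer_le_pr S q : measurable S -> outer_le S q -> pr S <= q.
Proof.
move=> mS h; apply/ler_addgt0Pr => e /h[B [mB SB pB]].
by apply: le_trans pB; exact: pr_le.
Qed.

Lemma pr_outer_le S q : measurable S -> pr S <= q -> outer_le S q.
Proof. by move=> mS Sq e e0; exists S; split => //; lra. Qed.

End RealProbability.

(** Serves to let a mesh width tend to zero: the factor paid for rounding to the mesh is absorbed in
    [e]. *)
Lemma expR_div_small (R : realType) (c q e : R) : 0 <= c -> 0 <= q -> 0 < e ->
  exists m, expR (c / m.+1%:R) * q <= q + e.
Proof.
move=> c0; rewrite le_eqVlt => /predU1P[<-|q0] e0.
  by exists 0%N; rewrite mulr0 add0r ltW.
pose l := ln (1 + e / q).
have eq0 : 0 < e / q by rewrite divr_gt0.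
have l0 : 0 < l by rewrite ln_gt0// ltrDl.
exists (Num.bound (c / l)).
have cl : c / (Num.bound (c / l)).+1%:R <= l.
  rewrite ler_pdivrMr// mulrC -ler_pdivrMr//; apply: ltW.
  apply: lt_le_trans (archi_boundP _) _; first by rewrite divr_ge0// ltW.
  by rewrite ler_nat.
apply: (@le_trans _ _ (expR l * q)).
  by rewrite ler_pM2r// ler_expR.
by rewrite /l lnK ?posrE ?addr_gt0// mulrDl mul1r divfK// gt_eqF.
Qed.

Lemma measurable_fin_forall {d : measure_display} {T : measurableType d}
    (I : finType) (F : I -> set T) :
  (forall i, measurable (F i)) -> measurable [set x | forall i, F i x].
Proof.
move=> mF; rewrite (_ : [set x | _] = \big[setI/setT]_i F i).
  by apply: bigsetI_measurable.
apply/seteqP; split => x /=.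
  by move=> h; elim/big_ind : _ => // A B; split.
by move=> h i; move: h; rewrite (bigD1 i)//= => -[].
Qed.

(** * Maximal inequalities over all levels, by discretisation *)

Section Levels.
Context {d : measure_display} {R : realType} {T : measurableType d}.
Variables (P : probability T R) (n : nat) (below : 'I_n -> R -> T -> bool).
Hypothesis below_mono : forall t x, {homo (fun g => below t g x) : g g' / g <= g' >-> g ==> g'}.
Hypothesis below_meas : forall t g, measurable [set x | below t g x].
Hypothesis below_box : forall lo hi : 'I_n -> R,
  (forall t, 0 <= lo t /\ lo t <= hi t /\ hi t <= 1) ->
  pr P [set x | forall t, below t (hi t) x /\ ~~ below t (lo t) x] =
  \prod_t (hi t - lo t).

Let box_meas (lo hi : 'I_n -> R) :
  measurable [set x | forall t, below t (hi t) x /\ ~~ below t (lo t) x].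
Proof.
apply: measurable_fin_forall => t; apply: measurableI; first exact: below_meas.
rewrite (_ : (fun x => _) = ~` [set x | below t (lo t) x]); last first.
  by apply/seteqP; split => x /= /negP.
exact/measurableC/below_meas.
Qed.

Let cnt g x : nat := (\sum_(t < n) below t g x)%N.

Section Grid.
Variables (v0 : R) (m : nat).
Hypotheses (v0_gt0 : 0 < v0) (v0_lt1 : v0 < 1).

Definition grid (i : nat) : R := v0 + (1 - v0) * i%:R / m.+1%:R.

Lemma grid0 : grid 0 = v0.
Proof. by rewrite /grid mulr0 mul0r addr0. Qed.

Lemma gridm : grid m.+1 = 1.
Proof. by rewrite /grid mulfK// addrC subrK. Qed.

Lemma gridS i : grid i.+1 = grid i + (1 - v0) / m.+1%:R.
Proof. rewrite /grid -[i.+1%:R]natr1; field; rewrite ?nat1r ?natr1 ?pnatr_eq0//. Qed.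

Lemma grid_step_ge0 : 0 <= (1 - v0) / m.+1%:R.
Proof. by rewrite divr_ge0// subr_ge0 ltW. Qed.

Lemma grid_step_le : (1 - v0) / m.+1%:R <= m.+1%:R^-1.
Proof. by rewrite ler_piMl ?invr_ge0// gerBl ltW. Qed.

Lemma grid_homo i j : (i <= j)%N -> grid i <= grid j.
Proof.
move=> ij; rewrite /grid lerD2l ler_pM2r ?invr_gt0//.
by apply: ler_wpM2l; rewrite ?ler_nat// subr_ge0 ltW.
Qed.

Let w (j : 'I_m.+2) : R := if j == ord0 then v0 else (1 - v0) / m.+1%:R.

Let lo (j : nat) : R := if j is k.+1 then grid k else 0.

Let w_lohi (j : 'I_m.+2) : w j = grid j - lo j.
Proof.
rewrite /w /lo; case: j => -[|j] ? /=; first by rewrite grid0 subr0.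
by rewrite gridS; ring.
Qed.

Let sum_w (i : 'I_m.+2) : \sum_(j < m.+2 | (j <= i)%N) w j = grid i.
Proof.
rewrite (eq_bigr (fun j : 'I_m.+2 => grid j - lo j)); last by move=> *; exact: w_lohi.
transitivity (\sum_(0 <= j < i.+1) (grid j - lo j)).
  rewrite big_mkord (big_ord_widen m.+2 (fun j => grid j - lo j) (ltn_ord i)).
  by apply: eq_bigl => j; rewrite ltnS.
elim: (i : nat) => [|k ih]; first by rewrite big_nat1/= subr0.
by rewrite big_nat_recr//= ih; ring.
Qed.

Let exists_cell t x : below t 1 x -> ~~ below t 0 x ->
  exists j : 'I_m.+2, below t (grid j) x /\ ~~ below t (lo j) x.
Proof.
move=> b1 b0; have ex : exists j, below t (grid j) x by exists m.+1; rewrite gridm.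
case: (ex_minnP ex) => j bj minj.
have jm : (j < m.+2)%N by rewrite ltnS minj// gridm.
exists (Ordinal jm); split => //=; case: j bj minj {jm} => [//|j] bj minj /=.
by apply/negP => /minj; rewrite ltnn.
Qed.

(** On the almost sure event [full] every trial has a grid cell, cell 0 being everything up to [v0];
    [below_box] makes these cells independent draws with weights [w], the setting of
    [finite_maximal]. *)
Lemma levels_grid_maximal (lam b kap : R) : 0 <= kap ->
  outer_le P
    [set x | exists2 i, (i < m.+2)%N & b * grid i - kap <= lam * (cnt (grid i) x)%:R]
    (expR (kap - b * v0) * (1 + (expR lam - 1) * v0) ^+ n).
Proof.
move=> kap0 e e0.
pose C := [pred c : {ffun 'I_n -> 'I_m.+2} | [exists i : 'I_m.+2,
   b * (\sum_(j < m.+2 | (j <= i)%N) w j) - kap <=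
     lam * (\sum_(t < n) (c t <= i)%N)%N%:R]].
pose F (c : {ffun 'I_n -> 'I_m.+2}) :=
  [set x | forall t, below t (grid (c t)) x /\ ~~ below t (lo (c t)) x].
pose full := [set x | forall t : 'I_n, below t 1 x /\ ~~ below t 0 x].
have mfull : measurable full by exact: (box_meas (fun=> 0) (fun=> 1)).
have pfull : pr P full = 1.
  rewrite (@below_box (fun=> 0) (fun=> 1)); last by split=> //; split=> //; exact: ler01.
  by rewrite big1// => *; rewrite subr0.
have mF c : measurable (F c) by exact: box_meas.
have mU : measurable (\big[setU/set0]_(c | C c) F c) by exact: bigsetU_measurable.
exists (~` full `|` \big[setU/set0]_(c | C c) F c); split.
- by apply: measurableU => //; exact: measurableC.
- move=> x [i im hi]; have [fx|] := pselect (full x); last by left.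
  right.
  have /fin_all_exists[c hc] : forall t, exists j : 'I_m.+2,
      below t (grid j) x /\ ~~ below t (lo j) x.
    by move=> t; have [b1 b0] := fx t; exact: exists_cell.
  apply/bigsetU_seqE; exists [ffun t => c t]; rewrite mem_index_enum; split => //; last first.
    by move=> t; rewrite ffunE.
  apply/existsP; exists (Ordinal im); rewrite sum_w/=.
  rewrite (_ : (\sum_(t < n) _)%N = cnt (grid i) x)//.
  apply: eq_bigr => t _; rewrite ffunE; congr nat_of_bool; have [bc nb] := hc t.
  apply/idP/idP => [ci|bi].
    by apply: (implyP (below_mono t x (grid_homo ci))).
  rewrite leqNgt; apply/negP => ic; move: nb; rewrite /lo.
  case: (nat_of_ord (c t)) ic => // k; rewrite ltnS => ik; apply/negP; rewrite negbK.
  by apply: (implyP (below_mono t x (grid_homo ik))).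
- apply: (@le_trans _ _ (expR (kap - b * v0) * (1 + (expR lam - 1) * v0) ^+ n)); last by lra.
  apply: le_trans (prUle _ (measurableC mfull) mU) _.
  rewrite pr_setC// pfull subrr add0r.
  apply: le_trans (pr_bigsetU_le _ _ _ mF) _.
  have w1 : \sum_j w j = 1.
    by rewrite -gridm -(sum_w ord_max); apply: eq_bigl => j; rewrite -ltnS ltn_ord.
  have wge0 j : 0 <= w j.
    by rewrite /w; case: ifP => _; [exact: ltW|exact: grid_step_ge0].
  have w00 : w ord0 = v0 by [].
  have := @finite_maximal R n m.+1 w wge0 _ w1 lam b kap kap0; rewrite w00 => /(_ v0_gt0).
  apply: le_trans; rewrite le_eqVlt; apply/orP; left; apply/eqP.
  apply: eq_bigr => c _; rewrite /F (@below_box (fun t => lo (c t)) (fun t => grid (c t))).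
    by apply: eq_bigr => t _; rewrite w_lohi.
  move=> t; split; [|split].
  + rewrite /lo; case: (nat_of_ord (c t)) => // k.
    by apply: le_trans (grid_homo (leq0n k)); rewrite grid0 ltW.
  + by rewrite -subr_ge0 -w_lohi.
  + by rewrite -gridm grid_homo// -ltnS.
Qed.

End Grid.

Let pow_le_exp (lam v0 : R) : 0 < v0 < 1 ->
  (1 + (expR lam - 1) * v0) ^+ n <= expR (n%:R * v0 * (expR lam - 1)).
Proof.
move=> /andP[v00 v01].
rewrite -mulrA expRM_natl (mulrC v0); apply: lerXn2r; rewrite ?nnegrE ?expR_ge0//.
  have := expR_ge0 lam; nra.
exact: expR_ge1Dx.
Qed.

(** A level is rounded up to the grid, where the count is still at least [k]. The rounding error, at
    most one mesh width, is paid by [kap] and vanishes as the mesh is refined; demanding [k] only at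
    levels beyond [v] leaves open on which side [below] is closed. *)
Lemma levels_up (v0 a lam : R) : 0 < v0 < 1 -> 0 <= lam -> 0 <= a ->
  outer_le P [set x | exists v k, [/\ v0 <= v, v < 1, a * n%:R * v <= k%:R &
      forall g, v < g -> (k <= \sum_(t < n) below t g x)%N]]
    (expR (n%:R * v0 * (expR lam - 1 - lam * a))).
Proof.
move=> v001 lam0 a0 e e0; have /andP[v00 v01] := v001.
pose b := lam * a * n%:R; have b0 : 0 <= b by rewrite !mulr_ge0.
have e20 : 0 < e / 2 by rewrite divr_gt0.
have [m hm] := @expR_div_small R b (expR (n%:R * v0 * (expR lam - 1 - lam * a))) (e / 2)
  b0 (expR_ge0 _) e20.
have kap0 : 0 <= b / m.+1%:R by rewrite divr_ge0.
have [B [mB SB pB]] := @levels_grid_maximal v0 m v00 v01 lam b _ kap0 _ e20.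
exists B; split => //.
  apply: subset_trans SB => x [v [k [v0v v1 hk hg]]].
  have ex : exists i, v < grid v0 m i by exists m.+1; rewrite gridm.
  case: (ex_minnP ex) => i vi mini.
  have im : (i < m.+2)%N by rewrite ltnS mini// gridm.
  exists i => //; have := hg _ vi; rewrite -(ler_nat R) => cn.
  have gi : grid v0 m i <= v + m.+1%:R^-1.
    case: i vi mini {im cn} => [|i] vi mini.
      by rewrite grid0 ltNge v0v in vi.
    rewrite gridS lerD ?grid_step_le// leNgt; apply/negP => /mini.
    by rewrite ltnn.
  apply: (@le_trans _ _ (b * v)).
    by rewrite lerBlDr -mulrDr ler_wpM2l.
  rewrite /b -!mulrA ler_wpM2l//; apply: le_trans cn.
  by rewrite mulrA.
apply: le_trans pB _; rewrite [X in _ <= _ + X](splitr e) addrA lerD2r.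
apply: le_trans hm; rewrite expRD -mulrA ler_pM2l ?expR_gt0//.
apply: (@le_trans _ _ (expR (- (b * v0)) * expR (n%:R * v0 * (expR lam - 1)))).
  by rewrite ler_pM2l ?expR_gt0// pow_le_exp.
rewrite -expRD ler_expR le_eqVlt; apply/orP; left; apply/eqP.
by rewrite /b; ring.
Qed.

Lemma levels_down (v0 a th : R) : 0 < v0 < 1 -> 0 <= th -> 0 <= a ->
  outer_le P [set x | exists v k, [/\ v0 < v, v <= 1, k%:R <= a * n%:R * v &
      forall g, g < v -> (\sum_(t < n) below t g x <= k)%N]]
    (expR (n%:R * v0 * (expR (- th) - 1 + th * a))).
Proof.
move=> v001 th0 a0 e e0; have /andP[v00 v01] := v001.
pose b := th * a * n%:R; have b0 : 0 <= b by rewrite !mulr_ge0.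
have e20 : 0 < e / 2 by rewrite divr_gt0.
have [m hm] := @expR_div_small R b (expR (n%:R * v0 * (expR (- th) - 1 + th * a))) (e / 2)
  b0 (expR_ge0 _) e20.
have kap0 : 0 <= b / m.+1%:R by rewrite divr_ge0.
(* Negative [lam] and [b] reverse the crossing inequality, so the same maximal inequality controls
   counts that are too small. *)
have [B [mB SB pB]] := @levels_grid_maximal v0 m v00 v01 (- th) (- b) _ kap0 _ e20.
exists B; split => //.
  apply: subset_trans SB => x [v [k [v0v v1 hk hg]]].
  have ex : exists i, v <= grid v0 m i by exists m.+1; rewrite gridm.
  case: (ex_minnP ex) => -[|i] vi mini; first by rewrite grid0 leNgt v0v in vi.
  have im : (i.+1 < m.+2)%N by rewrite ltnS mini// gridm.
  exists i; first exact: ltnW.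
  have iv : grid v0 m i < v by rewrite ltNge; apply/negP => /mini; rewrite ltnn.
  have := hg _ iv; rewrite -(ler_nat R) => cn.
  have gi : v <= grid v0 m i + m.+1%:R^-1.
    by apply: le_trans vi _; rewrite gridS lerD2l grid_step_le.
  rewrite !mulNr -opprD lerN2.
  apply: (@le_trans _ _ (b * v)); last by rewrite -mulrDr ler_wpM2l.
  rewrite /b -!mulrA ler_wpM2l//; apply: le_trans cn _.
  by rewrite mulrA.
apply: le_trans pB _; rewrite [X in _ <= _ + X](splitr e) addrA lerD2r.
apply: le_trans hm; rewrite expRD -mulrA ler_pM2l ?expR_gt0//.
apply: (@le_trans _ _ (expR (- (- b * v0)) * expR (n%:R * v0 * (expR (- th) - 1)))).
  by rewrite ler_pM2l ?expR_gt0// pow_le_exp.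
rewrite -expRD ler_expR le_eqVlt; apply/orP; left; apply/eqP.
by rewrite /b; ring.
Qed.

End Levels.

(** * Deviations under the null hypothesis, on one geometric block *)

Section NullModel.
Variables (R : realType) (n : nat) (H : null_model R n).
Notation P := (nm_Pr H).
Notation Y := (nm_Y H).

Lemma clamp01_id (r : R) : 0 <= r <= 1 -> clamp01 r = r.
Proof.
by move=> /andP[r0 r1]; rewrite /clamp01 (max_idPr r0) (min_idPr r1).
Qed.

Lemma nm_measurable_le t r : measurable [set x | Y t x <= r].
Proof.
rewrite (_ : mkset _ = setT `&` Y t @^-1` `]-oo, r]); last first.
  by apply/seteqP; split => x /=; rewrite ?in_itv/=; [split|case].
exact: (@nm_Y_meas R n H t measurableT _ (measurable_itv _)).
Qed.

Lemma nm_measurable_gt t r : measurable [set x | r < Y t x].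
Proof.
rewrite (_ : mkset _ = ~` [set x | Y t x <= r]).
  exact/measurableC/nm_measurable_le.
by apply/seteqP; split => x /=; rewrite ltNge => /negP.
Qed.

Let pbox (k : nat) (lo hi : 'I_n -> R) := [set x | forall t : 'I_n,
  Y t.+1 x <= hi t /\ ((t < k)%N -> lo t < Y t.+1 x)].

Let pbox_meas k lo hi : measurable (pbox k lo hi).
Proof.
apply: measurable_fin_forall => t; apply: measurableI; first exact: nm_measurable_le.
case: (ltnP t k) => tk.
  rewrite (_ : (fun x => _) = [set x | lo t < Y t.+1 x]); first exact: nm_measurable_gt.
  by apply/seteqP; split => x /=; [exact|move=> + _].
by rewrite (_ : (fun x => _) = setT)//; apply/seteqP; split => x.
Qed.

(** The model gives only the joint distribution function. Lower bounds are added one coordinate at a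
    time: the new box is the old one minus the box whose upper side at coordinate [k] is lowered to
    [lo]. *)
Let pr_pbox k lo hi : (k <= n)%N ->
  (forall t, 0 <= lo t /\ lo t <= hi t /\ hi t <= 1) ->
  pr P (pbox k lo hi) = \prod_t (hi t - (if (t < k)%N then lo t else 0)).
Proof.
elim: k lo hi => [|k ih] lo hi kn lohi.
  pose r t : R := if insub t.-1 is Some i then hi i else 0.
  have rE (t : 'I_n) : r t.+1 = hi t by rewrite /r/= valK.
  rewrite (_ : pbox _ _ _ = [set x | forall t, (1 <= t <= n)%N -> Y t x <= r t]); last first.
    apply/seteqP; split => x /= h.
      by case=> // t /= tn; have [] := h (Ordinal tn); rewrite -rE.
    by move=> t; split => //; rewrite -rE; apply: h; rewrite ltn_ord.
  rewrite /pr nm_iid/= big_add1/= big_mkord; apply: eq_bigr => t _.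
  have [l0 [lh h1]] := lohi t.
  by rewrite rE subr0 clamp01_id// h1 (le_trans l0 lh).
pose ko := Ordinal kn.
pose hi' (t : 'I_n) := if t == ko then lo t else hi t.
have hi'P t : 0 <= lo t /\ lo t <= hi' t /\ hi' t <= 1.
  have [l0 [lh h1]] := lohi t; rewrite /hi'; case: eqP => // _.
  by split=> //; split=> //; apply: le_trans h1.
have kn' := ltnW kn.
have sub : pbox k lo hi' `<=` pbox k lo hi.
  move=> x h t; have [ht hk] := h t; split => //; apply: le_trans ht _.
  by rewrite /hi'; case: eqP => // _; have [_ []] := lohi t.
have -> : pbox k.+1 lo hi = pbox k lo hi `\` pbox k lo hi'.
  apply/seteqP; split => x /=.
    move=> h; split.
      by move=> t; have [ht hk] := h t; split => // tk; apply: hk; exact: ltnW.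
    move=> h'; have [_ /(_ (ltnSn k))] := h ko; have [+ _] := h' ko.
    by rewrite /hi' eqxx leNgt => /negP.
  move=> [h h'] t; have [ht hk] := h t; split => //.
  rewrite ltnS leq_eqVlt => /predU1P[tk|/hk//].
  have {tk}-> : t = ko by apply/val_inj.
  rewrite ltNge; apply/negP => le; apply: h' => u; have [hu hku] := h u; split => //.
  by rewrite /hi'; case: eqP => // ->.
have := @prDI _ _ _ P _ _ (pbox_meas k lo hi) (pbox_meas k lo hi').
rewrite (setIidr sub) !ih// => /eqP; rewrite -subr_eq eq_sym => /eqP ->.
rewrite (bigD1 ko)//= [X in _ - X](bigD1 ko)//= [RHS](bigD1 ko)//= ltnn ltnSn.
rewrite {1}/hi' eqxx !subr0.
have e1 : \prod_(t | t != ko) (hi' t - (if (t < k)%N then lo t else 0)) =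
    \prod_(t | t != ko) (hi t - (if (t < k)%N then lo t else 0)).
  by apply: eq_bigr => t /negPf tk; rewrite /hi' tk.
have e2 : \prod_(t | t != ko) (hi t - (if (t < k.+1)%N then lo t else 0)) =
    \prod_(t | t != ko) (hi t - (if (t < k)%N then lo t else 0)).
  apply: eq_bigr => t tk; rewrite ltnS leq_eqVlt.
  by have /negPf -> : (t : nat) != k by [].
by rewrite e1 e2 -mulrBl.
Qed.

Lemma nm_box (lo hi : 'I_n -> R) :
  (forall t, 0 <= lo t /\ lo t <= hi t /\ hi t <= 1) ->
  pr P [set x | forall t : 'I_n, lo t < Y t.+1 x <= hi t] = \prod_t (hi t - lo t).
Proof.
move=> lohi; rewrite (_ : mkset _ = pbox n lo hi).
  by rewrite pr_pbox//; apply: eq_bigr => t _; rewrite ltn_ord.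
apply/seteqP; split => x /= h t.
  by have /andP[] := h t; split.
by have [-> /(_ (ltn_ord t)) ->] := h t.
Qed.

Definition nm_cnt_le (v : R) (x : nm_Omega H) : nat :=
  (\sum_(t < n) (1 - Y t.+1 x <= v)%R)%N.
Definition nm_cnt_lt (w : R) (x : nm_Omega H) : nat :=
  (\sum_(t < n) (Y t.+1 x < w)%R)%N.

Lemma nm_levels_up (v0 a lam : R) : 0 < v0 < 1 -> 0 <= lam -> 0 <= a ->
  outer_le P [set x | exists v, [/\ v0 <= v, v < 1 &
      a * n%:R * v <= (nm_cnt_le v x)%:R]]
    (expR (n%:R * v0 * (expR lam - 1 - lam * a))).
Proof.
move=> v001 lam0 a0.
(* The strict inequality matches the half-open boxes of [nm_box]: [lo <= 1 - Y < hi] is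
   [1 - hi < Y <= 1 - lo]. *)
have := @levels_up _ _ _ P n (fun t g x => 1 - Y t.+1 x < g) _ _ _ v0 a lam v001 lam0 a0.
move=> h; apply: outer_leS (h _ _ _) => //.
- move=> x [v [v0v v1 hv]]; exists v, (nm_cnt_le v x); split => // g vg.
  apply: leq_sum => t _; case: (leP (1 - Y t.+1 x) v) => //= pv.
  by rewrite (le_lt_trans pv vg).
- by move=> t x g g' gg'; apply/implyP => h1; exact: lt_le_trans gg'.
- move=> t g; rewrite (_ : mkset _ = [set x | 1 - g < Y t.+1 x]).
    exact: nm_measurable_gt.
  by apply/seteqP; split => x /=; rewrite ltrBlDr ltrBlDl addrC.
- move=> lo hi lohi.
  have := @nm_box (fun t => 1 - hi t) (fun t => 1 - lo t).
  rewrite (_ : \prod_t _ = \prod_t (hi t - lo t)); last by apply: eq_bigr => t _; ring.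
  move=> <-; last by move=> t; have := lohi t; lra.
  congr pr; apply/seteqP; split => x /= hx t.
    by have [] := hx t; rewrite -leNgt => h1 h2; apply/andP; split; lra.
  by have /andP[h1 h2] := hx t; rewrite -leNgt; split; lra.
Qed.

Lemma nm_levels_down (v0 a th : R) : 0 < v0 < 1 -> 0 <= th -> 0 <= a ->
  outer_le P [set x | exists v k, [/\ v0 < v, v <= 1, k%:R <= a * n%:R * v &
      (nm_cnt_lt v x <= k)%N]]
    (expR (n%:R * v0 * (expR (- th) - 1 + th * a))).
Proof.
move=> v001 th0 a0.
have := @levels_down _ _ _ P n (fun t g x => Y t.+1 x <= g) _ _ _ v0 a th v001 th0 a0.
move=> h; apply: outer_leS (h _ _ _) => //.
- move=> x [v [k [v0v v1 hv hk]]]; exists v, k; split => // g vg.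
  apply: leq_trans hk.
  apply: leq_sum => t _; case: (leP (Y t.+1 x) g) => //= pv.
  by rewrite (le_lt_trans pv vg).
- by move=> t x g g' gg'; apply/implyP => h1; exact: le_trans gg'.
- by move=> t g; exact: nm_measurable_le.
- move=> lo hi lohi; rewrite -nm_box//.
  congr pr; apply/seteqP; split => x /= hx t.
    by have [] := hx t; rewrite -ltNge => -> ->.
  by have /andP[h1 h2] := hx t; rewrite -ltNge.
Qed.

(** The slope [a = 1 + sqrt (2 * x / (rho * y))] lies below the square-root boundary on the whole
    block and touches it at the right end. With the optimal Poisson parameter [lam = ln a],
    evaluated at the left end [y], the exponent is governed by [xlnx_ge]; the factor [rho] is the
    price of the block length. *)
Lemma nm_up_block (x rho y : R) : 0 < x -> 1 < rho -> 0 < y ->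
  outer_le P [set om | exists v, [/\ y <= n%:R * v, n%:R * v <= rho * y, v < 1 &
      n%:R * v + Num.sqrt (2 * x * (n%:R * v)) <= (nm_cnt_le v om)%:R]]
    (expR (- (x / rho / (1 + Num.sqrt (2 * x / y))))).
Proof.
move=> x0 rho1 y0; have rho0 : 0 < rho by lra.
have [ny|yn] := leP n%:R y.
  apply: outer_leS (outer_le0 _ (lexx 0)); last exact: expR_ge0.
  move=> om [v [yv _ v1 _]].
  have : (n%:R : R) * v < y; last by lra.
  have [n0|] := eqVneq n 0%N; first by rewrite n0 mul0r.
  rewrite -lt0n => n0; apply: lt_le_trans ny.
  by rewrite gtr_pMr// ltr0n.
have n0 : 0 < n%:R :> R by apply: lt_trans yn.
pose z := Num.sqrt (2 * x / (rho * y)); pose a := 1 + z.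
have z0 : 0 <= z by exact: sqrtr_ge0.
have z2 : z ^+ 2 = 2 * x / (rho * y).
  by rewrite sqr_sqrtr// divr_ge0 ?mulr_ge0// ltW.
have a1 : 1 <= a by rewrite lerDl.
have a0 : 0 <= a by lra.
have v01 : 0 < y / n%:R < 1.
  by rewrite divr_gt0//= ltr_pdivrMr// mul1r.
have la : 0 <= ln a by exact: ln_ge0.
apply: outer_leS (nm_levels_up v01 la a0).
  move=> om [v [yv vy v1 hv]]; exists v; split => //.
    by rewrite ler_pdivrMr// mulrC.
  apply: le_trans hv; rewrite -mulrA /a mulrDl mul1r lerD2l.
  have nv0 : 0 < n%:R * v by apply: lt_le_trans yv.
  move: (n%:R * v) vy nv0 => r vy r0.
  have r0' := ltW r0.
  rewrite -ler_sqr ?nnegrE ?sqrtr_ge0 ?mulr_ge0// sqr_sqrtr; last first.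
    by rewrite !mulr_ge0// ltW.
  rewrite exprMn z2 expr2 mulrA ler_pM2r// mulrAC ler_pdivrMr ?mulr_gt0//.
  by rewrite ler_pM2l ?mulr_gt0.
rewrite ler_expR mulrC (mulrC (n%:R)) divfK ?gt_eqF// lnK ?posrE; last by lra.
have := xlnx_ge a1; rewrite {1}/a addrC addKr z2 => h1.
apply: (@le_trans _ _ (- (y * (2 * x / (rho * y) / (2 * a))))).
  have aE : a = 1 + z by [].
  move: h1; set q := _ / (2 * a) => h1.
  have h2 : z - ln a * a <= - q by lra.
  by apply: le_trans (ler_wpM2r (ltW y0) h2) _; rewrite mulNr mulrC.
rewrite lerN2 (_ : y * _ = x / rho / a); last first.
  by field; rewrite !gt_eqF//; lra.
rewrite ler_pM2l ?divr_gt0// lef_pV2 ?posrE; [|by have := sqrtr_ge0 (2 * x / y); lra|by lra].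
rewrite lerD2l; apply: ler_wsqrtr; rewrite ler_pM2l ?mulr_gt0// lef_pV2 ?posrE ?mulr_gt0//.
by rewrite ler_pMl// ltW.
Qed.

(** The mirror image at the upper end, with [w = 1 - v]. Blocks are taken in the count [j] instead
    of the level, because the bound on [K_s] is normalised by [1 - u] there. The level at the start
    of the block is [y = J + sqrt (2 * x * J)], and [th = 1 - a] turns the exponent into
    [- y * z ^+ 2 / 2] at most. *)
Lemma nm_down_block (x rho J : R) : 0 < x -> 1 < rho -> 0 < J ->
  outer_le P [set om | exists w (j : nat), [/\ J <= j%:R, j%:R <= rho * J, w <= 1,
      (nm_cnt_lt w om <= j)%N & j%:R + Num.sqrt (2 * x * j%:R) < n%:R * w]]
    (expR (- (x / rho / (1 + Num.sqrt (2 * x / J))))).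
Proof.
move=> x0 rho1 J0; have rho0 : 0 < rho by lra.
pose y := J + Num.sqrt (2 * x * J).
have y0 : 0 < y by have := sqrtr_ge0 (2 * x * J); rewrite /y; lra.
have yj (j : nat) : J <= j%:R -> y <= j%:R + Num.sqrt (2 * x * j%:R).
  move=> Jj; apply: lerD => //; apply: ler_wsqrtr.
  by rewrite ler_pM2l// mulr_gt0.
have [ny|yn] := leP n%:R y.
  apply: outer_leS (outer_le0 _ (lexx 0)); last exact: expR_ge0.
  move=> om [w [j [Jj _ w1 _ hw]]].
  have := le_lt_trans (yj _ Jj) hw => yw.
  have : n%:R * w <= y; last by rewrite leNgt yw.
  by apply: le_trans ny; rewrite ler_piMr.
have n0 : 0 < n%:R :> R by apply: lt_trans yn.
pose s := Num.sqrt (2 * x / (rho * J)); pose a := (1 + s)^-1.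
have s0 : 0 <= s by exact: sqrtr_ge0.
have s1 : 0 < 1 + s by lra.
have s2 : s ^+ 2 = 2 * x / (rho * J).
  by rewrite sqr_sqrtr// divr_ge0 ?mulr_ge0// ltW.
have a0 : 0 <= a by rewrite invr_ge0 ltW.
have v01 : 0 < y / n%:R < 1.
  by rewrite divr_gt0//= ltr_pdivrMr// mul1r.
pose z := s / (1 + s).
have z0 : 0 <= z by rewrite divr_ge0// ltW.
have az : a = 1 - z by rewrite /a /z; field; rewrite gt_eqF.
apply: outer_leS (nm_levels_down v01 z0 a0).
  move=> om [w [j [Jj jJ w1 hj hw]]]; exists w, j; split => //.
    by rewrite ltr_pdivrMr// mulrC; exact: le_lt_trans (yj _ Jj) hw.
  rewrite /a -mulrA mulrC ler_pdivlMr//; apply/ltW/(le_lt_trans _ hw).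
  have j0 : 0 < j%:R :> R by apply: lt_le_trans Jj.
  rewrite mulrDr mulr1 lerD2l.
  rewrite -ler_sqr ?nnegrE ?mulr_ge0 ?sqrtr_ge0// sqr_sqrtr; last first.
    by rewrite !mulr_ge0// ltW.
  rewrite exprMn s2 expr2 mulrC mulrA ler_pM2r// mulrAC ler_pdivrMr ?mulr_gt0//.
  by rewrite ler_pM2l ?mulr_gt0.
rewrite ler_expR mulrC (mulrC (n%:R)) divfK ?gt_eqF//.
have := expRN_le_quad z0 => h1.
apply: (@le_trans _ _ (- (y * (z ^+ 2 / 2)))).
  have h2 : expR (- z) - 1 + z * a <= - (z ^+ 2 / 2) by rewrite az; lra.
  by apply: le_trans (ler_wpM2r (ltW y0) h2) _; rewrite mulNr mulrC.
rewrite lerN2.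
have sJ : s <= Num.sqrt (2 * x / J).
  apply: ler_wsqrtr; rewrite ler_pM2l ?mulr_gt0// lef_pV2 ?posrE ?mulr_gt0//.
  by rewrite ler_pMl// ltW.
have yE : y = J * (1 + Num.sqrt (2 * x / J)).
  rewrite /y mulrDr mulr1; congr (_ + _).
  rewrite (_ : 2 * x * J = J ^+ 2 * (2 * x / J)); last by field; rewrite gt_eqF.
  by rewrite sqrtrM ?sqr_ge0// sqrtr_sqr ger0_norm// ltW.
apply: (@le_trans _ _ (J * (1 + s) * (z ^+ 2 / 2))); last first.
  by rewrite ler_wpM2r ?divr_ge0 ?sqr_ge0// yE ler_pM2l// lerD2l.
rewrite (_ : _ * (z ^+ 2 / 2) = x / rho / (1 + s)); last first.
  by rewrite /z expr_div_n s2; field; rewrite !gt_eqF.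
rewrite ler_pM2l ?divr_gt0// lef_pV2 ?posrE//; rewrite ?lerD2l//.
Qed.

End NullModel.

(** * Order statistics and counts *)

Section OrderStatistics.
Variable R : realType.
Implicit Types (l : seq R) (v : R).

Let sorted_nth l i j : (i <= j)%N -> (j < size l)%N ->
  nth 1 (sort <=%R l) i <= nth 1 (sort <=%R l) j.
Proof.
move=> ij jl; apply: (@sorted_leq_nth _ <=%R le_trans le_refl) => //.
- exact: (sort_sorted le_total).
- by rewrite inE size_sort (leq_ltn_trans ij).
- by rewrite inE size_sort.
Qed.

(** Ties are not excluded, so sorted entries and counts are linked by inequalities only; index [t]
    holds the order statistic of rank [t + 1]. *)
Lemma count_le_nth_sort l t : (t < size l)%N ->
  (t < count (fun p : R => (p <= nth 1 (sort <=%R l) t)%R) l)%N.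
Proof.
move=> tl; have /permP <- : perm_eq (sort <=%R l) l by rewrite perm_sort.
set v := nth _ _ _.
rewrite -(cat_take_drop t.+1 (sort <=%R l)) count_cat.
apply: leq_trans (leq_addr _ _).
have sz : size (take t.+1 (sort <=%R l)) = t.+1.
  by rewrite size_takel// size_sort.
rewrite -[X in (X <= _)%N]sz leq_eqVlt; apply/orP; left; rewrite eq_sym -all_count.
apply/(all_nthP 1) => i; rewrite sz => it; rewrite nth_take//.
exact: sorted_nth.
Qed.

Lemma count_gt_nth_sort l t : (t < size l)%N ->
  (count (fun p : R => (nth 1 (sort <=%R l) t < p)%R) l <= size l - t.+1)%N.
Proof.
move=> tl; have := count_le_nth_sort tl; set v := nth _ _ _ => h.
rewrite -(count_predC (fun p : R => (p <= v)%R) l).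
rewrite (eq_count (a2 := predC (fun p : R => (p <= v)%R))); last by move=> p /=; rewrite ltNge.
set a := count _ _ in h *; set b := count _ _.
by rewrite -addnBAC// leq_addl.
Qed.

Lemma nth_sort_le l v k : (0 < k)%N -> (k <= count (fun p : R => (p <= v)%R) l)%N ->
  nth 1 (sort <=%R l) k.-1 <= v.
Proof.
case: k => // k _ /= kc; rewrite leNgt; apply/negP => vk.
have kl : (k < size l)%N by apply: leq_trans kc (count_size _ _).
move: kc; have /permP <- : perm_eq (sort <=%R l) l by rewrite perm_sort.
rewrite -(cat_take_drop k (sort <=%R l)) count_cat.
have -> : count (fun p : R => (p <= v)%R) (drop k (sort <=%R l)) = 0%N.
  apply/eqP; rewrite -leqn0 leqNgt -has_count; apply/negP => /(has_nthP 1)[i].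
  rewrite size_drop size_sort nth_drop => il; rewrite leNgt => /negP; apply.
  apply: lt_le_trans vk _; apply: sorted_nth; first exact: leq_addr.
  by rewrite -ltn_subRL.
rewrite addn0 => h; have := leq_trans h (count_size _ _).
by rewrite size_takel ?ltnn// size_sort ltnW.
Qed.

Lemma nth_sort_gt l v : (count (fun p : R => (p <= v)%R) l < size l)%N ->
  v < nth 1 (sort <=%R l) (count (fun p : R => (p <= v)%R) l).
Proof.
move=> h; rewrite ltNge; apply/negP => hv.
have := count_le_nth_sort h; rewrite ltnNge => /negP; apply.
by apply: sub_count => p /= pv; exact: le_trans hv.
Qed.

Lemma count_pvalues (Q : pred R) (y : nat -> R) n :
  count Q [seq 1 - y t | t <- iota 1 n] = (\sum_(t < n) Q (1 - y t.+1)%R)%N.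
Proof.
rewrite -sum1_count big_map big_mkcond/=.
transitivity (\sum_(1 <= t < n.+1) (Q (1 - y t)%R : nat))%N.
  rewrite /index_iota subn1/=; apply: eq_bigr => t _.
  by case: (Q _).
by rewrite big_add1/= big_mkord.
Qed.

Lemma bigmax_ge_exists (I : eqType) (r : seq I) (Q : pred I) (F : I -> R) a :
  0 < a -> a <= \big[Num.max/0]_(i <- r | Q i) F i ->
  exists i, [/\ i \in r, Q i & a <= F i].
Proof.
move=> a0; elim: r => [|i r ih]; first by rewrite big_nil leNgt a0.
rewrite big_cons; case: ifPn => Qi.
  rewrite le_max => /orP[h|/ih[j [jr Qj h]]]; first by exists i; rewrite mem_head.
  by exists j; rewrite in_cons jr orbT.
by move=> /ih[j [jr Qj h]]; exists j; rewrite in_cons jr orbT.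
Qed.

Lemma exists_bigmax_ge (I : eqType) (r : seq I) (Q : pred I) (F : I -> R) a i :
  i \in r -> Q i -> a <= F i -> a <= \big[Num.max/0]_(j <- r | Q j) F j.
Proof.
move=> + Qi ai; elim: r => // j r ih; rewrite in_cons big_cons => /predU1P[<-|ir].
  by rewrite Qi le_max ai.
by case: ifP => _; rewrite ?le_max ih ?orbT.
Qed.

End OrderStatistics.

(** * Summing the block bounds *)

Section BlockSum.
Variable R : realType.

Definition block_sum (x rho y0 : R) K : R :=
  \sum_(k < K) expR (- (x / rho / (1 + Num.sqrt (2 * x / (y0 * rho ^+ k))))).

Lemma sum_nat_lt_le K (z : R) : 0 <= z -> \sum_(k < K) ((k%:R < z)%R : nat)%:R <= z + 1.
Proof.
move=> z0; elim: K => [|K ih]; first by rewrite big_ord0; lra.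
rewrite big_ord_recr/=; case: (ltP K%:R z) => Kz; last by rewrite addr0.
rewrite lerD//; apply: le_trans (ltW Kz).
apply: le_trans (_ : \sum_(k < K) (1 : R) <= _); last by rewrite sumr_const card_ord.
by apply: ler_sum => k _; case: (_ < _).
Qed.

Lemma exprn_ge1Dn (x : R) k : 0 <= 1 + x -> 1 + k%:R * x <= (1 + x) ^+ k.
Proof.
move=> x1; have [x0|x0] := leP 0 x.
  elim: k => [|k ih]; first by rewrite mul0r addr0 expr0.
  rewrite exprS; have := ler_wpM2l x1 ih; rewrite -natr1.
  have : 0 <= k%:R :> R by []. nra.
have [h|h] := leP (1 + k%:R * x) 0; first by apply: le_trans h _; exact: exprn_ge0.
elim: k h => [|k ih] h; first by rewrite mul0r addr0 expr0.
have k0 : 0 <= k%:R :> R by [].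
have h' : 0 < 1 + k%:R * x by move: h; rewrite -natr1; nra.
rewrite exprS; have := ler_wpM2l x1 (ih h'); rewrite -natr1; nra.
Qed.

(** Blocks beyond [C * x] have a correction factor at most [rho], hence the exponent [x / rho ^+ 2].
    By Bernoulli's inequality the remaining block indices are below [C * x / (y0 * (rho - 1))], and
    each of those blocks is bounded by the worst one, the first. *)
Lemma block_sum_le (x rho y0 C : R) K : 0 < x -> 1 < rho -> 0 < y0 -> 0 < C ->
  1 + Num.sqrt (2 / C) <= rho ->
  block_sum x rho y0 K <= K%:R * expR (- (x / rho ^+ 2)) +
    (C * x / (y0 * (rho - 1)) + 1) * expR (- (x / rho / (1 + Num.sqrt (2 * x / y0)))).
Proof.
move=> x0 rho1 y00 C0 hC; have rho0 : 0 < rho by lra.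
have rho10 : 0 < rho - 1 by lra.
have xr0 : 0 < x / rho by rewrite divr_gt0.
set E := expR (- (x / rho / _)).
have xx0 : 0 < 2 * x by lra.
pose z := C * x / (y0 * (rho - 1)).
have z0 : 0 <= z by rewrite divr_ge0 ?mulr_ge0// ltW.
have step (k : 'I_K) : expR (- (x / rho / (1 + Num.sqrt (2 * x / (y0 * rho ^+ k))))) <=
    expR (- (x / rho ^+ 2)) + ((k%:R < z)%R : nat)%:R * E.
  have yk0 : 0 < y0 * rho ^+ k by rewrite mulr_gt0// exprn_gt0.
  have rk : 1 + k%:R * (rho - 1) <= rho ^+ k.
    by have := @exprn_ge1Dn (rho - 1) k; rewrite addrC subrK; apply; lra.
  have E0 : 0 <= E by exact: expR_ge0.
  have s0 (r : R) : 0 < 1 + Num.sqrt r by rewrite ltr_wpDr// sqrtr_ge0.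
  have [big|small] := leP (C * x) (y0 * rho ^+ k).
    apply: ler_wpDr; first by rewrite mulr_ge0.
    rewrite ler_expR lerN2 expr2 invfM mulrA ler_pM2l//.
    rewrite lef_pV2 ?posrE//.
    apply: le_trans hC; rewrite lerD2l; apply: ler_wsqrtr.
    rewrite ler_pdivrMr// mulrAC ler_pdivlMr// -mulrA (mulrC x).
    by rewrite ler_pM2l.
  have kz : k%:R < z.
    rewrite /z ltr_pdivlMr ?mulr_gt0//; apply: le_lt_trans small.
    rewrite mulrCA ler_pM2l//; lra.
  rewrite kz mul1r; apply: ler_wpDl; first exact: expR_ge0.
  rewrite ler_expR lerN2 ler_pM2l//.
  rewrite lef_pV2 ?posrE//.
  rewrite lerD2l; apply: ler_wsqrtr; rewrite ler_pM2l// lef_pV2 ?posrE//.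
  apply: ler_peMr; first exact: ltW.
  have : 0 <= k%:R * (rho - 1) by rewrite mulr_ge0// ltW.
  lra.
apply: le_trans (ler_sum _ (fun k _ => step k)) _.
rewrite big_split/= sumr_const card_ord; apply: lerD; first by rewrite mulr_natl.
by rewrite -mulr_suml ler_wpM2r ?expR_ge0// sum_nat_lt_le.
Qed.

End BlockSum.

(** * Union over blocks, and the smallest p-value *)

Section NullUnion.
Variables (R : realType) (n : nat) (H : null_model R n).
Notation P := (nm_Pr H).
Notation Y := (nm_Y H).

Let exists_block (y0 rho y : R) K : 0 < y0 -> 1 < rho -> y0 <= y -> y < y0 * rho ^+ K ->
  exists2 k : 'I_K, y0 * rho ^+ k <= y & y <= rho * (y0 * rho ^+ k).
Proof.
move=> y00 rho1 yy yK.
have ex : exists k, y < y0 * rho ^+ k by exists K.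
case: (ex_minnP ex) => -[|k] yk mink; first by rewrite expr0 mulr1 ltNge yy in yk.
exists (Ordinal (mink _ yK)) => /=.
  by rewrite leNgt; apply/negP => /mink; rewrite ltnn.
by rewrite mulrCA -exprS ltW.
Qed.

Lemma nm_up (x rho y0 : R) K : 0 < x -> 1 < rho -> 0 < y0 ->
  outer_le P [set om | exists v, [/\ y0 <= n%:R * v, n%:R * v < y0 * rho ^+ K, v < 1 &
      n%:R * v + Num.sqrt (2 * x * (n%:R * v)) <= (nm_cnt_le v om)%:R]]
    (block_sum x rho y0 K).
Proof.
move=> x0 rho1 y00.
have hk (k : 'I_K) := nm_up_block H x0 rho1 (mulr_gt0 y00 (exprn_gt0 k (lt_trans ltr01 rho1))).
apply: outer_leS (outer_le_bigU (index_enum _) hk) => //.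
move=> om [v [y0v vK v1 hv]].
have [k yk ky] := exists_block y00 rho1 y0v vK.
by apply/bigsetU_seqE; exists k; split => //; exists v.
Qed.

Lemma nm_down (x rho J : R) K : 0 < x -> 1 < rho -> 0 < J ->
  outer_le P [set om | exists w (j : nat), [/\ J <= j%:R, j%:R < J * rho ^+ K, w <= 1,
      (nm_cnt_lt w om <= j)%N & j%:R + Num.sqrt (2 * x * j%:R) < n%:R * w]]
    (block_sum x rho J K).
Proof.
move=> x0 rho1 J0.
have hk (k : 'I_K) := nm_down_block H x0 rho1 (mulr_gt0 J0 (exprn_gt0 k (lt_trans ltr01 rho1))).
apply: outer_leS (outer_le_bigU (index_enum _) hk) => //.
move=> om [w [j [Jj jK w1 hj hw]]].
have [k yk ky] := exists_block J0 rho1 Jj jK.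
by apply/bigsetU_seqE; exists k; split => //; exists w, j.
Qed.

(** Supplies the starting point [y0] of the geometric blocks: below it no block bound is useful, and
    this union bound replaces them. *)
Lemma nm_small_pvalue (y0 : R) : (0 < n)%N -> 0 < y0 <= 1 ->
  outer_le P [set om | exists t : 'I_n, 1 - Y t.+1 om < y0 / n%:R] y0.
Proof.
move=> n0 /andP[y00 y01].
have n0' : 0 < n%:R :> R by rewrite ltr0n.
have yn : y0 / n%:R <= 1.
  by rewrite ler_pdivrMr// mul1r; apply: le_trans y01 _; rewrite ler1n.
have yn0 : 0 < y0 / n%:R by rewrite divr_gt0.
pose B := [set om | forall t : 'I_n, 0 < Y t.+1 om <= 1 - y0 / n%:R].
have mB : measurable B.
  apply: measurable_fin_forall => t.
  rewrite (_ : (fun x => _) = [set om | 0 < Y t.+1 om] `&` [set om | Y t.+1 om <= 1 - y0 / n%:R]).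
    by apply: measurableI; [exact: nm_measurable_gt|exact: nm_measurable_le].
  by apply/seteqP; split => om /= /andP.
have pB : 1 - y0 <= pr P B.
  rewrite (@nm_box _ _ H (fun=> 0) (fun=> 1 - y0 / n%:R)); last by move=> t; lra.
  rewrite prodr_const card_ord subr0; have := @exprn_ge1Dn R (- (y0 / n%:R)) n.
  by rewrite mulrN mulrCA divff ?gt_eqF// mulr1; apply; lra.
apply: outer_leS (pr_outer_le (measurableC mB) (lexx _)).
  by move=> om [t ht] /(_ t) /andP[_]; lra.
by rewrite pr_setC//; lra.
Qed.

End NullUnion.

(** A positive threshold cannot be met by the initial value 0 of the maximum, so rejection is
    witnessed by an index. Here [t] stands for rank [t + 1]. *)
Lemma tr_gof_rejectP (R : realType) n (c s delta : R) (z : nat -> R) :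
  let ps := sort <=%R [seq 1 - z t | t <- iota 1 n] in
  0 < (1 + delta) * ln (ln n%:R) :> R ->
  tr_gof_reject n c s delta z <->
  exists t : 'I_n, c <= nth 1 ps t.+1 /\
    (1 + delta) * ln (ln n%:R) <= n%:R * K_s_plus s (t.+1%:R / n%:R) (nth 1 ps t).
Proof.
move=> ps L0; have [n0|n0] := eqVneq n 0%N.
  by move: L0; rewrite n0 (ln0 (lexx 0)) (ln0 (lexx 0)) mulr0 ltxx.
have n0' : 0 < n%:R :> R by rewrite ltr0n lt0n.
rewrite /tr_gof_reject /tr_gof_stat -/ps; split.
  rewrite -ler_pdivrMl// => /bigmax_ge_exists[]; first by rewrite mulr_gt0 ?invr_gt0.
  move=> [|t] []; rewrite mem_index_iota// => tn ct.
  rewrite ler_pdivrMl// => hK.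
  by exists (Ordinal (tn : (t < n)%N)).
move=> [t [ct hK]]; rewrite -ler_pdivrMl//.
apply: (@exists_bigmax_ge _ _ _ _ _ _ t.+1) => //.
  by rewrite mem_index_iota/= ltnS.
by rewrite ler_pdivrMl.
Qed.

(** * Measurability of the rejection event *)

Section MeasurableTest.
Context {d : measure_display} {R : realType} {T : measurableType d}.
Variables (n : nat) (y : nat -> T -> R).
Hypothesis y_meas : forall t, measurable_fun setT (y t).

Let pvals x := [seq 1 - y t x | t <- iota 1 n].

Let size_pvals x : size (pvals x) = n.
Proof. by rewrite size_map size_iota. Qed.

Let measurable_pval_le t r : measurable [set x | 1 - y t x <= r].
Proof.
rewrite (_ : mkset _ = setT `&` y t @^-1` `[1 - r, +oo[).
  exact: (@y_meas t measurableT _ (measurable_itv _)).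
by apply/seteqP; split => x /=; rewrite ?in_itv/= ?andbT; [split => //; lra|case=> _; lra].
Qed.

Let measurable_order_stat k :
  measurable_fun setT (fun x => nth 1 (sort <=%R (pvals x)) k).
Proof.
have [nk|kn] := leqP n k.
  rewrite (_ : (fun x => _) = cst 1); first exact: measurable_cst.
  by apply/funext => x; rewrite nth_default// size_sort size_pvals.
move=> _; apply: (measurability _ (RGenOInfty.measurableE R)) => //.
move=> _ [_ [r ->] <-]; apply: measurableI => //.
(* The order statistic is at most [r] iff some set of more than [k] rounds has all its p-values at
   most [r]. *)
pose B := \big[setU/set0]_(S : {set 'I_n} | (k < #|S|)%N)
  [set x | forall t : 'I_n, t \in S -> 1 - y t.+1 x <= r].
rewrite [X in measurable X](_ : _ = ~` B).
  apply: measurableC; apply: bigsetU_measurable => S _.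
  apply: measurable_fin_forall => t; case: (boolP (t \in S)) => tS.
    rewrite (_ : (fun x => _) = [set x | 1 - y t.+1 x <= r]).
      exact: measurable_pval_le.
    by apply/seteqP; split => x /=; [apply|move=> + _].
  by rewrite (_ : (fun x => _) = setT)//; apply/seteqP; split.
have ordE x : (nth 1 (sort <=%R (pvals x)) k <= r) =
    (k < \sum_(t < n) (1 - y t.+1 x <= r)%R)%N.
  rewrite -(count_pvalues (fun p => p <= r) (y^~ x)); apply/idP/idP => h.
    have := @count_le_nth_sort _ (pvals x) k; rewrite size_pvals => /(_ kn) h1.
    apply: leq_trans h1 _; apply: sub_count => p /= hp; exact: le_trans h.
  exact: (@nth_sort_le _ (pvals x) r k.+1 _ h).
apply/seteqP; split => x /=; rewrite in_itv/= andbT ltNge ordE => h.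
  move=> /bigsetU_seqE[S [_ kS hS]]; move/negP : h; apply.
  apply: leq_trans kS _; rewrite -sum1_card big_mkcond/=.
  by apply: leq_sum => t _; case: ifP => // tS; rewrite hS.
apply/negP => hk; apply: h; apply/bigsetU_seqE.
exists (finset (fun t : 'I_n => 1 - y t.+1 x <= r)); split => //; last first.
  by move=> t; rewrite inE.
by rewrite -sum1_card big_mkcond/= (eq_bigr (fun t : 'I_n => (1 - y t.+1 x <= r)%R : nat))// =>
  t _; rewrite inE; case: (_ <= _).
Qed.

Let measurable_phi_s (s : R) : measurable_fun setT (phi_s s).
Proof.
rewrite /phi_s; case: (s == 1); last case: (s == 0).
- apply: measurable_funD => //; apply: measurable_funB => //.
  by apply: measurable_funM => //; exact: measurable_ln.
- apply: measurable_funB => //; apply: measurable_funD => //.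
  by apply: measurableT_comp => //; exact: measurable_ln.
- apply: measurable_funM => //; apply: measurable_funB => //.
  by apply: measurable_funD => //; apply: measurable_funM.
Qed.

Let measurable_K_s_plus (s u : R) : measurable_fun setT (K_s_plus s u).
Proof.
rewrite (_ : K_s_plus s u = fun v => if (0 < v) && (v < u) && (u < 1) then
    v * phi_s s (u * v `^ (-1)) + (1 - v) * phi_s s ((1 - u) * (1 - v) `^ (-1))
    else 0); last first.
  apply/funext => v; rewrite /K_s_plus; case: ifPn => // /andP[/andP[v0 vu] u1].
  by rewrite /K_s !powR_inv1//; lra.
have m1 : measurable_fun setT (fun v : R => 1 - v) by exact: measurable_funB.
have mp : measurable_fun setT (fun v : R => v `^ (-1)) by exact: measurable_powR.
apply: measurable_fun_ifT => //.
- apply: measurable_and => //; apply: measurable_and => //; exact: measurable_fun_ltr.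
- apply: measurable_funD; apply: measurable_funM => //.
    apply: (measurableT_comp (measurable_phi_s s)); exact: measurable_funM.
  apply: (measurableT_comp (measurable_phi_s s)); apply: measurable_funM => //.
  exact: (measurableT_comp mp m1).
Qed.

Lemma measurable_tr_gof_reject (c s delta : R) : 0 < (1 + delta) * ln (ln n%:R) ->
  measurable [set x | tr_gof_reject n c s delta (y^~ x)].
Proof.
move=> L0; set th := (1 + delta) * _ in L0.
pose B := \big[setU/set0]_(t < n) ([set x | c <= nth 1 (sort <=%R (pvals x)) t.+1] `&`
  [set x | th <= n%:R * K_s_plus s (t.+1%:R / n%:R) (nth 1 (sort <=%R (pvals x)) t)]).
rewrite (_ : mkset _ = B); last first.
  apply/seteqP; split => x /=.
    move=> /(tr_gof_rejectP _ _ _ L0)[t [h1 h2]]; apply/bigsetU_seqE.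
    by exists t; split.
  move=> /bigsetU_seqE[t [_ _ [h1 h2]]]; apply/(tr_gof_rejectP _ _ _ L0).
  by exists t.
apply: bigsetU_measurable => t _; apply: measurableI.
  rewrite (_ : mkset _ = setT `&` (fun x => nth 1 (sort <=%R (pvals x)) t.+1) @^-1` `[c, +oo[).
    exact: (@measurable_order_stat t.+1 measurableT _ (measurable_itv _)).
  by apply/seteqP; split => x /=; rewrite ?in_itv/= ?andbT; [split|case].
have mK : measurable_fun setT (fun x => n%:R *
    K_s_plus s (t.+1%:R / n%:R) (nth 1 (sort <=%R (pvals x)) t)).
  apply: measurable_funM => //.
  exact: (measurableT_comp (measurable_K_s_plus s _) (measurable_order_stat t)).
rewrite (_ : mkset _ = setT `&` (fun x => n%:R *
    K_s_plus s (t.+1%:R / n%:R) (nth 1 (sort <=%R (pvals x)) t)) @^-1` `[th, +oo[).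
  exact: (mK measurableT _ (measurable_itv _)).
by apply/seteqP; split => x /=; rewrite ?in_itv/= ?andbT; [split|case].
Qed.

End MeasurableTest.

(** * Type I error at a fixed sample size *)

Section TypeIBound.
Variables (R : realType) (n : nat) (H : null_model R n).
Notation P := (nm_Pr H).
Notation Y := (nm_Y H).

Let sqrt_lt (a b : R) : 0 <= a -> a < Num.sqrt b -> a ^+ 2 < b.
Proof.
move=> a0 ab; have b0 : 0 <= b.
  rewrite leNgt; apply/negP => /ltW/ler0_sqrtr b0.
  by rewrite b0 ltNge a0 in ab.
by rewrite -(sqr_sqrtr b0) ltr_sqr ?nnegrE ?sqrtr_ge0.
Qed.

Let sqrt_le (a b : R) : 0 <= a -> 0 <= b -> a <= Num.sqrt b -> a ^+ 2 <= b.
Proof.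
by move=> a0 b0 ab; rewrite -(sqr_sqrtr b0) ler_sqr ?nnegrE ?sqrtr_ge0.
Qed.

Let rescaled_bound (N k v : R) : 0 < N -> 0 < v -> k < N ->
  N * ((k / N - v) ^+ 2 / 2 * (v^-1 + (1 - k / N)^-1)) =
  (k - N * v) ^+ 2 * (N - k + N * v) / (2 * (N * v * (N - k))).
Proof.
move=> N0 v0 kN; have j0 : N - k != 0 by rewrite gt_eqF// subr_gt0.
by field; rewrite j0 !gt_eqF.
Qed.

(** The factor to control is [1 + y / (N - k)]. For [y <= delta / 8 * N] it is at most
    [1 + delta / 4], and [(1 + delta / 2) * (1 + delta / 4) <= 1 + delta]; otherwise it is at most
    4, which the quarter threshold absorbs. The condition [32 * x <= N] keeps [k - y] below [N / 5],
    so that [N - k] is of order [N]. *)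
Let low_deviation (delta L N k y : R) : 0 < delta <= 1 -> 0 < L ->
  32 * ((1 + delta) * L) <= N -> 0 < y -> y <= N / 2 -> y < k -> k < N ->
  (k - y) ^+ 2 < 2 * ((1 + delta / 2) * L) * y ->
  (delta / 8 * N < y -> (k - y) ^+ 2 < 2 * ((1 + delta) * L / 4) * y) ->
  (k - y) ^+ 2 * (N - k + y) < (1 + delta) * L * (2 * (y * (N - k))).
Proof.
move=> /andP[d0 d1] L0 hx y0 yhalf yk kN dev1 dev2.
have x0 : 0 < (1 + delta) * L by rewrite mulr_gt0//; lra.
have x10 : 0 < (1 + delta / 2) * L by rewrite mulr_gt0//; lra.
have x1x : (1 + delta / 2) * L * (1 + delta / 4) <= (1 + delta) * L.
  rewrite mulrAC ler_pM2r//; nra.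
have x1x' : (1 + delta / 2) * L <= (1 + delta) * L by rewrite ler_pM2r//; lra.
move: hx x0 x10 x1x x1x' dev1 dev2.
move: ((1 + delta) * L) ((1 + delta / 2) * L) => x x1 hx x0 x10 x1x x1x' dev1 dev2.
have N0 : 0 < N by lra.
have s0 : 0 < N - k + y by lra.
have dN : k - y < N / 5.
  rewrite -ltr_sqr ?nnegrE; [|lra|lra]; apply: lt_le_trans dev1 _.
  have h3 : x1 * y <= x * (N / 2) by apply: ler_pM => //; exact: ltW.
  have h4 : 32 * x * N <= N * N by rewrite ler_pM2r.
  have h5 : 0 <= N * N by apply: mulr_ge0; exact: ltW.
  lra.
have [ye|ye] := leP y (delta / 8 * N).
  have e8 : delta / 8 * N <= 8^-1 * N by rewrite ler_pM2r//; lra.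
  have ej : delta / 8 * (N / 2) <= delta / 8 * (N - k) by rewrite ler_pM2l//; lra.
  have h1 : (k - y) ^+ 2 * (N - k + y) < 2 * x1 * y * (N - k + y) by rewrite ltr_pM2r.
  have h2 : x1 * (N - k + y) <= x1 * ((1 + delta / 4) * (N - k)).
    by rewrite ler_pM2l//; lra.
  have h3 : x1 * (1 + delta / 4) * (N - k) <= x * (N - k) by rewrite ler_pM2r//; lra.
  have h4 : 2 * y * (x1 * (N - k + y)) <= 2 * y * (x * (N - k)).
    by rewrite ler_pM2l ?mulr_gt0//; lra.
  lra.
have h1 : (k - y) ^+ 2 * (N - k + y) < 2 * (x / 4) * y * (N - k + y).
  by rewrite ltr_pM2r//; exact: dev2.
have h2 : 2 * y * (x / 4 * (N - k + y)) <= 2 * y * (x / 4 * (4 * (N - k))).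
  rewrite ler_pM2l ?mulr_gt0// ler_pM2l; lra.
lra.
Qed.

(** The same computation normalised by [N - k]; the factor is now [1 + (N - k) / y] with
    [y > N / 2]. *)
Let high_deviation (delta L N k y : R) : 0 < delta <= 1 -> 0 < L ->
  N / 2 < y -> y < k -> k < N ->
  (k - y) ^+ 2 <= 2 * ((1 + delta / 2) * L) * (N - k) ->
  (delta / 8 * N < N - k -> (k - y) ^+ 2 <= 2 * ((1 + delta) * L / 4) * (N - k)) ->
  (k - y) ^+ 2 * (N - k + y) < (1 + delta) * L * (2 * (y * (N - k))).
Proof.
move=> /andP[d0 d1] L0 yhalf yk kN dev1 dev2.
have x0 : 0 < (1 + delta) * L by rewrite mulr_gt0//; lra.
have x10 : 0 < (1 + delta / 2) * L by rewrite mulr_gt0//; lra.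
have x1x : (1 + delta / 2) * L * (1 + delta / 4) <= (1 + delta) * L.
  rewrite mulrAC ler_pM2r//; nra.
move: x0 x10 x1x dev1 dev2.
move: ((1 + delta) * L) ((1 + delta / 2) * L) => x x1 x0 x10 x1x dev1 dev2.
have j0 : 0 < N - k by lra.
have s0 : 0 < N - k + y by lra.
have [je|je] := leP (N - k) (delta / 8 * N).
  have dy : delta / 8 * N < delta / 8 * (2 * y) by rewrite ltr_pM2l//; lra.
  have h1 : (k - y) ^+ 2 * (N - k + y) <= 2 * x1 * (N - k) * (N - k + y).
    by rewrite ler_pM2r.
  have h2 : x1 * (N - k + y) < x1 * ((1 + delta / 4) * y) by rewrite ltr_pM2l//; lra.
  have h3 : x1 * (1 + delta / 4) * y <= x * y by rewrite ler_pM2r//; lra.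
  have h4 : 2 * (N - k) * (x1 * (N - k + y)) < 2 * (N - k) * (x * y).
    rewrite ltr_pM2l ?mulr_gt0//; lra.
  lra.
have h1 : (k - y) ^+ 2 * (N - k + y) <= 2 * (x / 4) * (N - k) * (N - k + y).
  by rewrite ler_pM2r//; exact: dev2.
have h2 : 2 * (N - k) * (x / 4 * (N - k + y)) < 2 * (N - k) * (x / 4 * (4 * y)).
  rewrite ltr_pM2l ?mulr_gt0// ltr_pM2l; lra.
lra.
Qed.

(* The four estimates cover: [p_(t)] below 1/2 or above it, and the deviation
   point within distance [delta / 8] of the end of the unit interval (where the
   threshold must have the sharp constant) or not (where a quarter of it is enough). *)
Lemma type1_bound (c s delta L rho y0 : R) (K K2 : nat) :
  let x := (1 + delta) * L in
  let x1 := (1 + delta / 2) * L in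
  let eta := delta / 8 in
  -1 <= s <= 2 -> L = ln (ln n%:R) ->
  0 < delta <= 1 -> 0 < L -> 1 < rho -> 0 < y0 <= 1 ->
  n%:R <= y0 * rho ^+ K -> 1 <= eta * 2 ^+ K2 -> 32 * x <= n%:R ->
  pr P [set om | tr_gof_reject n c s delta (Y^~ om)] <=
    y0 + (block_sum x1 rho y0 K + block_sum (x / 4) 2 (eta * n%:R) K2 +
     (block_sum x1 rho 1 K + block_sum (x / 4) 2 (eta * n%:R) K2)).
Proof.
move=> x x1 eta hs LE /andP[d0 d1] L0 rho1 /andP[y00 y01] hKn hK2 hx.
have x0 : 0 < x by rewrite mulr_gt0//; lra.
have x10 : 0 < x1 by rewrite mulr_gt0//; lra.
have x40 : 0 < x / 4 by lra.
have eta0 : 0 < eta by rewrite /eta; lra.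
have n0 : 0 < n%:R :> R by lra.
have nn : (0 < n)%N by move: n0; rewrite ltr0n.
have etan : 0 < eta * n%:R by rewrite mulr_gt0.
have th0 : 0 < (1 + delta) * ln (ln n%:R) :> R by rewrite -LE.
have mS := @measurable_tr_gof_reject _ R _ n _ (@nm_Y_meas R n H) c s delta th0.
apply: outer_le_pr mS _.
have two1 : 1 < 2 :> R by lra.
have y01' : 0 < y0 <= 1 by rewrite y00.
(* The quarter-threshold blocks start at [eta * n] with ratio 2, so [K2] of them reach [n] whatever
   [n] is. *)
apply: outer_leS (outer_leU (nm_small_pvalue H nn y01')
  (outer_leU (outer_leU (nm_up H K x10 rho1 y00) (nm_up H K2 x40 two1 etan))
    (outer_leU (nm_down H K x10 rho1 ltr01) (nm_down H K2 x40 two1 etan)))) => //.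
move=> om /(tr_gof_rejectP _ _ _ th0)[t [_ hKs]]; apply/not_notP.
move=> /not_orP[nF /not_orP[/not_orP[nU1 nU2] /not_orP[nD1 nD2]]].
set ps := sort _ _ in hKs; set v := nth 1 ps t in hKs.
have tn : (t < size [seq (1 - Y i om)%R | i <- iota 1 n])%N by rewrite size_map size_iota.
have vcnt := count_le_nth_sort tn; have vcnt' := count_gt_nth_sort tn.
move: vcnt vcnt'; rewrite -/ps -/v.
rewrite !count_pvalues size_map size_iota => cle cgt.
move: hKs; rewrite -LE -/x /K_s_plus; case: ifP; last by rewrite mulr0; lra.
move=> /andP[/andP[v0 vu] u1].
move=> /le_trans/(_ (ler_wpM2l (ltW n0) (K_s_ub hs v0 vu u1))).
pose N : R := n%:R; pose Tt : R := t.+1%:R; pose y := N * v; pose dd := Tt - y.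
have N0 : 0 < N by [].
have y_gt0 : 0 < y by rewrite mulr_gt0.
have TN : Tt < N by move: u1; rewrite ltr_pdivrMr// mul1r.
have dd0 : 0 < dd by rewrite subr_gt0 /y mulrC -ltr_pdivlMr.
have vE : v = y / N by rewrite /y mulrC mulKf// gt_eqF.
have j0 : 0 < N - Tt by rewrite subr_gt0.
rewrite -/N -/Tt [X in x <= X](_ : _ = dd ^+ 2 * (N - Tt + y) / (2 * (y * (N - Tt)))); last first.
  exact: rescaled_bound.
rewrite ler_pdivlMr ?mulr_gt0// => hK.
have v1 : v < 1 by apply: lt_trans u1.
have yN : y < N by rewrite /y gtr_pMr.
have NK2 : N <= eta * N * 2 ^+ K2.
  by rewrite mulrAC -[leLHS]mul1r ler_pM2r.
(* [v] is itself one of the p-values, so the bound on the smallest p-value applies to it. *)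
have vy0 : y0 <= y.
  rewrite leNgt; apply/negP => yy; apply: nF.
  have : v \in ps by apply: mem_nth; rewrite size_sort.
  rewrite mem_sort => /mapP[i]; rewrite mem_iota => /andP[i1 i2] vi.
  have i3 : (i.-1 < n)%N by rewrite prednK// -ltnS.
  exists (Ordinal i3) => /=; rewrite prednK// -vi vE ltr_pM2r// invr_gt0//.
suff : dd ^+ 2 * (N - Tt + y) < x * (2 * (y * (N - Tt))) by rewrite ltNge hK.
have hd : 0 < delta <= 1 by rewrite d0.
have yT : y < Tt by rewrite -subr_gt0.
have [yhalf|yhalf] := leP y (N / 2).
  have dev r : ~ (y + Num.sqrt r <= (nm_cnt_le v om)%:R) -> dd ^+ 2 < r.
    move=> h; apply: sqrt_lt; first exact: ltW.
    rewrite ltNge; apply/negP => h'; apply: h.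
    apply: (@le_trans _ _ Tt); last by rewrite ler_nat.
    by rewrite -lerBrDl.
  apply: low_deviation => //.
    by apply: dev => h; apply: nU1; exists v; split => //; exact: lt_le_trans yN hKn.
  move=> ye; apply: dev => h; apply: nU2; exists v; split => //; first exact: ltW.
  exact: lt_le_trans yN NK2.
pose j := (n - t.+1)%N.
have jE : j%:R = N - Tt by rewrite /j natrB.
pose w := 1 - v.
have wE : N * w = N - y by rewrite /w mulrBr mulr1.
have hcnt : (nm_cnt_lt w om <= j)%N.
  apply: leq_trans cgt; apply: leq_sum => i _; case: (ltP (Y i.+1 om) w) => // h.
  by rewrite ltrBrDl -ltrBrDr h.
have w1 : w <= 1 by rewrite gerBl ltW.
have dev r : 0 <= r -> ~ (j%:R + Num.sqrt r < N * w) -> dd ^+ 2 <= r.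
  move=> r0 h; apply: sqrt_le => //; first exact: ltW.
  rewrite leNgt; apply/negP => h'; apply: h.
  have -> : N * w = j%:R + dd by rewrite jE wE /dd; ring.
  by rewrite ltrD2l.
have j1 : 1 <= j%:R :> R.
  by rewrite ler1n /j subn_gt0; move: TN; rewrite /Tt /N ltr_nat.
have jN : j%:R < N by rewrite jE gtrBl ltr0n.
have jj0 : 0 <= N - Tt by exact: ltW.
apply: high_deviation => //; rewrite -jE.
  apply: dev; first by rewrite jE mulr_ge0// mulr_ge0// ltW.
  move=> h; apply: nD1; exists w, j; split => //.
  rewrite mul1r; apply: lt_le_trans jN _; apply: le_trans hKn _.
  by rewrite ler_piMl// exprn_ge0// ltW// (lt_trans ltr01).
move=> je; apply: dev; first by rewrite jE mulr_ge0// mulr_ge0// ltW.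
move=> h; apply: nD2; exists w, j; split => //; first exact: ltW.
exact: lt_le_trans jN NK2.
Qed.

End TypeIBound.

(** * Growth estimates *)

Section Asymptotics.
Variable R : realType.

Lemma expR_ge_sqr (z : R) : 0 <= z -> z ^+ 2 / 2 <= expR z.
Proof.
move=> z0; have h := @expR_ge1Dxn R z 1 z0.
have e2 : (2`! = 2)%N by [].
by rewrite e2 in h; lra.
Qed.

Lemma expRN_le_inv (z : R) : 0 < z -> expR (- z) <= z^-1.
Proof.
move=> z0; rewrite expRN lef_pV2 ?posrE ?expR_gt0//.
by have := expR_ge1Dx z; lra.
Qed.

Lemma expRN_le_inv4 (z : R) : 0 < z -> expR (- z) <= (4 / z) ^+ 4.
Proof.
move=> z0; have z4 : 0 < z / 4 by lra.
have -> : - z = 4%:R * - (z / 4) by field.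
rewrite expRM_natl -(invf_div z); apply: lerXn2r.
- by rewrite nnegrE expR_ge0.
- by rewrite nnegrE invr_ge0 ltW.
- exact: expRN_le_inv.
Qed.

Lemma near_ln_ge (B : R) : exists N, forall n, (N <= n)%N -> B <= ln n%:R :> R.
Proof.
exists (Num.bound (expR B)) => n Nn.
have h : expR B <= n%:R.
  apply: ltW; apply: lt_le_trans (archi_boundP (expR_ge0 B)) _.
  by rewrite ler_nat.
by rewrite -(expRK B) ler_ln ?posrE ?expR_gt0//; apply: lt_le_trans h; exact: expR_gt0.
Qed.

Lemma near_lnln_ge (B : R) : exists N, forall n, (N <= n)%N -> B <= ln (ln n%:R) :> R.
Proof.
have [N hN] := near_ln_ge (expR B); exists N => n /hN h.
by rewrite -(expRK B) ler_ln ?posrE ?expR_gt0//; apply: lt_le_trans h; exact: expR_gt0.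
Qed.

Lemma near_lnln_le_lin (c : R) : 0 < c ->
  exists N, forall n, (N <= n)%N -> ln (ln n%:R) <= c * n%:R :> R.
Proof.
move=> c0; have [N hN] := near_ln_ge (2 / c + 1); exists N => n /hN h.
have c20 : 0 < 2 / c by rewrite divr_gt0.
have l0 : 0 < ln (n%:R : R) by lra.
have n0 : 0 < n%:R :> R.
  by rewrite ltNge; apply/negP => n0; rewrite ln0// ltxx in l0.
apply: (@le_trans _ _ (ln n%:R)); first exact/ltW/ln_sublinear.
rewrite -[X in c * X](@lnK R n%:R) ?posrE//.
apply: (@le_trans _ _ (c * (ln n%:R ^+ 2 / 2))); last first.
  by rewrite ler_pM2l// expR_ge_sqr// ltW.
have h2 : 2 / c <= ln (n%:R : R) by lra.
move: h2; rewrite ler_pdivrMr// => h2; nra.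
Qed.

Lemma block_sum_le_const (x rho y0 : R) K : 0 < x -> 1 < rho -> 2 * x <= y0 ->
  block_sum x rho y0 K <= K%:R * expR (- (x / (2 * rho))).
Proof.
move=> x0 rho1 xy; have rho0 : 0 < rho by lra.
have xr0 : 0 < x / rho by rewrite divr_gt0.
rewrite mulr_natl; apply: le_trans (_ : _ <= \sum_(k < K) expR (- (x / (2 * rho)))) _; last first.
  by rewrite sumr_const card_ord.
apply: ler_sum => k _; rewrite ler_expR lerN2.
have -> : x / (2 * rho) = x / rho / 2 by field; rewrite gt_eqF.
have s0 (r : R) : 0 < 1 + Num.sqrt r by rewrite ltr_wpDr// sqrtr_ge0.
rewrite ler_pM2l// lef_pV2 ?posrE//.
rewrite [leRHS](_ : 2 = 1 + Num.sqrt 1); last by rewrite sqrtr1; lra.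
have rk : 1 <= rho ^+ k by rewrite exprn_ege1// ltW.
have y00 : 0 < y0 by lra.
have yk : y0 <= y0 * rho ^+ k by apply: ler_peMr => //; exact: ltW.
rewrite lerD2l; apply: ler_wsqrtr; rewrite ler_pdivrMr ?mul1r; last by lra.
lra.
Qed.

(** [C] is chosen so that [1 + sqrt (2 / C) = rho]. For [x >= 1] the worst block costs at most
    [expR (- a * sqrt x)]; its fourth-power bound decays like [1 / x ^+ 2], one power more than the
    [O(x)] early blocks consume. *)
Lemma block_sum_le_inv (rho y0 : R) : 1 < rho -> 0 < y0 ->
  exists2 D, 0 <= D & forall x K, 1 <= x ->
    block_sum x rho y0 K <= K%:R * expR (- (x / rho ^+ 2)) + D / x.
Proof.
move=> rho1 y00; have rho0 : 0 < rho by lra.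
pose C := 2 / (rho - 1) ^+ 2.
have r10 : 0 < rho - 1 by lra.
have C0 : 0 < C by rewrite divr_gt0// exprn_gt0.
have hC : 1 + Num.sqrt (2 / C) <= rho.
  rewrite /C invf_div mulrCA divff// mulr1 sqrtr_sqr gtr0_norm//; lra.
pose B := C / (y0 * (rho - 1)).
have B0 : 0 <= B by apply/ltW/divr_gt0 => //; exact: mulr_gt0.
pose a := (rho * (1 + Num.sqrt (2 / y0)))^-1.
have s0 (r : R) : 0 < 1 + Num.sqrt r by rewrite ltr_wpDr// sqrtr_ge0.
have a0 : 0 < a by rewrite invr_gt0 mulr_gt0.
exists ((B + 1) * (4 / a) ^+ 4).
  apply: mulr_ge0; first exact: addr_ge0.
  by apply/exprn_ge0/ltW/divr_gt0.
move=> x K x1; have x0 : 0 < x by lra.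
apply: le_trans (block_sum_le K x0 rho1 y00 C0 hC) _; rewrite lerD2l.
pose r := Num.sqrt x.
have r2 : r ^+ 2 = x by rewrite sqr_sqrtr// ltW.
have r0 : 0 < r by rewrite sqrtr_gt0.
have r1 : 1 <= r by rewrite -[leLHS]sqrtr1; exact: ler_wsqrtr.
have hexp : expR (- (x / rho / (1 + Num.sqrt (2 * x / y0)))) <= (4 / (a * r)) ^+ 4.
  apply: le_trans (expRN_le_inv4 (mulr_gt0 a0 r0)); rewrite ler_expR lerN2.
  have -> : Num.sqrt (2 * x / y0) = r * Num.sqrt (2 / y0).
    by rewrite mulrAC mulrC sqrtrM// ltW.
  rewrite -r2 /a invfM.
  have -> : rho^-1 / (1 + Num.sqrt (2 / y0)) * r = r ^+ 2 / rho / (r * (1 + Num.sqrt (2 / y0))).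
    by field; rewrite !gt_eqF.
  rewrite ler_pM2l ?divr_gt0 ?exprn_gt0// lef_pV2 ?posrE ?mulr_gt0//; last first.
    by rewrite ltr_wpDr// mulr_ge0 ?sqrtr_ge0// ltW.
  by rewrite mulrDr mulr1 lerD2r.
have -> : C * x / (y0 * (rho - 1)) = B * x by rewrite /B mulrAC.
apply: le_trans (ler_wpM2l _ hexp) _; first by rewrite addr_ge0// mulr_ge0// ltW.
have -> : (4 / (a * r)) ^+ 4 = (4 / a) ^+ 4 / x / x.
  by rewrite -r2; field; rewrite !gt_eqF.
rewrite [leLHS](_ : _ = (B + x^-1) * (4 / a) ^+ 4 / x); last first.
  by field; rewrite !gt_eqF.
rewrite ler_pM2r ?invr_gt0// ler_pM2r ?exprn_gt0 ?divr_gt0//.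
by rewrite lerD2l invf_le1.
Qed.

End Asymptotics.

(** * The Type I error vanishes *)

Section TypeI.
Variable R : realType.

Lemma type1_error (delta s e : R) (c : nat -> R) (H : forall n, null_model R n) :
  0 < delta <= 1 -> -1 <= s <= 2 -> 0 < e ->
  exists N, forall n, (N <= n)%N ->
    pr (nm_Pr (H n)) [set x | tr_gof_reject n (c n) s delta (fun t => nm_Y (H n) t x)] <= e.
Proof.
move=> hd hs e0; have /andP[d0 d1] := hd.
pose y0 := Num.min 1 (e / 2).
have y00 : 0 < y0 by rewrite lt_min ltr01 divr_gt0.
have y01 : y0 <= 1 by rewrite ge_min lexx.
have y0e : y0 <= e / 2 by rewrite ge_min lexx orbT.
(* This makes [x1 / rho ^+ 2] equal to [L + g * L]: the part [L] cancels the number of blocks, and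
   the surplus [g * L] drives the sum to zero. *)
pose rho := Num.sqrt (1 + delta / 4).
have rho2 : rho ^+ 2 = 1 + delta / 4 by rewrite sqr_sqrtr//; lra.
have rho1 : 1 < rho by rewrite -sqrtr1 ltr_sqrt; lra.
have rho0 : 0 < rho by lra.
have lr0 : 0 < ln rho by rewrite ln_gt0.
pose g := (delta / 4) / (1 + delta / 4).
have g0 : 0 < g by rewrite divr_gt0//; lra.
pose eta := delta / 8.
have eta0 : 0 < eta by rewrite /eta; lra.
have [K2 hK2] : exists K2 : nat, 1 <= eta * 2 ^+ K2.
  exists (Num.bound (eta^-1)); rewrite -ler_pdivrMl// mulr1; apply: ltW; apply: lt_le_trans (archi_boundP _) _.
    by rewrite invr_ge0 ltW.
  by rewrite -natrX ler_nat ltnW// ltn_expl.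
have [D1 D10 hD1] := block_sum_le_inv rho1 y00.
have [D2 D20 hD2] := block_sum_le_inv rho1 (@ltr01 R).
pose A := (1 + `|ln y0|) / ln rho + 1.
have A0 : 0 <= A by rewrite addr_ge0// divr_ge0 ?addr_ge0// ltW.
pose M := 2 * A / g + D1 + D2 + 32 * K2%:R.
have M0 : 0 <= M.
  by rewrite !addr_ge0// ?mulr_ge0 ?invr_ge0 ?(ltW g0).
have [N1 hN1] := @near_lnln_ge R (1 + 2 * M / e).
have c0 : 0 < eta / 64 by lra.
have [N2 hN2] := near_lnln_le_lin c0.
have [N3 hN3] := @near_ln_ge R 1.
exists (N1 + N2 + N3)%N => n Nn.
have L1 := hN1 n (leq_trans (leq_trans (leq_addr _ _) (leq_addr _ _)) Nn).
have Ln := hN2 n (leq_trans (leq_trans (leq_addl _ _) (leq_addr _ _)) Nn).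
have ln1n := hN3 n (leq_trans (leq_addl _ _) Nn).
pose L := ln (ln (n%:R : R)); rewrite -/L in L1 Ln.
have Me0 : 0 <= 2 * M / e by rewrite divr_ge0 ?mulr_ge0// ltW.
have L1' : 1 <= L by lra.
have L0 : 0 < L by lra.
have ln0n : 0 < ln (n%:R : R) by lra.
have n0 : 0 < n%:R :> R.
  by rewrite ltNge; apply/negP => n0; rewrite ln0// ltxx in ln0n.
have ly0 : ln y0 <= 0 by exact: ln_le0.
(* Enough blocks to lead from [y0] to [n]; their number is [O(ln n)], that is [O(expR L)]. *)
have [K hK KA] : exists2 K : nat, n%:R <= y0 * rho ^+ K & K%:R <= A * ln n%:R.
  have z0 : 0 <= (ln n%:R - ln y0) / ln rho.
    by rewrite divr_ge0 ?(ltW lr0)// subr_ge0 (le_trans ly0)// ltW.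
  exists (Num.trunc ((ln n%:R - ln y0) / ln rho)).+1.
    rewrite -ler_pdivrMl// mulrC.
    rewrite -(@ler_ln R) ?posrE ?divr_gt0 ?exprn_gt0// ln_div ?posrE//.
    rewrite lnXn// -[ln rho *+ _]mulr_natl -ler_pdivrMr//; apply: ltW.
    exact: truncnS_gt.
  have -> : A * ln n%:R = (1 + `|ln y0|) / ln rho * ln n%:R + ln n%:R by rewrite /A; ring.
  rewrite -natr1; apply: lerD => //.
  apply: le_trans (_ : _ <= (ln n%:R - ln y0) / ln rho) _; first by rewrite truncn_le.
  rewrite mulrAC ler_pM2r ?invr_gt0//.
  by rewrite mulrDl mul1r lerD2l ler0_norm// ler_peMr// oppr_ge0.
have x32 : 32 * ((1 + delta) * L) <= n%:R.
  have : eta * n%:R <= 8^-1 * n%:R by rewrite ler_pM2r// /eta; lra.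
  have : (1 + delta) * L <= 2 * L by rewrite ler_pM2r//; lra.
  lra.
have y01' : 0 < y0 <= 1 by rewrite y00.
apply: le_trans (type1_bound (H n) (c n) hs erefl hd L0 rho1 y01' hK hK2 x32) _.
rewrite -/L -/eta.
pose x := (1 + delta) * L; pose x1 := (1 + delta / 2) * L; rewrite -/x -/x1.
have x1L : L <= x1 by rewrite /x1 ler_peMl ?ltW//; lra.
have xL : L <= x by rewrite /x ler_peMl ?ltW//; lra.
have x11 : 1 <= x1 by lra.
have x40 : 0 < x / 4 by lra.
have xen : 2 * (x / 4) <= eta * n%:R.
  have : x <= 2 * L by rewrite /x ler_pM2r//; lra.
  lra.
have b1 := hD1 x1 K x11; have b2 := hD2 x1 K x11.
have two1 : 1 < 2 :> R by lra.
have b3 := block_sum_le_const K2 x40 two1 xen.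
have e1 : K%:R * expR (- (x1 / rho ^+ 2)) <= A / g / L.
  have -> : x1 / rho ^+ 2 = L + g * L.
    by rewrite rho2 /x1 /g; field; apply/eqP; lra.
  rewrite opprD expRD expRN lnK ?posrE// mulrA.
  apply: le_trans (_ : _ <= A * expR (- (g * L))) _.
    by rewrite ler_pM2r ?expR_gt0// ler_pdivrMr.
  by rewrite -mulrA ler_wpM2l// -invfM expRN_le_inv// mulr_gt0.
have e2 : K2%:R * expR (- (x / 4 / (2 * 2))) <= K2%:R * (16 / L).
  rewrite ler_wpM2l//; apply: le_trans (expRN_le_inv _) _; first by lra.
  have -> : (x / 4 / (2 * 2))^-1 = 16 / x by field; apply/eqP; lra.
  by rewrite ler_pM2l// lef_pV2 ?posrE//; lra.
have e3 : D1 / x1 <= D1 / L by rewrite ler_wpM2l// lef_pV2 ?posrE//; lra.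
have e4 : D2 / x1 <= D2 / L by rewrite ler_wpM2l// lef_pV2 ?posrE//; lra.
have : M / L <= e / 2.
  rewrite ler_pdivrMr// mulrAC ler_pdivlMr//.
  have : 2 * M / e <= L by lra.
  by rewrite ler_pdivrMr//; lra.
rewrite /M; lra.
Qed.

End TypeI.

(** * The Gumbel-max decoder *)

Section GumbelDecoder.
Variables (R : realType) (W : finType).

Lemma gumbel_decP (w0 : W) (P u : W -> R) : (exists w, 0 < P w) ->
  0 < P (gumbel_dec w0 P u) /\
  forall w, 0 < P w -> ln (u w) / P w <= ln (u (gumbel_dec w0 P u)) / P (gumbel_dec w0 P u).
Proof.
move=> [w1 Pw1]; rewrite /gumbel_dec.
set i0 := Order.arg_max w0 xpredT P.
have Pi0 : 0 < P i0.
  rewrite /i0; case: Order.TotalTheory.arg_maxP => // i _ h.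
  exact: lt_le_trans Pw1 (h w1 _).
by case: Order.TotalTheory.arg_maxP => // i Pi h; split.
Qed.

Definition gumbel_winners (P u : W -> R) : pred W := [pred i | (0 < P i) &&
  [forall (j | 0 < P j), ln (u j) / P j <= ln (u i) / P i]].

(** The decoder depends on its arguments only through the set of winners, and not on the default
    token. As there are finitely many such sets, its measurability becomes a finite matter. *)
Lemma gumbel_dec_pick (w0 : W) (P u : W -> R) : (exists w, 0 < P w) ->
  [pick i in gumbel_winners P u] = Some (gumbel_dec w0 P u).
Proof.
move=> ex; have [g1 g2] := gumbel_decP w0 u ex.
have hg : gumbel_winners P u (gumbel_dec w0 P u).
  by rewrite /gumbel_winners/= g1; apply/forallP => j; apply/implyP => Pj; exact: g2.
rewrite /gumbel_dec /Order.arg_max /extremum.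
rewrite (eq_pick (Q := mem (gumbel_winners P u))); last first.
  by move=> i; rewrite inE.
case: pickP => // /(_ (gumbel_dec w0 P u)) h.
by have : false by rewrite -h; exact: hg.
Qed.

End GumbelDecoder.

(** * One round of the watermark model, given the past *)

Section WatermarkModel.
Variables (R : realType) (W : finType) (n : nat) (eps Delta : R).
Variable M : wm_model W n eps Delta.
Notation Pr := (wm_Pr M).
Notation U := (wm_U M).
Notation P := (wm_P M).
Notation tok := (wm_tok M).
Notation wmk := (wm_wmk M).
Notation Y := (wm_Y M).

Definition hist (t : nat) (A : set (wm_Omega M)) : Prop :=
  @measurable _ (g_sigma_algebraType (hist_gen U P tok t)) A.

Lemma measurable_U_le t w r : measurable [set x | U t w x <= r].
Proof.
rewrite (_ : mkset _ = setT `&` U t w @^-1` `]-oo, r]); last first.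
  by apply/seteqP; split => x /=; rewrite ?in_itv/=; [split|case].
exact: (@wm_U_meas _ _ _ _ _ M t w measurableT _ (measurable_itv _)).
Qed.

Lemma measurable_P_le t w r : measurable [set x | P t w x <= r].
Proof.
rewrite (_ : mkset _ = setT `&` P t w @^-1` `]-oo, r]); last first.
  by apply/seteqP; split => x /=; rewrite ?in_itv/=; [split|case].
exact: (@wm_P_meas _ _ _ _ _ M t w measurableT _ (measurable_itv _)).
Qed.

Lemma hist_measurable t A : hist t A -> measurable A.
Proof.
apply: (@smallest_sub _ _ _ (@measurable _ (wm_Omega M))).
  exact: sigma_algebra_measurable.
move=> B [j [_ [[a ->]|[[w [r ->]]|[w [r ->]]]]]].
- exact: wm_tok_meas.
- exact: measurable_U_le.
- exact: measurable_P_le.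
Qed.

Lemma hist_gen_in t A : hist_gen U P tok t A -> hist t A.
Proof. exact: sub_sigma_algebra. Qed.

Lemma hist_le t t' A : (t <= t')%N -> hist t A -> hist t' A.
Proof.
move=> tt'; apply: (@smallest_sub _ _ _ (hist t')).
  exact: smallest_sigma_algebra.
move=> B [j [/andP[j1 jt] hj]]; apply: hist_gen_in; exists j; split => //.
by rewrite j1 (leq_trans jt).
Qed.

Lemma histI t A B : hist t A -> hist t B -> hist t (A `&` B).
Proof. exact: measurableI. Qed.

Lemma histC t A : hist t A -> hist t (~` A).
Proof. exact: measurableC. Qed.

Lemma histT t : hist t setT.
Proof. exact: measurableT. Qed.

Lemma hist_forall t (I : finType) (F : I -> set (wm_Omega M)) :
  (forall i, hist t (F i)) -> hist t [set x | forall i, F i x].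
Proof. exact: (@measurable_fin_forall _ (g_sigma_algebraType (hist_gen U P tok t))). Qed.

Lemma Y_leE t r : [set x | Y t x <= r] =
  \big[setU/set0]_(a : W) (tok t @^-1` [set a] `&` [set x | U t a x <= r]).
Proof.
apply/seteqP; split => x.
  by move=> /= Yr; apply/bigsetU_seqE; exists (tok t x); split => //; rewrite mem_index_enum.
by move=> /bigsetU_seqE[a [_ _ [/= ta]]]; rewrite /wm_Y ta.
Qed.

Lemma measurable_Y_le t r : measurable [set x | Y t x <= r].
Proof.
rewrite Y_leE; apply: bigsetU_measurable => a _; apply: measurableI.
  exact: wm_tok_meas.
exact: measurable_U_le.
Qed.

Lemma measurable_Y t : measurable_fun setT (Y t).
Proof.
move=> _; apply: (measurability _ (RGenOInfty.measurableE R)) => //.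
move=> _ [_ [r ->] <-]; apply: measurableI => //.
rewrite [X in measurable X](_ : _ = ~` [set x | Y t x <= r]).
  exact/measurableC/measurable_Y_le.
apply/seteqP; split => x /=; rewrite in_itv/= andbT ltNge; first by move/negP.
by move=> /negP.
Qed.

Lemma hist_Y_le j t r : (1 <= j < t)%N -> hist t [set x | Y j x <= r].
Proof.
move=> jt; rewrite Y_leE.
apply: (@bigsetU_measurable _ (g_sigma_algebraType (hist_gen U P tok t))) => a _.
apply: histI; apply: hist_gen_in; exists j; split => //.
  by left; exists a.
by right; left; exists a, r.
Qed.

Lemma hist_P_le t w r : (2 <= t)%N -> hist t [set x | P t w x <= r].
Proof.
case: t => // t; rewrite ltnS => t1; apply: hist_gen_in; exists t.
by rewrite t1 ltnSn; split => //; right; right; exists w, r.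
Qed.

Lemma hist_P_ge t w r : (2 <= t)%N -> hist t [set x | r <= P t w x].
Proof.
move=> t2.
have mP : @measurable_fun _ _ (g_sigma_algebraType (hist_gen U P tok t)) R setT (P t w).
  move=> _; apply: (measurability _ (RGenOInfty.measurableE R)) => //.
  move=> _ [_ [s ->] <-]; apply: measurableI => //.
  rewrite [X in measurable X](_ : _ = ~` [set x | P t w x <= s]).
    by apply: histC; exact: hist_P_le.
  apply/seteqP; split => x /=; rewrite in_itv/= andbT ltNge; first by move/negP.
  by move=> /negP.
rewrite (_ : mkset _ = setT `&` P t w @^-1` `[r, +oo[); last first.
  by apply/seteqP; split => x /=; rewrite ?in_itv/= ?andbT; [split|case].
exact: (mP measurableT _ (measurable_itv _)).
Qed.

Lemma measurable_xi_rect t r : measurable (xi_rect U t r).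
Proof. by apply: measurable_fin_forall => w; exact: measurable_U_le. Qed.

Section Round.
Variable t : nat.
Hypothesis tn : (1 <= t <= n)%N.

Lemma pr_xi_rect A (r : W -> R) : hist t A ->
  pr Pr (A `&` xi_rect U t r) = pr Pr A * \prod_w clamp01 (r w).
Proof.
move=> hA; apply: EFin_inj.
have mA := hist_measurable hA; have mr := measurable_xi_rect t r.
rewrite EFinM -!prE//; last exact: measurableI.
exact: wm_A_a.
Qed.

Lemma pr_xi_rect_wmk A (r : W -> R) : hist t A ->
  pr Pr (A `&` xi_rect U t r `&` wmk t) = eps * (pr Pr A * \prod_w clamp01 (r w)).
Proof.
move=> hA; rewrite -pr_xi_rect//; apply: EFin_inj.
have mA := hist_measurable hA; have mr := measurable_xi_rect t r.
have mAr : measurable (A `&` xi_rect U t r) by exact: measurableI.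
rewrite EFinM -!prE//; last by apply: measurableI => //; exact: wm_wmk_meas.
exact: wm_A_b_coin.
Qed.

Lemma clamp01_prod1 : \prod_(w : W) clamp01 (1 : R) = 1.
Proof. by rewrite big1// => w _; rewrite clamp01_id//; lra. Qed.

(** With [A] the whole space and the unit rectangle, the coin assumption exhibits [eps] as a
    probability. *)
Lemma eps01 : 0 <= eps <= 1.
Proof.
have h := pr_xi_rect_wmk (fun=> 1) (@histT t).
rewrite setTI clamp01_prod1 pr_setT !mulr1 in h.
rewrite -h pr_ge0/= -(pr_setT Pr); apply: pr_le => //.
by apply: measurableI; [exact: measurable_xi_rect|exact: wm_wmk_meas].
Qed.

Let unit_rect := xi_rect U t (fun=> 1).

Let mu : measurable unit_rect. Proof. exact: measurable_xi_rect. Qed.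
Let mw : measurable (wmk t). Proof. exact: wm_wmk_meas. Qed.
Let mtok a : measurable (tok t @^-1` [set a]). Proof. exact: wm_tok_meas. Qed.

Let pr_unit : pr Pr (~` unit_rect) = 0.
Proof.
rewrite pr_setC// -[unit_rect]setTI pr_xi_rect; last exact: histT.
by rewrite pr_setT clamp01_prod1 mulr1 subrr.
Qed.

(** Given the token [a], the event is [U_a <= r]. The rectangles with side [r] or 1 at [a] share the
    same integral of [P_a], so only their ratio [r] matters and the integral is never evaluated;
    summing over [a] restores the mass of unwatermarked rounds. *)
Lemma pr_free_le A r : hist t A -> 0 <= r <= 1 ->
  pr Pr (A `&` [set x | Y t x <= r] `&` ~` wmk t) <= r * ((1 - eps) * pr Pr A).
Proof.
move=> hA r01; have mA := hist_measurable hA; have mwC := measurableC mw.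
pose ra (a w : W) : R := if w == a then r else 1.
pose X a := A `&` xi_rect U t (ra a) `&` ~` wmk t `&` tok t @^-1` [set a].
pose Z a := A `&` unit_rect `&` ~` wmk t `&` tok t @^-1` [set a].
have mX a : measurable (X a).
  by do 3 (apply: measurableI => //); exact: measurable_xi_rect.
have mZ a : measurable (Z a) by do 3 apply: measurableI => //.
have XZ a : pr Pr (X a) = r * pr Pr (Z a).
  apply: EFin_inj; rewrite EFinM -!prE// (wm_A_b_free tn hA) (wm_A_b_free tn hA).
  rewrite clamp01_prod1 mulr1 muleA -EFinM; congr (_%:E * _)%E.
  rewrite mulrC; congr (_ * _); rewrite (bigD1 a)//= /ra eqxx clamp01_id//.
  by rewrite big1 ?mulr1// => w /negPf ->; rewrite clamp01_id//; lra.
have sumZ : \sum_a pr Pr (Z a) = (1 - eps) * pr Pr A.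
  rewrite -(@pr_fin_partition _ _ _ Pr _ _ (A `&` unit_rect `&` ~` wmk t))//.
  - have := @prDI _ _ _ Pr _ _ (measurableI _ _ mA mu) mw.
    rewrite pr_xi_rect_wmk// pr_xi_rect// clamp01_prod1 mulr1 setDE => h; lra.
  - by do 2 apply: measurableI => //.
  - by move=> x h; exists (tok t x); split.
  - by move=> a x [].
  - by move=> a b x [_ /= ha] [_ /= hb]; rewrite -ha -hb.
rewrite -sumZ mulr_sumr; under eq_bigr do rewrite -XZ.
have mS : measurable (A `&` [set x | Y t x <= r] `&` ~` wmk t).
  by do 2 apply: measurableI => //; exact: measurable_Y_le.
rewrite (@prDI _ _ _ Pr _ unit_rect mS mu) -[leRHS]add0r; apply: lerD.
  rewrite -pr_unit; apply: pr_le; [exact: measurableD|exact: measurableC|].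
  by move=> x [].
apply: pr_fin_sub => //; first exact: measurableI.
move=> x [[[Ax Yx] wx] ux]; exists (tok t x) => //; split => //; split => //; split => //.
by move=> w; rewrite /ra; case: eqP => [->|_]//; exact: ux.
Qed.

Lemma sum_P x : \sum_(w : W) P t w x = 1.
Proof. exact: wm_P_sum1. Qed.

Lemma exists_P_gt0 x : exists w, 0 < P t w x.
Proof.
apply: contrapT => h; have := sum_P x; rewrite big1; first by move/esym/eqP; rewrite oner_eq0.
move=> w _; apply/eqP; rewrite eq_le wm_P_ge0 andbT leNgt; apply/negP => Pw.
by apply: h; exists w.
Qed.

Lemma P_le_max w x : P t w x <= 1 - Delta.
Proof.
have hB := wm_B x tn.
have : P t w x <= \big[Num.max/0]_(w : W) P t w x.
  by apply: (@exists_bigmax_ge _ _ _ _ _ _ w) => //; rewrite mem_index_enum.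
lra.
Qed.

Lemma exists_P_max x : Delta < 1 -> exists w, P t w x = 1 - Delta.
Proof.
move=> D1; have := wm_B x tn => hB.
have := @bigmax_ge_exists R _ (index_enum W) xpredT (fun w => P t w x) (1 - Delta).
case; [lra|lra|].
move=> w [_ _ hw]; exists w; apply/eqP; rewrite eq_le hw andbT; exact: P_le_max.
Qed.

Lemma Delta_lt1 (x : wm_Omega M) : Delta < 1.
Proof.
have [w Pw] := exists_P_gt0 x; have := P_le_max w x; lra.
Qed.

Let measurable_Pinv w : measurable_fun setT (fun x => (P t w x)^-1).
Proof.
rewrite (_ : (fun x => _) = (fun x => P t w x `^ (-1))); last first.
  by apply/funext => x; rewrite powR_inv1// wm_P_ge0.
apply: (measurableT_comp (measurable_powR (-1))); exact: wm_P_meas.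
Qed.

Let measurable_score w : measurable_fun setT (fun x => ln (U t w x) / P t w x).
Proof.
apply: measurable_funM; last exact: measurable_Pinv.
by apply: (measurableT_comp (@measurable_ln R)); exact: wm_U_meas.
Qed.

Let measurable_gt0P w : measurable [set x | 0 < P t w x].
Proof.
rewrite (_ : mkset _ = ~` [set x | P t w x <= 0]); last first.
  by apply/seteqP; split => x /=; rewrite ltNge => /negP.
exact/measurableC/measurable_P_le.
Qed.

Let winners x := gumbel_winners (fun w => P t w x) (fun w => U t w x).

Let measurable_winner i : measurable [set x | winners x i].
Proof.
rewrite (_ : mkset _ = [set x | 0 < P t i x] `&`
  [set x | forall j, ([set x | P t j x <= 0] `|`
    [set x | ln (U t j x) / P t j x <= ln (U t i x) / P t i x]) x]).
  apply: measurableI => //; apply: measurable_fin_forall => j.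
  apply: measurableU; first exact: measurable_P_le.
  have := measurable_fun_ler (measurable_score j) (measurable_score i).
  move=> /(_ measurableT [set true] I); rewrite setTI.
  exact.
apply/seteqP; split => x /=.
  move=> /andP[Pi /forallP h]; split => // j; have := h j.
  by case: (ltP 0 (P t j x)) => Pj /=; [right|left].
move=> [Pi h]; rewrite /winners /gumbel_winners/= Pi/=; apply/forallP => j; apply/implyP => Pj.
by have [|//] := h j; rewrite leNgt Pj.
Qed.

Let dec x := gumbel_dec (tok t x) (fun w => P t w x) (fun w => U t w x).

(** The event is assumed null, but a union bound needs it measurable. It is decided by the pair
    formed by the set of winners and the token, which takes finitely many values. *)
Let measurable_mismatch : measurable [set x | tok t x <> dec x].
Proof.
pose Q (S : {set W}) := [set x | forall i, (i \in S) = winners x i].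
have mQ S : measurable (Q S).
  apply: measurable_fin_forall => i; case: (i \in S).
    rewrite (_ : (fun x => _) = [set x | winners x i]); first exact: measurable_winner.
    by apply/seteqP; split => x /=; case: (winners x i).
  rewrite (_ : (fun x => _) = ~` [set x | winners x i]); first exact/measurableC/measurable_winner.
  by apply/seteqP; split => x /=; case: (winners x i) => // /negP.
rewrite (_ : mkset _ = \big[setU/set0]_(p : {set W} * W | [pick i in p.1] != Some p.2)
    (Q p.1 `&` tok t @^-1` [set p.2])).
  by apply: bigsetU_measurable => p _; exact: measurableI.
have pickE x (S : {set W}) : Q S x -> [pick i in S] = Some (dec x).
  move=> QS; rewrite -(gumbel_dec_pick (tok t x) (fun w => U t w x) (exists_P_gt0 x)).
  by apply: eq_pick => i; rewrite QS.
apply/seteqP; split => x.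
  move=> /= td; apply/bigsetU_seqE; exists (finset (winners x), tok t x) => /=.
  have QS : Q (finset (winners x)) x by move=> i; rewrite inE.
  rewrite mem_index_enum; split => //; rewrite (pickE x)//.
  by apply/eqP => -[] /esym.
move=> /bigsetU_seqE[[S a] [_ /= h [QS /= ta]]]; move: h; rewrite (pickE x)// ta.
by move=> /eqP h dx; apply: h; rewrite dx.
Qed.

Let pr_mismatch : pr Pr (wmk t `&` [set x | tok t x <> dec x]) = 0.
Proof. by rewrite /pr wm_A_b_wmk. Qed.


(** Almost sure by [pr_good]. The comparison of scores requires it, since [ln] is 0 at nonpositive
    arguments. *)
Let good := [set x | forall w, 0 < U t w x <= 1].

Let measurable_good : measurable good.
Proof.
apply: measurable_fin_forall => w.
rewrite (_ : (fun x => _) = ~` [set x | U t w x <= 0] `&` [set x | U t w x <= 1]).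
  by apply: measurableI; [apply: measurableC|]; exact: measurable_U_le.
by apply/seteqP; split => x /=; [move=> /andP[+ ->]|move=> [+ ->]]; rewrite ltNge ?andbT => /negP.
Qed.

Let pr_good : pr Pr (~` good) = 0.
Proof.
pose r0 (w w' : W) : R := if w' == w then 0 else 1.
have h0 w : pr Pr (xi_rect U t (r0 w)) = 0.
  rewrite -[xi_rect _ _ _]setTI pr_xi_rect; last exact: histT.
  by rewrite (bigD1 w)//= /r0 eqxx clamp01_id ?mul0r ?mulr0//; lra.
have mr w : measurable (xi_rect U t (r0 w)) by exact: measurable_xi_rect.
have mU : measurable (\big[setU/set0]_w xi_rect U t (r0 w)) by exact: bigsetU_measurable.
apply/eqP; rewrite eq_le pr_ge0 andbT.
apply: (@le_trans _ _ (pr Pr (~` unit_rect `|` \big[setU/set0]_w xi_rect U t (r0 w)))).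
  apply: pr_le; [exact: measurableC|by apply: measurableU => //; exact: measurableC|].
  move=> x ng; have [ux|] := pselect (unit_rect x); last by left.
  right; apply/bigsetU_seqE; apply: contrapT => h; apply: ng => w.
  rewrite (ux w) andbT ltNge; apply/negP => Uw; apply: h; exists w.
  rewrite mem_index_enum; split => // w'; rewrite /r0; case: eqP => [->//|_]; exact: ux.
apply: le_trans (prUle _ (measurableC mu) mU) _; rewrite pr_unit add0r.
by apply: le_trans (pr_bigsetU_le _ _ _ mr) _; rewrite big1.
Qed.

Lemma pr_wmk_le A r X : measurable A -> measurable X ->
  (forall x, A x -> (forall w, 0 < U t w x <= 1) ->
    U t (gumbel_dec (tok t x) (fun w => P t w x) (fun w => U t w x)) x <= r -> X x) ->
  pr Pr (A `&` [set x | Y t x <= r] `&` wmk t) <= pr Pr (A `&` X `&` wmk t).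
Proof.
move=> mA mX h.
have mAX : measurable (A `&` X `&` wmk t) by do 2 apply: measurableI => //.
have mm : measurable (wmk t `&` [set x | tok t x <> dec x]) by exact: measurableI.
have mg := measurableC measurable_good.
have -> : pr Pr (A `&` X `&` wmk t) = pr Pr (A `&` X `&` wmk t) +
    (pr Pr (wmk t `&` [set x | tok t x <> dec x]) + pr Pr (~` good)).
  by rewrite pr_mismatch pr_good !addr0.
apply: le_trans (lerD (lexx _) (prUle _ mm mg)).
apply: le_trans (prUle _ mAX (measurableU _ _ mm mg)); apply: pr_le.
- by do 2 apply: measurableI => //; exact: measurable_Y_le.
- by apply: measurableU => //; exact: measurableU.
- move=> x [[Ax Yx] wx]; have [gx|] := pselect (good x); last by right; right.
  have [td|] := pselect (tok t x = dec x); last by right; left.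
  left; split => //; split => //; apply: h => //.
  by rewrite -[gumbel_dec _ _ _]/(dec x) -td.
Qed.

(** For fixed [P] the scores [- ln U_w / P_w] are independent exponential clocks of rate [P_w]; the
    event says that clock [w] rings no earlier than [m w]. *)
Definition P_rect (m : W -> R) :=
  [set x | forall w, U t w x <= expR (- (m w * P t w x))].

Lemma measurable_P_rect m : measurable (P_rect m).
Proof.
apply: measurable_fin_forall => w.
have mf : measurable_fun setT (fun x => expR (- (m w * P t w x))).
  apply: (measurableT_comp (@measurable_expR R)); apply: measurableT_comp => //.
  apply: measurable_funM => //; exact: wm_P_meas.
have := measurable_fun_ler (@wm_U_meas _ _ _ _ _ M t w) mf.
by move=> /(_ measurableT [set true] I); rewrite setTI.
Qed.

Hypothesis t2 : (2 <= t)%N.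

Lemma P_le1 w x : P t w x <= 1.
Proof.
rewrite -(sum_P x) (bigD1 w)//= lerDl; apply: sumr_ge0 => *; exact: wm_P_ge0.
Qed.

(* [P_t] is known given the past but random, so it is cut into small cubes on
   which it is almost constant. *)
Lemma pr_P_rect A m S : hist t A -> (forall w, 0 <= m w) ->
  (forall x, A x -> \sum_w m w * P t w x = S) ->
  pr Pr (A `&` P_rect m `&` wmk t) = eps * (pr Pr A * expR (- S)).
Proof.
move=> hA m0 mS; have mA := hist_measurable hA.
have /andP[e0 e1] := eps01; have mP := measurable_P_rect m.
have [mb mbE mb0] : exists2 mb, mb = \sum_w m w & 0 <= mb.
  by exists (\sum_w m w) => //; exact: sumr_ge0.
set X := pr Pr (A `&` _ `&` _).
have bounds k : eps * (pr Pr A * expR (- S - mb / k.+1%:R)) <= X /\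
    X <= eps * (pr Pr A * expR (mb / k.+1%:R - S)).
  pose N : R := k.+1%:R; have N0 : 0 < N by rewrite ltr0n.
  (* Each coordinate has [k + 2] cells rather than [k + 1], because [P_w = 1] falls into a cell of
     its own. *)
  pose B (c : {ffun W -> 'I_k.+2}) := [set x | forall w,
    ([set x | (c w)%:R / N <= P t w x] `&` ~` [set x | (c w).+1%:R / N <= P t w x]) x].
  have hB c : hist t (B c).
    by apply: hist_forall => w; apply: histI; [|apply: histC]; exact: hist_P_ge.
  have hAB c : hist t (A `&` B c) by exact: histI.
  have Bex x : exists c, B c x.
    have hw w : exists i : 'I_k.+2,
        i%:R / N <= P t w x /\ ~ (i.+1%:R / N <= P t w x).
      have NP0 : 0 <= P t w x * N by rewrite mulr_ge0 ?wm_P_ge0// ltW.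
      have tr1 : (Num.trunc (P t w x * N))%:R <= P t w x * N by rewrite truncn_le.
      have ik : (Num.trunc (P t w x * N) < k.+2)%N.
        rewrite ltnS -(ler_nat R); apply: le_trans tr1 _.
        by rewrite -/N ler_piMl ?P_le1// ltW.
      exists (Ordinal ik) => /=; rewrite !ler_pdivrMr//; split => //.
      by apply/negP; rewrite -ltNge truncnS_gt.
    have [c hc] := fin_all_exists hw; exists [ffun w => c w] => w /=.
    by rewrite ffunE; exact: hc.
  have Bdisj c c' x : B c x -> B c' x -> c = c'.
    move=> h h'; apply/ffunP => w; apply/val_inj.
    have [/= a1 /negP] := h w; have [/= b1 /negP] := h' w; rewrite -!ltNge => b2 a2.
    have := le_lt_trans a1 b2; have := le_lt_trans b1 a2.
    rewrite !ltr_pM2r ?invr_gt0// !ltr_nat !ltnS => u1 u2.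
    by apply/eqP; rewrite eqn_leq u1 u2.
  have XE : X = \sum_c pr Pr (A `&` B c `&` P_rect m `&` wmk t).
    apply: pr_fin_partition.
    - by do 2 apply: measurableI => //.
    - by move=> c; do 2 apply: measurableI => //; exact: hist_measurable (hAB c).
    - by move=> x [[Ax Px] wx]; have [c Bc] := Bex x; exists c.
    - by move=> c x [[[Ax _] Px] wx].
    - by move=> c c' x [[[_ Bc] _] _] [[[_ Bc'] _] _]; exact: Bdisj Bc Bc'.
  have AE : pr Pr A = \sum_c pr Pr (A `&` B c).
    apply: pr_fin_partition => //.
    - by move=> c; exact: hist_measurable (hAB c).
    - by move=> x Ax; have [c Bc] := Bex x; exists c.
    - by move=> c c' x [_ Bc] [_ Bc']; exact: Bdisj Bc Bc'.
  have prE0 (E : set (wm_Omega M)) : ~ (exists x, E x) -> pr Pr E = 0.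
    move=> nE; rewrite (_ : E = set0) ?pr_set0//.
    by apply/seteqP; split => x // Ex; apply: nE; exists x.
  have clE (r : W -> R) : (forall w, 0 <= r w) ->
      \prod_w clamp01 (expR (- (m w * r w))) = expR (- \sum_w m w * r w).
    move=> r0; rewrite -sumrN expR_sum; apply: eq_bigr => w _.
    by rewrite clamp01_id// expR_ge0 expR_le1 oppr_le0 mulr_ge0.
  have Pc0 (i : nat) : 0 <= i%:R / N :> R by rewrite divr_ge0// ltW.
  have sumS c : \sum_w m w * ((c w : 'I_k.+2).+1%:R / N) = \sum_w m w * ((c w)%:R / N) + mb / N.
    rewrite mbE mulr_suml -big_split/=; apply: eq_bigr => w _.
    by rewrite -natr1 mulrDl mulrDr mul1r.
  (* On a nonempty cell any point [x] of [A] fixes [S]; replacing [P] by a corner of the cube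
     changes the exponent by at most [mb / N]. *)
  rewrite AE XE !mulr_suml !mulr_sumr; split; apply: ler_sum => c _.
  - have [|/prE0 z] := pselect (exists x, (A `&` B c) x); last first.
      by rewrite z mul0r mulr0 pr_ge0.
    move=> [x [Ax Bx]].
    apply: (@le_trans _ _ (pr Pr (A `&` B c `&`
        xi_rect U t (fun w => expR (- (m w * ((c w).+1%:R / N)))) `&` wmk t))).
      rewrite pr_xi_rect_wmk// clE; last by move=> w; exact: Pc0.
      rewrite ler_wpM2l// ler_wpM2l ?pr_ge0// ler_expR -opprD lerN2 sumS lerD2r.
      rewrite -(mS x Ax); apply: ler_sum => w _; rewrite ler_wpM2l//.
      by have [] := Bx w.
    apply: pr_le.
    + by do 2 apply: measurableI => //; [exact: hist_measurable (hAB c)|exact: measurable_xi_rect].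
    + by do 2 apply: measurableI => //; exact: hist_measurable (hAB c).
    + move=> z [[[Az Bz] rz] wz]; do 2 split => //.
      move=> w; apply: le_trans (rz w) _; rewrite ler_expR lerN2 ler_wpM2l//.
      by have [_ /= /negP] := Bz w; rewrite -ltNge => /ltW.
  - have [|z] := pselect (exists x, (A `&` B c) x); last first.
      have z0 := prE0 _ z; rewrite z0 mul0r mulr0 prE0// => -[x [[ABx _] _]].
      by apply: z; exists x.
    move=> [x [Ax Bx]].
    apply: (@le_trans _ _ (pr Pr (A `&` B c `&`
        xi_rect U t (fun w => expR (- (m w * ((c w)%:R / N)))) `&` wmk t))).
      apply: pr_le.
      + by do 2 apply: measurableI => //; exact: hist_measurable (hAB c).
      + by do 2 apply: measurableI => //; [exact: hist_measurable (hAB c)|exact: measurable_xi_rect].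
      + move=> z [[[Az Bz] rz] wz]; do 2 split => //.
        move=> w; apply: le_trans (rz w) _; rewrite ler_expR lerN2 ler_wpM2l//.
        by have [] := Bz w.
    rewrite pr_xi_rect_wmk// clE; last by move=> w; exact: Pc0.
    rewrite ler_wpM2l// ler_wpM2l ?pr_ge0// ler_expR -[leRHS]opprB lerN2 lerBlDr -sumS -(mS x Ax).
    apply: ler_sum => w _; rewrite ler_wpM2l//.
    by have [_ /= /negP] := Bx w; rewrite -ltNge => /ltW.
apply/eqP; rewrite eq_le; apply/andP; split; apply/ler_addgt0Pr => e' e'0.
- have q0 : 0 <= eps * (pr Pr A * expR (- S)) by rewrite mulr_ge0// mulr_ge0 ?pr_ge0 ?expR_ge0.
  have [k hk] := expR_div_small mb0 q0 e'0; apply: le_trans hk.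
  by have [_] := bounds k; rewrite expRD => /le_trans; apply; rewrite le_eqVlt; apply/orP; left; apply/eqP; ring.
- have [k hk] := expR_div_small mb0 (pr_ge0 _ _ : 0 <= X) e'0; apply: le_trans hk.
  have [+ _] := bounds k => /(ler_wpM2l (expR_ge0 (mb / k.+1%:R))).
  apply: le_trans; rewrite expRD le_eqVlt; apply/orP; left; apply/eqP.
  set r := mb / _; transitivity (eps * (pr Pr A * expR (- S)) * (expR r * expR (- r))).
    by rewrite expRxMexpNx_1 mulr1.
  by ring.
Qed.

End Round.
End WatermarkModel.

(** * Numerical gain of a watermarked round *)

Section SignalArithmetic.
Variable R : realType.
Implicit Types D : R.

(* With [r = 1 - D / 2] the level watched by the test and [l = - ln r], a token
   of probability [p] won at rate [m] has [U <= r] iff [m >= l / p]; [l / (1 - D)]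
   and [l / D] are the extreme rates, for the top token and for the others. *)
Definition sig_l D : R := - ln (1 - D / 2).
Definition sig_m1 D : R := sig_l D / (1 - D).
Definition sig_m2 D : R := sig_l D / D.

Lemma sig_l_ge D : 0 < D < 1 -> D / 2 <= sig_l D.
Proof.
move=> D01; rewrite /sig_l lerNr; have := @le_ln1Dx R (- (D / 2)).
by apply; lra.
Qed.

Lemma expR_sig_l D : 0 < D < 1 -> expR (- sig_l D) = 1 - D / 2.
Proof. by move=> D01; rewrite /sig_l opprK lnK// posrE; lra. Qed.

Lemma sig_l_le D : 0 < D < 1 / 3 -> sig_l D <= 3 / 5 * D.
Proof.
move=> D03; have r0 : 0 < 1 - D / 2 by lra.
rewrite /sig_l; set r := 1 - D / 2 in r0 *.
rewrite -lnV ?posrE//.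
have h : r^-1 = 1 + (r^-1 - 1) by ring.
have ri : 0 < r^-1 by rewrite invr_gt0.
rewrite h; apply: le_trans (le_ln1Dx _) _; first by lra.
rewrite lerBlDr -(ler_pM2r r0) mulVf ?gt_eqF// /r; nra.
Qed.

Lemma sig_m1_ge0 D : 0 < D < 1 -> 0 <= sig_m1 D.
Proof. by move=> D01; have := sig_l_ge D01; rewrite /sig_m1 => h; rewrite divr_ge0//; lra. Qed.

Lemma sig_m2_ge0 D : 0 < D < 1 -> 0 <= sig_m2 D.
Proof. by move=> D01; have := sig_l_ge D01; rewrite /sig_m2 => h; rewrite divr_ge0//; lra. Qed.

(** The bound [m1] exceeds [l] by at least [D ^+ 2 / 2]. This gain is quadratic and compares with
    [D / 18] only because [D] is bounded below. *)
Lemma expR_sig_m1_large D : 1 / 3 <= D -> D < 1 ->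
  expR (- sig_m1 D) <= 1 - D / 2 - D / 18.
Proof.
move=> D3 D1; have D10 : 0 < 1 - D by lra.
have D01 : 0 < D < 1 by lra.
have l0 := sig_l_ge D01.
have h1 : sig_l D + D ^+ 2 / 2 <= sig_m1 D.
  rewrite /sig_m1 ler_pdivlMr//; nra.
apply: (@le_trans _ _ (expR (- (sig_l D + D ^+ 2 / 2)))); first by rewrite ler_expR lerN2.
rewrite opprD expRD expR_sig_l// expRN.
have h2 : 1 + D ^+ 2 / 2 <= expR (D ^+ 2 / 2) by exact: expR_ge1Dx.
have s0 : 0 < 1 + D ^+ 2 / 2 by have := sqr_ge0 D; lra.
apply: (@le_trans _ _ ((1 - D / 2) / (1 + D ^+ 2 / 2))).
  rewrite ler_pM2l; last by lra.
  by rewrite lef_pV2 ?posrE ?expR_gt0.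
rewrite ler_pdivrMr//.
have : D * (10 * D ^+ 2 - 18 * D + 2) <= 0.
  by rewrite pmulr_rle0; nra.
rewrite !expr2; nra.
Qed.

(** The first exponential already is at most [1 - D / 2]; the gain is the difference of the other
    two. It is at least [expR (- m2) * (m2 - m1) * D >= 2 / 5 * (1 / 4) * D = D / 10]. *)
Lemma expR_sig_m1_small D : 0 < D < 1 / 3 ->
  expR (- sig_m1 D) - expR (- (sig_m2 D * (1 - D) + sig_m1 D * D)) + expR (- sig_m2 D)
    <= 1 - D / 2 - D / 18.
Proof.
move=> D03; have /andP[D0 D3] := D03; have D1 : 0 < 1 - D by lra.
have D01 : 0 < D < 1 by lra.
have l0 := sig_l_ge D01; have l1 := sig_l_le D03.
have h1 : expR (- sig_m1 D) <= 1 - D / 2.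
  rewrite -expR_sig_l// ler_expR lerN2 /sig_m1 ler_pdivlMr//; nra.
have h2 : sig_m2 D <= 3 / 5 by rewrite /sig_m2 ler_pdivrMr.
have h3 : 1 / 4 <= sig_m2 D - sig_m1 D.
  have -> : sig_m2 D - sig_m1 D = sig_l D * ((1 - 2 * D) / (D * (1 - D))).
    by rewrite /sig_m2 /sig_m1; field; rewrite !gt_eqF.
  rewrite mulrA ler_pdivlMr ?mulr_gt0//.
  have : D / 2 * (1 - 2 * D) <= sig_l D * (1 - 2 * D) by rewrite ler_pM2r; lra.
  nra.
have h4 : 2 / 5 <= expR (- sig_m2 D) by have := expR_ge1Dx (- sig_m2 D); lra.
have h5 : expR (- sig_m2 D) * (1 + (sig_m2 D - sig_m1 D) * D) <=
    expR (- (sig_m2 D * (1 - D) + sig_m1 D * D)).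
  have -> : - (sig_m2 D * (1 - D) + sig_m1 D * D) = - sig_m2 D + (sig_m2 D - sig_m1 D) * D by ring.
  by rewrite expRD ler_pM2l ?expR_gt0// expR_ge1Dx.
have h6 : D / 10 <= expR (- sig_m2 D) * ((sig_m2 D - sig_m1 D) * D).
  have h7 : 1 / 4 * D <= (sig_m2 D - sig_m1 D) * D by rewrite ler_pM2r.
  have -> : D / 10 = 2 / 5 * (1 / 4 * D) by field.
  by apply: ler_pM => //; lra.
lra.
Qed.

End SignalArithmetic.

(** * Signal of a watermarked round; Chernoff bound over the rounds *)

Section WatermarkSignal.
Variables (R : realType) (W : finType) (n : nat) (eps Delta : R).
Variable M : wm_model W n eps Delta.
Notation Pr := (wm_Pr M).
Notation U := (wm_U M).
Notation P := (wm_P M).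
Notation tok := (wm_tok M).
Notation wmk := (wm_wmk M).
Notation Y := (wm_Y M).
Hypothesis Delta_gt0 : 0 < Delta.
Hypothesis Delta_lt1 : Delta < 1.

Let r : R := 1 - Delta / 2.
Notation l := (sig_l Delta).
Notation m1 := (sig_m1 Delta).
Notation m2 := (sig_m2 Delta).

Let D01 : 0 < Delta < 1. Proof. by rewrite Delta_gt0. Qed.

Let r01 : 0 < r < 1.
Proof. by have := D01; rewrite /r => h; lra. Qed.

Let r0 : 0 < r. Proof. by have /andP[] := r01. Qed.

Let l_gt0 : 0 < l.
Proof. by apply: lt_le_trans (sig_l_ge D01); rewrite divr_gt0. Qed.

Let D1 : 0 < 1 - Delta. Proof. by rewrite subr_gt0. Qed.

Section Round.
Variable t : nat.
Hypotheses (tn : (1 <= t <= n)%N) (t2 : (2 <= t)%N).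

Let dec x := gumbel_dec (tok t x) (fun w => P t w x) (fun w => U t w x).

(** The winner has the earliest clock, [- ln U_dec / P_dec], which is at least [l / (1 - Delta)]
    because no probability exceeds [1 - Delta]. *)
Let dec_le x : (forall w, 0 < U t w x <= 1) -> U t (dec x) x <= r ->
  forall w, U t w x <= expR (- (m1 * P t w x)).
Proof.
move=> gx Ud w; have /andP[Uw0 Uw1] := gx w.
have [Pw|Pw] := ltP 0 (P t w x); last first.
  have -> : P t w x = 0 by apply/eqP; rewrite eq_le Pw wm_P_ge0.
  by rewrite mulr0 oppr0 expR0.
have [d0 dmax] := gumbel_decP (tok t x) (fun w => U t w x) (exists_P_gt0 t x).
rewrite -/(dec x) in d0 dmax.
have /andP[Ud0 _] := gx (dec x).
have lnd : ln (U t (dec x) x) <= - l by rewrite /sig_l opprK ler_ln ?posrE.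
have dD := P_le_max tn (dec x) x.
rewrite -[leLHS](@lnK R) ?posrE// ler_expR -mulNr -ler_pdivrMr//.
apply: le_trans (dmax w Pw) _; rewrite ler_pdivrMr//.
apply: le_trans lnd _; rewrite mulNr lerN2 /sig_m1 mulrAC ler_pdivrMr//.
by rewrite ler_pM2l.
Qed.

Let mm (a w : W) : R := if w == a then m2 else m1.

(** If some clock rang before [m2], so would the winner's. The winner would then not be the top
    token [a], would have [P_dec <= Delta], and so [- ln U_dec < Delta * m2 = l], contradicting
    [U_dec <= r]. *)
Let dec_not_crossed x a : (forall w, 0 < U t w x <= 1) -> P t a x = 1 - Delta ->
  U t (dec x) x <= r -> Delta < 1 / 3 ->
  @P_rect _ _ _ _ _ M t (mm a) x -> @P_rect _ _ _ _ _ M t (fun=> m2) x.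
Proof.
move=> gx Pa Ud D3 hY w; have /andP[Uw0 Uw1] := gx w.
rewrite leNgt; apply/negP => Uw.
have [d0 dmax] := gumbel_decP (tok t x) (fun w => U t w x) (exists_P_gt0 t x).
rewrite -/(dec x) in d0 dmax.
have Pw : 0 < P t w x.
  rewrite ltNge; apply/negP => Pw.
  have P0 : P t w x = 0 by apply/eqP; rewrite eq_le Pw wm_P_ge0.
  by move: Uw; rewrite P0 mulr0 oppr0 expR0 ltNge Uw1.
have sw : - m2 < ln (U t w x) / P t w x.
  by rewrite ltr_pdivlMr// mulNr -(@ltr_expR R) lnK ?posrE.
have sd := lt_le_trans sw (dmax w Pw).
have /andP[Ud0 _] := gx (dec x).
have da : dec x != a.
  apply/eqP => da; move: sd; rewrite da.
  have /andP[Ua0 _] := gx a; have := hY a; rewrite /mm eqxx => Ua.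
  rewrite ltNge => /negP; apply; rewrite ler_pdivrMr ?Pa//.
  by rewrite -Pa mulNr -(@ler_expR R) lnK ?posrE.
have PdD : P t (dec x) x <= Delta.
  have := sum_P t x; rewrite (bigD1 a)//= (bigD1 (dec x))//= Pa => h.
  have : 0 <= \sum_(i | (i != a) && (i != dec x)) P t i x.
    by apply: sumr_ge0 => *; exact: wm_P_ge0.
  lra.
move: sd; rewrite ltNge => /negP; apply.
rewrite ler_pdivrMr//; apply: (@le_trans _ _ (- l)).
  by rewrite /sig_l opprK ler_ln ?posrE.
by rewrite mulNr lerN2 /sig_m2 mulrAC ler_pdivrMr// ler_pM2l.
Qed.

Let m1_ge0 : 0 <= m1. Proof. exact: sig_m1_ge0. Qed.
Let m2_ge0 : 0 <= m2. Proof. exact: sig_m2_ge0. Qed.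

Let sum_const (m : R) x : \sum_w m * P t w x = m.
Proof. by rewrite -mulr_sumr sum_P mulr1. Qed.

Lemma pr_wmk_step (A : set (wm_Omega M)) : hist t A ->
  pr Pr (A `&` [set x | Y t x <= r] `&` wmk t) <= eps * (pr Pr A * (r - Delta / 18)).
Proof.
move=> hA; have mA := hist_measurable hA.
have /andP[e0 e1] := eps01 M tn.
have [D3|D3] := leP (1 / 3) Delta.
  apply: le_trans (pr_wmk_le tn mA (@measurable_P_rect _ _ _ _ _ M t (fun=> m1)) _) _.
    by move=> x _ gx Ud; exact: dec_le.
  rewrite (@pr_P_rect _ _ _ _ _ M _ tn t2 _ _ m1)//.
  by rewrite ler_wpM2l// ler_wpM2l ?pr_ge0//; apply: expR_sig_m1_large => //; done.
have D03 : 0 < Delta < 1 / 3 by rewrite Delta_gt0.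
(* The rates [mm a] depend on the top token, so [A] is split by it; it is unique because
   [1 - Delta > 1 / 2]. *)
pose B a := A `&` [set x | 1 - Delta <= P t a x].
have hB a : hist t (B a) by apply: histI => //; exact: hist_P_ge.
have mB a : measurable (B a) by exact: hist_measurable (hB a).
have BP a x : B a x -> P t a x = 1 - Delta.
  by move=> [_ /= h]; apply/eqP; rewrite eq_le h (P_le_max tn).
have AE : pr Pr A = \sum_a pr Pr (B a).
  apply: pr_fin_partition => //.
  - move=> x Ax; have [a Pa] := exists_P_max tn x Delta_lt1; exists a.
    by split => //=; rewrite Pa.
  - by move=> a x [].
  - move=> a b x Ba Bb; apply/eqP/negPn/negP => ab.
    have := sum_P t x; rewrite (bigD1 a)//= (bigD1 b)/=; last by rewrite eq_sym.
    rewrite (BP _ _ Ba) (BP _ _ Bb) => h.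
    have : 0 <= \sum_(i | (i != a) && (i != b)) P t i x.
      by apply: sumr_ge0 => *; exact: wm_P_ge0.
    lra.
have mY := measurable_Y_le M t r; have mw := wm_wmk_meas M t.
rewrite AE mulr_suml mulr_sumr.
apply: (@le_trans _ _ (\sum_a pr Pr (B a `&` [set x | Y t x <= r] `&` wmk t))).
  apply: pr_fin_sub.
  - by do 2 apply: measurableI => //.
  - by move=> a; do 2 apply: measurableI => //.
  - move=> x [[Ax Yx] wx]; have [a Pa] := exists_P_max tn x Delta_lt1; exists a => //.
    by do 3 split => //=; rewrite Pa.
apply: ler_sum => a _.
pose X1 := @P_rect _ _ _ _ _ M t (fun=> m1); pose X2 := @P_rect _ _ _ _ _ M t (mm a).
pose X3 := @P_rect _ _ _ _ _ M t (fun=> m2).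
have mX1 : measurable X1 by exact: measurable_P_rect.
have mX2 : measurable X2 by exact: measurable_P_rect.
have mX3 : measurable X3 by exact: measurable_P_rect.
(* A low [U_dec] forces [X1], and forces [X3] on [X2]. As [X2] lies in [X1], the probability is at
   most that of [X1] minus [X2] plus [X3], the expression of [expR_sig_m1_small]. *)
apply: le_trans (pr_wmk_le tn (mB a) (measurableD mX1 (measurableD mX2 mX3)) _) _.
  move=> x Bx gx Ud; split; first by move=> w; exact: dec_le.
  move=> [h2]; apply; exact: (dec_not_crossed gx (BP _ _ Bx)).
have m12 : m1 <= m2.
  rewrite /sig_m1 /sig_m2 ler_pM2l// lef_pV2 ?posrE//.
  by move: D03 => /andP[? ?]; lra.
have s21 : X2 `<=` X1.
  move=> x hx w; apply: le_trans (hx w) _; rewrite ler_expR lerN2 /mm.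
  by apply: ler_wpM2r; [exact: wm_P_ge0|case: ifP].
pose C (X : set (wm_Omega M)) := B a `&` X `&` wmk t.
have mC X : measurable X -> measurable (C X) by move=> mX; do 2 apply: measurableI => //.
have p1 : pr Pr (C X1) = eps * (pr Pr (B a) * expR (- m1)).
  by rewrite (@pr_P_rect _ _ _ _ _ M _ tn t2 _ _ m1).
have p3 : pr Pr (C X3) = eps * (pr Pr (B a) * expR (- m2)).
  by rewrite (@pr_P_rect _ _ _ _ _ M _ tn t2 _ _ m2).
have p2 : pr Pr (C X2) = eps * (pr Pr (B a) * expR (- (m2 * (1 - Delta) + m1 * Delta))).
  apply: pr_P_rect => //; first by move=> w; rewrite /mm; case: ifP.
  move=> x Bx; rewrite (bigD1 a)//= {1}/mm eqxx (BP _ _ Bx); congr (_ + _).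
  rewrite (eq_bigr (fun w => m1 * P t w x)); last by move=> w /negPf wa; rewrite /mm wa.
  rewrite -mulr_sumr; congr (_ * _).
  by have := sum_P t x; rewrite (bigD1 a)//= (BP _ _ Bx); lra.
have hD := @prDI _ _ _ Pr _ _ (mC _ mX1) (mC _ mX2).
have I12 : C X1 `&` C X2 = C X2.
  by apply/seteqP; split => x; [case|move=> h; split => //; case: h => [[? /s21 ?] ?]].
rewrite I12 p1 p2 in hD.
apply: (@le_trans _ _ (pr Pr (C X1 `\` C X2) + pr Pr (C X3))).
  apply: le_trans (prUle _ _ _); [|by apply: measurableD; exact: mC|exact: mC].
  apply: pr_le.
  - by apply: mC; do 2 apply: measurableD => //.
  - by apply: measurableU; [apply: measurableD; exact: mC|exact: mC].
  - move=> x [[Bx [h1 h23]] wx]; have [h2|h2] := pselect (X2 x).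
      by right; do 2 split => //; apply: contrapT => h3; exact: h23.
    by left; split => // -[[]].
have := ler_wpM2l e0 (ler_wpM2l (pr_ge0 Pr (B a)) (expR_sig_m1_small D03)).
by rewrite p3 /r; lra.
Qed.

Lemma pr_step (A : set (wm_Omega M)) : hist t A ->
  pr Pr (A `&` [set x | Y t x <= r]) <= pr Pr A * (1 - (Delta / 2 + eps * Delta / 18)).
Proof.
move=> hA; have mA := hist_measurable hA.
have mAY : measurable (A `&` [set x | Y t x <= r]).
  by apply: measurableI => //; exact: measurable_Y_le.
rewrite (@prDI _ _ _ Pr _ _ mAY (wm_wmk_meas M t)) setDE.
have h1 := pr_wmk_step hA.
have h2 := @pr_free_le _ _ _ _ _ M _ tn _ r hA.
apply: le_trans (lerD (h2 _) h1) _; first by have /andP[/ltW -> /ltW ->] := r01.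
rewrite /r; lra.
Qed.

End Round.

Let low_count (t k : nat) (m : R) := [set x | (\sum_(j < k) (r < Y (t + j) x)%R)%N%:R <= m].

Let low_countS t k m : low_count t k.+1 m =
  ([set x | Y t x <= r] `&` low_count t.+1 k m) `|`
  (~` [set x | Y t x <= r] `&` low_count t.+1 k (m - 1)).
Proof.
have E x : (\sum_(j < k.+1) (r < Y (t + j) x)%R)%N =
    ((r < Y t x)%R + \sum_(j < k) (r < Y (t.+1 + j) x)%R)%N.
  rewrite big_ord_recl/= addn0; congr (_ + _)%N.
  by apply: eq_bigr => j _; rewrite /bump/= addnA addn1.
apply/seteqP; split => x /=; rewrite /low_count/= E natrD.
  case: (boolP (r < Y t x)) => h hm.
    by right; split; [apply/negP; rewrite -ltNge|rewrite lerBrDl].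
  by left; rewrite add0r in hm; split => //; rewrite leNgt.
case: (boolP (r < Y t x)) => h [[h1 h2]|[h1 h2]].
- by rewrite ltNge h1 in h.
- by rewrite lerBrDl in h2.
- by rewrite add0r.
- by move/negP : h1; rewrite -ltNge (negPf h).
Qed.

Let measurable_low_count t k m : measurable (low_count t k m).
Proof.
elim: k t m => [|k ih] t m.
  have [m0|m0] := leP 0 m.
    rewrite (_ : low_count _ _ _ = setT)//.
    by apply/seteqP; split => x //= _; rewrite /low_count/= big_ord0.
  rewrite (_ : low_count _ _ _ = set0)//.
  by apply/seteqP; split => x //=; rewrite /low_count/= big_ord0 leNgt m0.
rewrite low_countS; apply: measurableU; apply: measurableI => //.
  exact: measurable_Y_le.
exact/measurableC/measurable_Y_le.
Qed.

(** Induction on the number [k] of remaining rounds [t, ..., n]. Keeping the past event [A] general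
    replaces conditional expectations: round [t] splits [A] into two events known at time [t + 1],
    and an exceedance lowers the allowance [m] by 1. *)
Let chernoff_step (lam m : R) t k (A : set (wm_Omega M)) : 0 <= lam -> (2 <= t)%N -> (t + k = n.+1)%N ->
  hist t A ->
  pr Pr (A `&` low_count t k m) <=
  pr Pr A * (expR (lam * m) *
    (1 - (1 - expR (- lam)) * (Delta / 2 + eps * Delta / 18)) ^+ k).
Proof.
move=> lam0; set pi := _ / 2 + _.
elim: k t m A => [|k ih] t m A t2 tk hA; have mA := hist_measurable hA.
  rewrite expr0 mulr1; have [m0|m0] := leP 0 m.
    apply: (@le_trans _ _ (pr Pr A)).
      by apply: pr_le => //; apply: measurableI.
    by apply: ler_peMr; rewrite ?pr_ge0// -[leLHS]expR0 ler_expR mulr_ge0.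
  rewrite (_ : A `&` _ = set0); first by rewrite pr_set0 mulr_ge0 ?pr_ge0 ?expR_ge0.
  by apply/seteqP; split => x // -[_]; rewrite /low_count/= big_ord0 leNgt m0.
have tn : (1 <= t <= n)%N.
  by rewrite (ltnW t2)/= -ltnS -tk addnS ltnS leq_addr.
set q := 1 - _ in ih *.
pose AL := A `&` [set x | Y t x <= r]; pose AH := A `&` ~` [set x | Y t x <= r].
have hY : hist t.+1 [set x | Y t x <= r].
  by apply: hist_Y_le; rewrite (ltnW t2) ltnSn.
have hA' : hist t.+1 A by apply: hist_le hA.
have hAL : hist t.+1 AL by exact: histI.
have hAH : hist t.+1 AH by apply: histI => //; exact: histC.
have t2' : (2 <= t.+1)%N by exact: ltnW.
have tk' : (t.+1 + k = n.+1)%N by rewrite addSnnS.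
have i1 := ih t.+1 m AL t2' tk' hAL.
have i2 := ih t.+1 (m - 1) AH t2' tk' hAH.
have mY := measurable_Y_le M t r.
have sAL := pr_step tn t2 hA; rewrite -/AL -/pi in sAL.
have sA : pr Pr A = pr Pr AH + pr Pr AL by rewrite (@prDI _ _ _ Pr _ _ mA mY) setDE.
have q0 : 0 <= q.
  have /andP[e0 e1] := eps01 M tn.
  have D0 := Delta_gt0; have Dlt := Delta_lt1.
  have eD0 : 0 <= eps * Delta by rewrite mulr_ge0// ltW.
  have eD1 : eps * Delta <= Delta by rewrite ler_piMl// ltW.
  have pi0 : 0 <= pi by rewrite /pi; lra.
  have pi1 : pi <= 1 by rewrite /pi; lra.
  have El0 := expR_ge0 (- lam).
  have El : 0 <= 1 - expR (- lam) by rewrite subr_ge0 expR_le1 oppr_le0.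
  rewrite /q subr_ge0 -[leRHS]mulr1; by apply: ler_pM => //; rewrite gerBl.
apply: (@le_trans _ _ (pr Pr (AL `&` low_count t.+1 k m) + pr Pr (AH `&` low_count t.+1 k (m - 1)))).
  rewrite low_countS setIUr !setIA; apply: prUle.
    by apply: measurableI => //; exact: hist_measurable hAL.
  by apply: measurableI => //; exact: hist_measurable hAH.
apply: le_trans (lerD i1 i2) _.
rewrite mulrBr mulr1 expRB exprS -expRN.
have E0 : 0 <= expR (lam * m) * q ^+ k by rewrite mulr_ge0 ?expR_ge0// exprn_ge0.
have key : pr Pr AL + pr Pr AH * expR (- lam) <= pr Pr A * q.
  have el : 0 <= 1 - expR (- lam) by rewrite subr_ge0 expR_le1 oppr_le0.
  have -> : pr Pr AH = pr Pr A - pr Pr AL by rewrite sA addrK.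
  have := ler_wpM2l el sAL; rewrite /q; lra.
have := ler_wpM2l E0 key; lra.
Qed.

Lemma measurable_exceedances (m : R) :
  measurable [set x | (\sum_(j < n.-1) (r < Y (2 + j) x)%R)%N%:R <= m].
Proof. exact: measurable_low_count. Qed.

Lemma wm_chernoff (lam m : R) : 0 <= lam -> (2 <= n)%N ->
  pr Pr [set x | (\sum_(j < n.-1) (r < Y (2 + j) x)%R)%N%:R <= m] <=
  expR (lam * m) *
    (1 - (1 - expR (- lam)) * (Delta / 2 + eps * Delta / 18)) ^+ n.-1.
Proof.
move=> lam0 n2; have tk : (2 + n.-1 = n.+1)%N by rewrite add2n prednK// ltnW.
have := @chernoff_step lam m 2 n.-1 setT lam0 (leqnn _) tk (@histT _ _ _ _ _ M 2).
by rewrite setTI pr_setT mul1r.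
Qed.

End WatermarkSignal.

(** * The Type II error vanishes *)

Section TypeII.
Variables (R : realType) (W : finType).

Lemma wm_model_inhabited n (eps Delta : R) (M : wm_model W n eps Delta) : exists x : wm_Omega M, True.
Proof.
apply: contrapT => h; have : pr (wm_Pr M) setT = 0.
  rewrite (_ : setT = set0) ?pr_set0//.
  by apply/seteqP; split => x // _; apply: h; exists x.
by rewrite pr_setT => /eqP; rewrite oner_eq0.
Qed.

(** [Y_t] is one of the [U_{t,w}], so a union over tokens bounds the chance of a tiny p-value
    however the token was chosen, round 1 included. *)
Lemma pr_U_gt n (eps Delta : R) (M : wm_model W n eps Delta) t (a : R) :
  (1 <= t <= n)%N -> 0 <= a <= 1 ->
  pr (wm_Pr M) (~` xi_rect (wm_U M) t (fun=> 1 - a)) <= #|W|%:R * a.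
Proof.
move=> tn a01; rewrite pr_setC; last exact: measurable_xi_rect.
rewrite -[xi_rect _ _ _]setTI pr_xi_rect//; last exact: histT.
rewrite pr_setT mul1r clamp01_id; last by lra.
rewrite prodr_const; have := @exprn_ge1Dn R (- a) #|W|.
rewrite mulrN => h; have {}h : 1 - #|W|%:R * a <= (1 - a) ^+ #|W| by apply: h; lra.
have -> : #|(fun=> true) : pred W| = #|W| by apply: eq_card.
lra.
Qed.

(** [m] gives up half of the drift [eps * Delta / 18]. With [lam = eps / 72] and
    [X = n * lam ^+ 2 * Delta], the drift contributes [- 2 * X], the quadratic term at most [X / 2],
    and the missing first round at most [lam <= X], which is where [72 <= n * (eps * Delta)]
    enters. *)
Lemma wm_chernoff_small n (eps Delta : R) (M : wm_model W n eps Delta) (m : R) :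
  0 < Delta -> Delta < 1 -> 0 <= eps <= 1 -> (2 <= n)%N ->
  72 <= n%:R * (eps * Delta) -> m = n%:R * (Delta / 2 + eps * Delta / 36) ->
  pr (wm_Pr M)
    [set x | (\sum_(j < n.-1) (1 - Delta / 2 < wm_Y M (2 + j) x)%R)%N%:R <= m] <=
  expR (- (n%:R * ((eps / 72) ^+ 2 * Delta) / 2)).
Proof.
move=> D0 D1 /andP[e0 e1] n2 neD mE.
have lam0 : 0 <= eps / 72 by rewrite divr_ge0.
have El := expRN_le_quad lam0.
have hc := @wm_chernoff _ _ _ _ _ M D0 D1 (eps / 72) m lam0 n2; apply: le_trans hc _.
have nE : n.-1%:R = n%:R - 1 :> R by rewrite -subn1 natrB// ltnW.
have N2 : 2 <= n%:R :> R by rewrite (ler_nat R 2).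
have eD0 : 0 <= eps * Delta by rewrite mulr_ge0// ltW.
have eD1 : eps * Delta <= Delta by rewrite ler_piMl// ltW.
have El0 : 0 <= 1 - expR (- (eps / 72)) by rewrite subr_ge0 expR_le1 oppr_le0.
have El1 : 1 - expR (- (eps / 72)) <= 1 by rewrite gerBl expR_ge0.
have epsE : eps * Delta = 72 * (eps / 72 * Delta) by field.
move: El El0 El1 nE N2 neD lam0 mE {n2}; rewrite {}epsE in eD0 eD1 *.
move: (eps / 72) eD0 eD1 (n%:R : R) => lam eD0 eD1 N El El0 El1 nE N2 neD lam0 mE.
pose pi := Delta / 2 + 72 * (lam * Delta) / 18; rewrite -/pi.
have pi0 : 0 <= pi by rewrite /pi; lra.
have pi1 : pi <= Delta by rewrite /pi; lra.
apply: (@le_trans _ _ (expR (lam * m) * expR (- (1 - expR (- lam)) * pi) ^+ n.-1)).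
  rewrite ler_pM2l ?expR_gt0//; apply: lerXn2r; rewrite ?nnegrE ?expR_ge0//.
    by rewrite subr_ge0 -[leRHS]mulr1; apply: ler_pM => //; lra.
  by apply: le_trans (expR_ge1Dx _); rewrite mulNr.
rewrite -expRM_natl -expRD ler_expR nE.
have h1 : (lam - lam ^+ 2 / 2) * pi <= (1 - expR (- lam)) * pi by rewrite ler_wpM2r//; lra.
have h2 : (N - 1) * ((lam - lam ^+ 2 / 2) * pi) <= (N - 1) * ((1 - expR (- lam)) * pi).
  by rewrite ler_wpM2l//; lra.
have h3 : lam ^+ 2 * (N * pi) <= lam ^+ 2 * (N * Delta).
  by rewrite ler_wpM2l ?sqr_ge0// ler_wpM2l//; lra.
have h4 : 0 <= lam ^+ 2 * pi by rewrite mulr_ge0 ?sqr_ge0.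
have h5 : lam * 1 <= lam * (N * (lam * Delta)) by rewrite ler_wpM2l//; lra.
have h6 : lam * pi <= lam * 1 by rewrite ler_wpM2l//; lra.
have h7 : lam * m = lam * (N * pi) - 2 * (lam * (N * (lam * Delta))).
  by rewrite mE /pi; field.
have h8 : lam * (N * (lam * Delta)) = N * (lam ^+ 2 * Delta) by ring.
have h9 : lam ^+ 2 * (N * Delta) = N * (lam ^+ 2 * Delta) by ring.
lra.
Qed.

(** [(u - v) ^+ 2 / u] increases with [u] beyond [v], so [u = v + kn] is the worst case; the
    denominator is then at most [Delta]. *)
Let K_s_signal (s N u v p kn Delta : R) : -1 <= s <= 2 -> 0 < N -> 0 < p -> p <= v ->
  0 < kn -> v + kn <= u -> u < 1 -> v + kn <= Delta ->
  N * (kn ^+ 2 / (2 * Delta)) <= N * K_s_plus s u p.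
Proof.
move=> hs N0 p0 pv kn0 vu u1 wD.
have pu : p < u by lra.
rewrite /K_s_plus p0 pu u1/= ler_pM2l//; apply: le_trans (K_s_lb hs p0 pu u1).
have u0 : 0 < u by lra.
have D0 : 0 < Delta by lra.
rewrite ler_pdivrMr ?mulr_gt0// mulrAC ler_pdivlMr ?mulr_gt0//.
have g1 : kn ^+ 2 * u <= (u - v) ^+ 2 * (v + kn).
  have -> : (u - v) ^+ 2 * (v + kn) =
      kn ^+ 2 * u + (u - (v + kn)) * (u * (v + kn) - v ^+ 2) by ring.
  rewrite lerDl mulr_ge0//; first lra.
  by rewrite subr_ge0 expr2; apply: ler_pM; lra.
have g2 : (u - v) ^+ 2 <= (u - p) ^+ 2 by rewrite ler_sqr ?nnegrE; lra.
have g3 : (u - v) ^+ 2 * (v + kn) <= (u - p) ^+ 2 * Delta.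
  by apply: ler_pM; rewrite ?sqr_ge0//; lra.
lra.
Qed.

Let sum_shift_le (f : nat -> nat) n : (0 < n)%N ->
  (\sum_(j < n.-1) f j.+1 <= \sum_(t < n) f t)%N.
Proof. by case: n => // n _; rewrite [leqRHS]big_ord_recl leq_addl. Qed.

Lemma type2_bound n (eps Delta c s delta : R) (M : wm_model W n eps Delta) :
  -1 <= s <= 2 -> 0 < Delta -> (4 <= n)%N -> c <= n%:R^-1 ->
  0 < (1 + delta) * ln (ln n%:R) ->
  2 <= n%:R * Delta ->
  72 <= n%:R * (eps * Delta) ->
  (1 + delta) * ln (ln n%:R) <= n%:R * ((eps * Delta / 36) ^+ 2 / (2 * Delta)) ->
  pr (wm_Pr M) [set x | ~ tr_gof_reject n c s delta (fun t => wm_Y M t x)] <=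
    expR (- (n%:R * ((eps / 72) ^+ 2 * Delta) / 2)) + (#|W|%:R / n%:R + #|W|%:R / n%:R).
Proof.
move=> hs D0 n4 c1 L0 nD neD hL.
have [x0 _] := wm_model_inhabited M.
have n2 : (2 <= n)%N by apply: leq_trans n4.
have n1 : (0 < n)%N by exact: ltnW.
have t1n : (1 <= 1 <= n)%N by [].
have t2n : (1 <= 2 <= n)%N by [].
have D1 : Delta < 1 := Delta_lt1 t1n x0.
have e01 := eps01 M t1n; have /andP[e0 e1] := e01.
have N4 : 4 <= n%:R :> R by rewrite (ler_nat R 4).
have N0 : 0 < n%:R :> R by rewrite ltr0n.
have kn0 : 0 < eps * Delta / 36.
  rewrite divr_gt0// -(pmulr_rgt0 _ N0); apply: lt_le_trans neD; exact: ltr0n.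
have mDE : n%:R * (Delta / 2 + eps * Delta / 36) <= n%:R - 1.
  have eD1 : eps * Delta <= 1 by rewrite -[leRHS]mulr1; apply: ler_pM => //; exact: ltW.
  have h1 : Delta / 2 + eps * Delta / 36 <= 1 / 2 + 1 / 36 by lra.
  have := ler_wpM2l (ltW N0) h1; lra.
have wD : Delta / 2 + eps * Delta / 36 <= Delta.
  have eD1 : eps * Delta <= Delta by rewrite ler_piMl// ltW.
  lra.
have m0 : 0 < n%:R * (Delta / 2 + eps * Delta / 36).
  by rewrite mulr_gt0// addr_gt0// divr_gt0.
have p1 := @wm_chernoff_small n eps Delta M _ D0 D1 e01 n2 neD erefl.
have mE1 := measurable_exceedances M (n%:R * (Delta / 2 + eps * Delta / 36)).
have nDv : n%:R^-1 <= Delta / 2 by rewrite -(ler_pM2l N0) divff ?gt_eqF//; lra.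
move: hL neD => hL _.
pose r := 1 - Delta / 2; pose v := Delta / 2; pose kn := eps * Delta / 36.
pose m := n%:R * (v + kn).
pose E1 := [set x | (\sum_(j < n.-1) (r < wm_Y M (2 + j) x)%R)%N%:R <= m].
have a2_gt0 : 0 < (n%:R * n%:R)^-1 :> R by rewrite invr_gt0 mulr_gt0.
have a1_01 : 0 <= (n%:R^-1 : R) <= 1.
  by rewrite invr_ge0 ltW//= invf_le1// ler1n.
have a2_01 : 0 <= ((n%:R * n%:R)^-1 : R) <= 1.
  by rewrite ltW//= -natrM invf_le1 ?ler1n ?ltr0n muln_gt0 n1.
(* Outside [E2] some p-value, that of round 2, is at least [1 / n]. Outside [E3] all p-values are
   positive, as the guard of [K_s_plus] demands; the width [1 / n ^+ 2] makes the union over [n]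
   rounds affordable. *)
pose E2 := ~` xi_rect (wm_U M) 2 (fun=> 1 - n%:R^-1).
pose E3t t := ~` xi_rect (wm_U M) t (fun=> 1 - (n%:R * n%:R)^-1).
pose E3 := \big[setU/set0]_(t < n) E3t t.+1.
have mR := @measurable_tr_gof_reject _ R _ n (fun t x => wm_Y M t x)
  (@measurable_Y _ _ _ _ _ M) c s delta L0.
have p2 : pr (wm_Pr M) E2 <= #|W|%:R / n%:R by exact: pr_U_gt.
have mE2 : measurable E2 by exact/measurableC/measurable_xi_rect.
have mE3t (t : 'I_n) : measurable (E3t t.+1).
  exact/measurableC/measurable_xi_rect.
have mE3 : measurable E3 by exact: bigsetU_measurable.
have p3 : pr (wm_Pr M) E3 <= #|W|%:R / n%:R.
  apply: le_trans (pr_bigsetU_le _ _ _ mE3t) _.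
  apply: (@le_trans _ _ (\sum_(t < n) (#|W|%:R * (n%:R * n%:R)^-1))).
    by apply: ler_sum => t _; apply: pr_U_gt => //=.
  rewrite sumr_const card_ord -[_ *+ n]mulr_natr invfM -!mulrA mulVf ?mulr1//.
  by rewrite gt_eqF.
apply: le_trans (lerD p1 (lerD p2 p3)).
apply: le_trans (lerD (lexx _) (prUle _ mE2 mE3)).
apply: le_trans (prUle _ mE1 (measurableU _ _ mE2 mE3)); apply: pr_le.
- exact: measurableC.
- by apply: measurableU => //; exact: measurableU.
move=> x nR; apply: contrapT => /not_orP[nE1 /not_orP[nE2 nE3]].
apply: nR; apply/(tr_gof_rejectP _ _ _ L0).
set l := [seq _ | t <- iota 1 n].
have sl : size l = n by rewrite size_map size_iota.
have l_gt0 p : p \in l -> 0 < p.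
  move=> /mapP[t]; rewrite mem_iota => /andP[t1 tn] ->.
  have tn' : (t.-1 < n)%N by rewrite prednK// -ltnS.
  have : xi_rect (wm_U M) t (fun=> 1 - (n%:R * n%:R)^-1) x.
    apply: contrapT => h; apply: nE3; apply/bigsetU_seqE; exists (Ordinal tn').
    by split => //; rewrite /E3t/= prednK.
  move=> /(_ (wm_tok M t x)) h; rewrite subr_gt0; apply: le_lt_trans h _.
  by rewrite gtrBl.
have p2_gt : n%:R^-1 <= 1 - wm_Y M 2 x.
  have : xi_rect (wm_U M) 2 (fun=> 1 - n%:R^-1) x by apply: contrapT => h; exact: nE2.
  by move=> /(_ (wm_tok M 2 x)) h; rewrite lerBrDr -lerBrDl.
pose T := count (fun p : R => (p <= v)%R) l.
have Tm : m < T%:R.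
  have hm : m < (\sum_(j < n.-1) (r < wm_Y M (2 + j) x)%R)%N%:R.
    by rewrite ltNge; apply/negP => h; exact: nE1.
  apply: lt_le_trans hm _; rewrite ler_nat /T /l count_pvalues.
  apply: leq_trans (sum_shift_le (fun t => (1 - wm_Y M t.+1 x <= v)%R : nat) n1).
  apply: leq_sum => j _; rewrite -[j.+2]/(2 + j)%N.
  case: (ltP r (wm_Y M (2 + j) x)) => // h.
  by rewrite lerBlDr -lerBlDl -/v -/r (ltW h).
(* The cap keeps [k / n < 1]. The order statistic following rank [k] must reach [c]: for [T < n] it
   exceeds [v >= 1 / n], and for [T = n] it is the largest p-value, at least that of round 2. *)
pose k := minn T n.-1.
have k0 : (0 < k)%N.
  rewrite leq_min; apply/andP; split; last by rewrite -ltnS prednK.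
  by rewrite -(ltr_nat R); exact: lt_trans Tm.
have kn' : (k < n)%N by rewrite /k (leq_ltn_trans (geq_minr _ _))// ltn_predL.
have km : m <= k%:R.
  have [hT|hT] := leqP T n.-1; first by rewrite /k (minn_idPl hT) ltW.
  by rewrite /k (minn_idPr (ltnW hT)) -subn1 natrB.
have kE : (k.-1).+1 = k by rewrite prednK.
have kn1 : (k.-1 < n)%N by rewrite kE ltnW.
exists (Ordinal kn1); rewrite /= kE.
have pk : nth 1 (sort <=%R l) k.-1 <= v.
  by apply: nth_sort_le => //; exact: geq_minl.
split.
  apply: le_trans c1 _.
  have [hT|hT] := leqP T n.-1.
    have -> : k = T by rewrite /k (minn_idPl hT).
    have : v < nth 1 (sort <=%R l) T.
      by apply: nth_sort_gt; rewrite sl -/T (leq_ltn_trans hT)// ltn_predL.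
    by move=> /ltW; exact: le_trans.
  have -> : k = n.-1 by rewrite /k (minn_idPr (ltnW hT)).
  apply: le_trans p2_gt _.
  have : 1 - wm_Y M 2 x \in sort <=%R l.
    by rewrite mem_sort; apply: (map_f (fun t => 1 - wm_Y M t x)); rewrite mem_iota.
  move=> /(nthP 1)[i]; rewrite size_sort sl => iN <-.
  apply: (@sorted_leq_nth _ <=%R le_trans le_refl).
  - exact: (sort_sorted le_total).
  - by rewrite inE size_sort sl.
  - by rewrite inE size_sort sl ltn_predL.
  - by rewrite -ltnS prednK.
have p0 : 0 < nth 1 (sort <=%R l) k.-1.
  by apply: l_gt0; rewrite -(mem_sort <=%R); apply: mem_nth; rewrite size_sort sl.
apply: le_trans hL _; apply: (@K_s_signal _ _ _ v) => //.
- by rewrite ler_pdivlMr// mulrC.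
- by rewrite ltr_pdivrMr// mul1r ltr_nat.
Qed.

(** The right side is at least a constant times [n ^ g = expR (g * ln n)], which dominates the
    square of [ln n], hence any multiple of [1 + ln (ln n)]. *)
Lemma near_signal_ge (p q : R) (eps Delta : nat -> R) (D : R) :
  0 < 1 - (q + 2 * p) -> 0 <= D ->
  asymp (fun n => n%:R `^ (- p)) eps -> asymp (fun n => n%:R `^ (- q)) Delta ->
  exists N, forall n, (N <= n)%N ->
    D * (1 + ln (ln n%:R)) <= n%:R * (eps n ^+ 2 * Delta n).
Proof.
move=> g0 D0 [C1 [C1' [C10 [_ hC1]]]] [C2 [C2' [C20 [_ hC2]]]].
pose g := 1 - (q + 2 * p).
pose C := C1 ^+ 2 * C2; have C0 : 0 < C by rewrite mulr_gt0// exprn_gt0.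
have Cg0 : 0 < C * g ^+ 2 by rewrite mulr_gt0// exprn_gt0.
have [N hN] := @near_ln_ge R (1 + 4 * D / (C * g ^+ 2)).
exists (N + 1)%N => n Nn.
have z0 : 0 <= 4 * D / (C * g ^+ 2) by rewrite divr_ge0 ?mulr_ge0// ltW.
have n1 : (1 <= n)%N by apply: leq_trans Nn; rewrite addn1.
have := hN n (leq_trans (leq_addr _ _) Nn); set z := ln _ => hz.
have n0 : 0 < n%:R :> R by rewrite ltr0n.
have z1 : 1 <= z by lra.
have z4 : 4 * D / (C * g ^+ 2) <= z by lra.
have /andP[e1 _] := hC1 n n1; have /andP[d1 _] := hC2 n n1.
have lnz : ln z <= z by apply/ltW/ln_sublinear; lra.
apply: (@le_trans _ _ (C * (g * z) ^+ 2 / 2)).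
  apply: (@le_trans _ _ (2 * D * z)).
    have -> : 2 * D * z = D * (z + z) by ring.
    by rewrite ler_wpM2l//; lra.
  move: z4; rewrite ler_pdivrMr// => z4.
  have := ler_wpM2r (_ : 0 <= z) z4; rewrite exprMn => /(_ (le_trans ler01 z1)).
  lra.
apply: (@le_trans _ _ (C * n%:R `^ g)).
  rewrite -mulrA ler_pM2l// /powR ifF; last by rewrite gt_eqF.
  by apply: expR_ge_sqr; rewrite mulr_ge0 ?ltW//; lra.
have -> : C * n%:R `^ g = n%:R * ((C1 * n%:R `^ (- p)) ^+ 2 * (C2 * n%:R `^ (- q))).
  have -> : n%:R `^ g = n%:R * ((n%:R `^ (- p)) ^+ 2 * n%:R `^ (- q)).
    have pD (a b : R) : (n%:R : R) `^ (a + b) = n%:R `^ a * n%:R `^ b.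
      by rewrite powRD// (gt_eqF n0) implybT.
    rewrite expr2 -!pD; transitivity ((n%:R : R) `^ 1 * n%:R `^ (- p - p - q)).
      by rewrite -pD; congr (_ `^ _); rewrite /g; ring.
    by rewrite powRr1// ltW.
  by rewrite /C; ring.
rewrite ler_pM2l//; apply: ler_pM.
- exact: sqr_ge0.
- by rewrite mulr_ge0 ?powR_ge0// ltW.
- rewrite ler_sqr ?nnegrE//; first by rewrite mulr_ge0 ?powR_ge0// ltW.
  by apply: le_trans e1; rewrite mulr_ge0 ?powR_ge0// ltW.
- exact: d1.
Qed.

Lemma type2_error (p q delta s e : R) (eps Delta c : nat -> R)
    (M : forall n, wm_model W n (eps n) (Delta n)) :
  0 < 1 - (q + 2 * p) -> 0 < delta -> -1 <= s <= 2 -> 0 < e ->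
  (forall n, 0 <= c n <= n%:R^-1) ->
  asymp (fun n => n%:R `^ (- p)) eps -> asymp (fun n => n%:R `^ (- q)) Delta ->
  exists N, forall n, (N <= n)%N ->
    pr (wm_Pr (M n)) [set x | ~ tr_gof_reject n (c n) s delta (fun t => wm_Y (M n) t x)] <= e.
Proof.
move=> g0 d0 hs e0 hc heps hDelta.
(* All requirements are lower bounds on [Q = n * eps ^+ 2 * Delta]. In order: the side conditions of
   [type2_bound], the rejection threshold, and the Chernoff term being at most [e / 2]. *)
have [D Dge [D72 Ddelta De]] : exists2 D : R, 0 <= D & [/\ 72 <= D,
    2 * 36 ^+ 2 * (1 + delta) <= D & 2 * 72 ^+ 2 / (e / 2) <= D].
  have h1 : 0 <= 2 * 36 ^+ 2 * (1 + delta) :> R.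
    by rewrite mulr_ge0 ?mulr_ge0 ?exprn_ge0 ?addr_ge0// ltW.
  have h2 : 0 <= 2 * 72 ^+ 2 / (e / 2) :> R.
    by rewrite divr_ge0 ?divr_ge0 ?mulr_ge0 ?exprn_ge0// ltW.
  exists (72 + 2 * 36 ^+ 2 * (1 + delta) + 2 * 72 ^+ 2 / (e / 2)).
    by rewrite addr_ge0// addr_ge0.
  split.
  - by rewrite -addrA lerDl addr_ge0.
  - by rewrite addrAC lerDr addr_ge0.
  - by rewrite lerDr addr_ge0.
have [N1 hN1] := near_signal_ge g0 Dge heps hDelta.
have [N2 hN2] := @near_lnln_ge R 1.
exists (N1 + N2 + (4 + Num.bound (4 * #|W|%:R / e)))%N => n Nn.
have hQ := hN1 n (leq_trans (leq_trans (leq_addr _ _) (leq_addr _ _)) Nn).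
have L1 := hN2 n (leq_trans (leq_trans (leq_addl _ _) (leq_addr _ _)) Nn).
have nW := leq_trans (leq_addl _ _) Nn.
have n4 := leq_trans (leq_addr _ _) nW.
have {}nW := leq_trans (leq_addl _ _) nW.
have n1 : (1 <= n)%N by apply: leq_trans n4.
have t1n : (1 <= 1 <= n)%N by [].
have N0 : 0 < n%:R :> R by rewrite ltr0n.
have [C2 [C2' [C20 [_ hC2]]]] := hDelta.
have D0 : 0 < Delta n.
  have /andP[+ _] := hC2 n n1; apply: lt_le_trans.
  by rewrite mulr_gt0// powR_gt0.
have /andP[ep0 ep1] := eps01 (M n) t1n.
pose Q := n%:R * (eps n ^+ 2 * Delta n); rewrite -/Q in hQ.
have L0 : 0 < ln (ln (n%:R : R)) by apply: lt_le_trans L1.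
have DQ : D <= Q.
  by apply: le_trans hQ; rewrite ler_peMr// lerDl ltW.
have DLQ : D * ln (ln n%:R) <= Q.
  by apply: le_trans hQ; rewrite ler_wpM2l// lerDr.
have Q0 : 0 < Q by apply: lt_le_trans DQ; apply: lt_le_trans D72.
have Q1 : Q <= n%:R * (eps n * Delta n).
  by rewrite ler_pM2l// ler_pM2r// expr2 ler_piMl.
have Q2 : Q <= n%:R * Delta n.
  by apply: le_trans Q1 _; rewrite ler_pM2l// ler_piMl// ltW.
have neD : 72 <= n%:R * (eps n * Delta n) by apply: le_trans D72 (le_trans DQ Q1).
have nD : 2 <= n%:R * Delta n.
  by apply: le_trans (le_trans DQ Q2); apply: le_trans D72; rewrite ler_nat.
have /andP[_ c1] := hc n.
have th0 : 0 < (1 + delta) * ln (ln n%:R) by rewrite mulr_gt0// addr_gt0.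
have hL : (1 + delta) * ln (ln n%:R) <=
    n%:R * ((eps n * Delta n / 36) ^+ 2 / (2 * Delta n)).
  have -> : n%:R * ((eps n * Delta n / 36) ^+ 2 / (2 * Delta n)) = Q / (2 * 36 ^+ 2).
    by rewrite /Q; field; rewrite gt_eqF.
  rewrite ler_pdivlMr ?mulr_gt0 ?exprn_gt0// mulrC mulrA.
  by apply: le_trans DLQ; rewrite ler_pM2r.
apply: le_trans (type2_bound (M n) hs D0 n4 c1 th0 nD neD hL) _.
have b1 : expR (- (n%:R * ((eps n / 72) ^+ 2 * Delta n) / 2)) <= e / 2.
  have -> : n%:R * ((eps n / 72) ^+ 2 * Delta n) / 2 = Q / (2 * 72 ^+ 2).
    by rewrite /Q; field.
  apply: le_trans (expRN_le_inv _) _.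
    by rewrite divr_gt0// mulr_gt0// exprn_gt0.
  rewrite invf_div ler_pdivrMr// -ler_pdivrMl ?divr_gt0// [leLHS]mulrC.
  exact: le_trans De DQ.
have b2 : #|W|%:R / n%:R <= e / 4.
  rewrite ler_pdivrMr// mulrAC ler_pdivlMr// mulrC (mulrC e) -ler_pdivrMr//.
  apply: ltW; apply: lt_le_trans (archi_boundP _) _.
    by rewrite divr_ge0 ?mulr_ge0// ltW.
  by rewrite ler_nat.
rewrite (splitr e); apply: lerD => //.
have -> : e / 2 = e / 4 + e / 4 by field.
exact: lerD.
Qed.

End TypeII.

Unset Implicit Arguments.
Set Strict Implicit.
Set Printing Implicit Defensive.

Theorem theorem4p3 (R : realType) (W : finType) (p q : R)
  (eps Delta c : nat -> R) (delta s : R)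
  (hp : 0 <= p) (hq0 : 0 <= q) (hq1 : q <= 1) (hpq : q + 2 * p < 1)
  (heps : asymp (fun n => n%:R `^ (- p)) eps)
  (hDelta : asymp (fun n => n%:R `^ (- q)) Delta)
  (hdelta : 0 < delta) (hs : -1 <= s <= 2)
  (hc : forall n : nat, 0 <= c n <= n%:R^-1)
  (M : forall n : nat, wm_model W n (eps n) (Delta n))
  (H0 : forall n : nat, null_model R n) :
  (fun n : nat =>
     fine (nm_Pr (H0 n)
             [set x | tr_gof_reject n (c n) s delta (fun t => nm_Y (H0 n) t x)])
     + fine (wm_Pr (M n)
             [set x | ~ tr_gof_reject n (c n) s delta (fun t => wm_Y (M n) t x)]))
  @ \oo --> 0.
Proof.
apply/cvgrPdist_le => e e0.
have e20 : 0 < e / 2 by rewrite divr_gt0.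
(* The Type I analysis assumes [delta <= 1]; a smaller [delta] only enlarges the rejection region,
   so bounding the error for [d] suffices. *)
pose d := Num.min delta 1.
have d01 : 0 < d <= 1 by rewrite lt_min hdelta ltr01 ge_min lexx orbT.
have g0 : 0 < 1 - (q + 2 * p) by rewrite subr_gt0.
have [N1 h1] := type1_error c H0 d01 hs e20.
have [N2 h2] := type2_error M g0 hdelta hs e20 hc heps hDelta.
have [N3 h3] := @near_lnln_ge R 1.
exists (N1 + N2 + N3)%N => // n /= Nn.
have {}h1 := h1 n (leq_trans (leq_trans (leq_addr _ _) (leq_addr _ _)) Nn).
have {}h2 := h2 n (leq_trans (leq_trans (leq_addl _ _) (leq_addr _ _)) Nn).
have L1 := h3 n (leq_trans (leq_addl _ _) Nn).
have L0 : 0 < ln (ln (n%:R : R)) by apply: lt_le_trans L1.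
have dL (x : R) : 0 < x -> 0 < (1 + x) * ln (ln n%:R).
  by move=> x0; rewrite mulr_gt0// addr_gt0.
have mI x : 0 < x -> measurable
    [set om | tr_gof_reject n (c n) s x (fun t => nm_Y (H0 n) t om)].
  by move=> x0; exact: (measurable_tr_gof_reject (@nm_Y_meas _ _ (H0 n)) (c n) s (dL x x0)).
have h1' : pr (nm_Pr (H0 n))
    [set x | tr_gof_reject n (c n) s delta (fun t => nm_Y (H0 n) t x)] <= e / 2.
  apply: le_trans h1; apply: pr_le; [exact: mI|by apply: mI; case/andP: d01|].
  move=> x; apply: le_trans; rewrite ler_pM2r// lerD2l.
  by rewrite ge_min lexx.
rewrite sub0r normrN ger0_norm; last by rewrite addr_ge0// pr_ge0.
by rewrite (splitr e); exact: lerD.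
Qed.
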